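(* If $A$ is a postliminal $C^*$-algebra or an AF-algebra, then $\overline{[A,A]}\subseteq\mathrm{CQ}(A)$.
   Context: $A$ is not assumed unital. ''Ideal'' means closed two-sided ideal; $Z(A)$ is the centre of $A$. An element $a\in A$ is a CQ-element of $A$ if for every ideal $I$ of $A$, $a+I\in Z(A/I)$ implies $a\in Z(A)+I$; $\mathrm{CQ}(A)$ is the set of all CQ-elements of $A$. $[A,A]$ is the linear span of all commutators $[a,b]=ab-ba$ ($a,b\in A$) and $\overline{[A,A]}$ is its norm-closure. Postliminal means GCR (type I); AF means approximately finite-dimensional. *)

(* Defs.v *)
From HB Require Import structures.
From mathcomp Require Import all_boot all_order all_algebra.
From mathcomp Require Import complex.
From mathcomp Require Import boolp classical_sets cardinality reals topology normedtype.
Set Implicit Arguments.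
Unset Strict Implicit.
Unset Printing Implicit Defensive.
Import Order.TTheory GRing.Theory Num.Theory numFieldNormedType.Exports.

Declare Scope cstar_scope.
Delimit Scope cstar_scope with cstar.
Local Open Scope classical_set_scope.
Local Open Scope ring_scope.
Local Open Scope complex_scope.
Local Open Scope cstar_scope.

(* No unit is assumed, so the product cannot come from the MathComp rings,
   which are all unital. *)
HB.mixin Record isCStarAlgebra (R : realType) A
    of CompleteNormedModule R[i] A := {
  cmul : A -> A -> A;
  cstar : A -> A;
  cmulA : forall a b c, cmul a (cmul b c) = cmul (cmul a b) c;
  cmulDl : forall a b c, cmul (a + b) c = cmul a c + cmul b c;
  cmulDr : forall a b c, cmul a (b + c) = cmul a b + cmul a c;
  cmulZl : forall (k : R[i]) a b, cmul (k *: a) b = k *: cmul a b;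
  cmulZr : forall (k : R[i]) a b, cmul a (k *: b) = k *: cmul a b;
  cstarK : forall a, cstar (cstar a) = a;
  cstarD : forall a b, cstar (a + b) = cstar a + cstar b;
  cstarZ : forall (k : R[i]) a, cstar (k *: a) = Num.conj k *: cstar a;
  cstarM : forall a b, cstar (cmul a b) = cmul (cstar b) (cstar a);
  cnormM : forall a b, `|cmul a b| <= `|a| * `|b|;
  cnorm_star : forall a, `|cmul (cstar a) a| = `|a| ^+ 2
}.

#[short(type="cstarAlgType")]
HB.structure Definition CStarAlgebra (R : realType) :=
  {A of isCStarAlgebra R A & CompleteNormedModule R[i] A}.

Notation "a ** b" := (cmul a b)
  (at level 40, left associativity) : cstar_scope.

HB.mixin Record isHilbert (R : realType) H of CompleteNormedModule R[i] H := {
  inner : H -> H -> R[i];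
  innerDl : forall x y z, inner (x + y) z = inner x z + inner y z;
  innerZl : forall (k : R[i]) x y, inner (k *: x) y = k * inner x y;
  innerC : forall x y, inner y x = Num.conj (inner x y);
  inner_norm : forall x, inner x x = `|x| ^+ 2
}.

#[short(type="hilbertType")]
HB.structure Definition Hilbert (R : realType) :=
  {H of isHilbert R H & CompleteNormedModule R[i] H}.

Definition is_subspace (R : realType) (V : lmodType R[i]) (S : set V) : Prop :=
  [/\ S 0, forall x y, S x -> S y -> S (x + y)
     & forall (k : R[i]) x, S x -> S (k *: x)].

Definition lin_span (R : realType) (V : lmodType R[i]) (S : set V) : set V :=
  [set x | exists (n : nat) (k : 'I_n -> R[i]) (v : 'I_n -> V),
      (forall i, S (v i)) /\ x = \sum_(i < n) k i *: v i].

Section CStarNotions.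
Variables (R : realType) (A : cstarAlgType R).
Implicit Types (a b : A) (I B : set A).

Definition is_ideal I : Prop :=
  [/\ is_subspace I, forall a b, I b -> I (a ** b) /\ I (b ** a) & closed I].

Definition centre : set A := [set z | forall b, z ** b = b ** z].

Definition coset I a : set A := [set a + i | i in I].

(* a + I lies in Z(A/I).  The elements of A/I are the cosets of I, with
   (a + I)(b + I) = ab + I. *)
Definition central_mod I a : Prop :=
  forall b, coset I (a ** b) = coset I (b ** a).

Definition CQ : set A :=
  [set a | forall I, is_ideal I -> central_mod I a ->
     exists z i, [/\ centre z, I i & a = z + i]].

Definition commutators : set A :=
  [set x | exists a b, x = a ** b - b ** a].

Definition fd_cstar_subalgebra B : Prop :=
  [/\ is_subspace B,
      forall a b, B a -> B b -> B (a ** b),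
      forall a, B a -> B (cstar a)
    & exists2 S : set A, finite_set S & B = lin_span S].

Definition AF_algebra : Prop :=
  exists B : nat -> set A,
    [/\ forall n, fd_cstar_subalgebra (B n),
        forall n, B n `<=` B n.+1
      & closure (\bigcup_n B n) = setT].

Definition is_representation (H : hilbertType R) (pi : A -> {linear H -> H}) :
    Prop :=
  [/\ forall a, continuous (pi a),
      forall a b x, pi (a + b) x = pi a x + pi b x,
      forall (k : R[i]) a x, pi (k *: a) x = k *: pi a x,
      forall a b x, pi (a ** b) x = pi a (pi b x)
    & forall a x y, inner (pi (cstar a) x) y = inner x (pi a y)].

(* The zero representation is not irreducible, so H <> 0. *)
Definition is_irreducible (H : hilbertType R) (pi : A -> {linear H -> H}) :
    Prop :=
  [/\ is_representation pi,
      exists a x, pi a x <> 0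
    & forall L : set H, is_subspace L -> closed L ->
        (forall a x, L x -> L (pi a x)) -> L = [set 0] \/ L = setT].

Definition compact_operator (H : hilbertType R) (T : {linear H -> H}) : Prop :=
  compact (closure (T @` [set x : H | `|x| <= 1])).

(* GCR: pi(A) contains all compact operators of H, for every irreducible
   representation pi of A on a Hilbert space H. *)
Definition postliminal : Prop :=
  forall (H : hilbertType R) (pi : A -> {linear H -> H}),
    is_irreducible pi ->
    forall T : {linear H -> H}, compact_operator T -> exists a, pi a =1 T.

End CStarNotions.

Arguments CQ {R} A.
Arguments centre {R} A.
Arguments commutators {R} A.
Arguments AF_algebra {R} A.
Arguments postliminal {R} A.

(* Main.v *)
(** Let [a] be in the closure of [[A, A]] and central modulo the ideal [I]; then
    already [a] is in [I], so that [a = 0 + a].  Otherwise rescale [a] so that its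
    distance to [I] is at least 1.  For every ideal [M] above [I] that is still at
    distance at least 1 from [a], a pure state of [A / M] of maximal value at
    [a^* a] gives an irreducible representation [pi] that kills [M] and, by Schur's
    lemma, maps [a] to a scalar [l] with [|l| >= 1].

    If [A] is AF, take [M = I] and approximate [a] by a combination [x] of
    commutators of a finite-dimensional subalgebra [B].  On the finite-dimensional
    space [pi(B) v] the operator [pi(x)] has trace 0 but is close to [l].

    If [A] is postliminal, take [M] maximal.  If the Hilbert space of [pi] is
    finite-dimensional, the same trace argument applies.  If not, the closure [J] of
    the elements acting with finite rank is an ideal that is still at distance at
    least 1 from [a], because a finite rank operator has a kernel; it is strictly
    larger than [M], because [pi(A)] contains the operators of rank one.

    Positivity is developed in the unitization: [h >= 0] means [|c - h| <= c] for
    some [c >= 0].  The pure states come from Zorn's lemma applied to sublinear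
    functionals instead of the Krein-Milman theorem. *)

Require Import Defs.
From HB Require Import structures.
From mathcomp Require Import all_boot all_order all_algebra.
From mathcomp Require Import complex ring lra.
From mathcomp Require Import boolp classical_sets cardinality reals topology normedtype.
Set Implicit Arguments.
Unset Strict Implicit.
Unset Printing Implicit Defensive.
Import Order.TTheory GRing.Theory Num.Theory numFieldNormedType.Exports.
Local Open Scope classical_set_scope.
Local Open Scope ring_scope.
Local Open Scope complex_scope.
Local Open Scope cstar_scope.

(** * Linear identities by reflection *)

(** Some trace has to enter: in the Cuntz algebra O_2 the unit is a sum of two commutators and is
    central, so [a] need not lie in [I] for general [A]. The trace lives on a finite-dimensional
    subspace of a representation space, and the state serves to make [a] act there as a scalar
    bounded away from 0. The quotient A / M is never formed. Its order and norm are expressed inside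
    the unitization, by inequalities up to an element of [M] and by distances to [M]; an approximate
    unit of [M] turns the former into the latter. Functional calculus is replaced by square roots
    obtained from a contraction. They exist for strictly positive elements, which is why most
    estimates carry an extra [e] or [d]. Positivity of [st x * x], on which the GNS form rests, has
    to be proved with these means. Schur's lemma and irreducibility are both read off from purity: a
    positive functional dominated by the state [F] is a multiple of [F]. Applied to [F (c * y)] with
    [c] central modulo [M], this makes [c] act as a scalar; applied to the projection of the cyclic
    vector to a closed invariant subspace, it gives irreducibility. *)

Section LinearReflection.
Variables (K : fieldType) (V : lmodType K).

Inductive lexp := LVar of nat | LZero | LAdd of lexp & lexp | LOpp of lexp
  | LScale of K & lexp | LMuln of nat & lexp.

Fixpoint leval (env : seq V) (e : lexp) : V :=
  match e with
  | LVar n => nth 0 env n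
  | LZero => 0
  | LAdd a b => leval env a + leval env b
  | LOpp a => - leval env a
  | LScale k a => k *: leval env a
  | LMuln n a => leval env a *+ n
  end.

(** [eqn] in place of [==] lets [cbn] compute the coefficients of a reified term down to field
    expressions. *)
Fixpoint lcoef (e : lexp) (i : nat) : K :=
  match e with
  | LVar n => if eqn n i then 1 else 0
  | LZero => 0
  | LAdd a b => lcoef a i + lcoef b i
  | LOpp a => - lcoef a i
  | LScale k a => k * lcoef a i
  | LMuln n a => n%:R * lcoef a i
  end.

Fixpoint lwf (s : nat) (e : lexp) : bool :=
  match e with
  | LVar n => (n < s)%N
  | LZero => true
  | LAdd a b => lwf s a && lwf s b
  | LOpp a | LScale _ a | LMuln _ a => lwf s a
  end.

Lemma leval_coef env e : lwf (size env) e ->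
  leval env e = \sum_(i < size env) lcoef e i *: nth 0 env i.
Proof.
elim: e => [n|| a IHa b IHb | a IHa | k a IHa | n a IHa] /=.
- move=> ns; rewrite (bigD1 (Ordinal ns)) //= big1 ?addr0.
    by rewrite (_ : eqn n n = true) ?scale1r //; exact: eqxx.
  move=> i /negP ni; case: ifP => [e|]; last by rewrite scale0r.
  by case: ni; apply/eqP/val_inj/esym/eqP.
- by move=> _; rewrite big1 // => i _; rewrite scale0r.
- case/andP=> /IHa-> /IHb->; rewrite -big_split /=.
  by apply: eq_bigr => i _; rewrite scalerDl.
- move=> /IHa->; rewrite -sumrN.
  by apply: eq_bigr => i _; rewrite scaleNr.
- move=> /IHa->; rewrite scaler_sumr.
  by apply: eq_bigr => i _; rewrite scalerA.
- move=> /IHa->; rewrite -sumrMnl.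
  by apply: eq_bigr => i _; rewrite -scalerA scaler_nat.
Qed.

Fixpoint lcoefs_eq (s : nat) (e f : lexp) : Prop :=
  if s is s'.+1 then lcoef e s' = lcoef f s' /\ lcoefs_eq s' e f else True.

Lemma leval_eq env e f : lwf (size env) e -> lwf (size env) f ->
  lcoefs_eq (size env) e f -> leval env e = leval env f.
Proof.
move=> we wf ef; rewrite !leval_coef //; apply: eq_bigr => i _; congr (_ *: _).
case: i => i /=; elim: (size env) ef => //= s IH [es /IH{}IH].
by rewrite ltnS leq_eqVlt => /orP[/eqP->|/IH].
Qed.
End LinearReflection.

Ltac lin_mem x l :=
  lazymatch l with
  | nil => constr:(false)
  | cons ?y ?l' =>
      match True with
      | _ => let _ := match True with _ => unify x y end in constr:(true)
      | _ => lin_mem x l'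
      end
  end.
Ltac lin_idx x l :=
  lazymatch l with
  | cons ?y ?l' =>
      match True with
      | _ => let _ := match True with _ => unify x y end in constr:(0%N)
      | _ => let n := lin_idx x l' in constr:(S n)
      end
  end.
Ltac lin_atoms l t :=
  lazymatch t with
  | @GRing.add _ ?a ?b => let l1 := lin_atoms l a in lin_atoms l1 b
  | @GRing.opp _ ?a => lin_atoms l a
  | @GRing.scale _ _ _ ?a => lin_atoms l a
  | @GRing.natmul _ ?a _ => lin_atoms l a
  | @GRing.zero _ => l
  | _ => let b := lin_mem t l in
         lazymatch b with true => l | false => constr:(cons t l) end
  end.
Ltac lin_reify K l t :=
  lazymatch t with
  | @GRing.add _ ?a ?b =>
      let x := lin_reify K l a in let y := lin_reify K l b in
      constr:(@LAdd K x y)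
  | @GRing.opp _ ?a => let x := lin_reify K l a in constr:(@LOpp K x)
  | @GRing.scale _ _ ?k ?a => let x := lin_reify K l a in constr:(@LScale K k x)
  | @GRing.natmul _ ?a ?n => let x := lin_reify K l a in constr:(@LMuln K n x)
  | @GRing.zero _ => constr:(@LZero K)
  | _ => let n := lin_idx t l in constr:(@LVar K n)
  end.
(** Atoms are identified by [unify], hence up to conversion; the scalar identity for each atom is
    left to [ring] or [field]. *)
Ltac linear_eq K V :=
  lazymatch goal with
  | |- ?a = ?b =>
      let l0 := lin_atoms (@nil V) a in
      let l := lin_atoms l0 b in
      let x := lin_reify K l a in
      let y := lin_reify K l b in
      apply: (@leval_eq K V l x y);
      [ exact: isT | exact: isT
      | cbn [lcoefs_eq size lcoef eqn]; repeat split; try (by []); try ring;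
        try (field; by rewrite ?pnatr_eq0) ]
  end.

(** * Positivity in unital C*-algebras *)

Notation cabs := (ComplexField.Normc.normc).

(* The last clause is completeness, restricted to geometrically converging
   sequences; two consecutive terms near the limit are what a fixed point
   iteration needs. *)
Record unital_cstar (R : realType) (U : algType R[i]) (st : U -> U) (nr : U -> R)
    : Prop := UnitalCStar {
  stK : forall a, st (st a) = a;
  stD : forall a b, st (a + b) = st a + st b;
  stZ : forall k a, st (k *: a) = Num.conj k *: st a;
  stM : forall a b, st (a * b) = st b * st a;
  nr_ge0 : forall a, 0 <= nr a;
  nr_eq0 : forall a, nr a = 0 -> a = 0;
  nrD : forall a b, nr (a + b) <= nr a + nr b;
  nrZ : forall k a, nr (k *: a) = cabs k * nr a;
  nrM : forall a b, nr (a * b) <= nr a * nr b;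
  nr_stM : forall a, nr (st a * a) = nr a ^+ 2;
  nr_complete : forall (u : nat -> U) (r : R), 0 <= r < 1 ->
    (forall n, nr (u n.+1 - u n) <= r ^+ n) ->
    exists l, forall e, 0 < e -> exists n, nr (u n - l) <= e /\ nr (u n.+1 - l) <= e
}.

Lemma cabs_real (R : realType) (r : R) : cabs r%:C = `|r|.
Proof. by rewrite /= expr0n addr0 sqrtr_sqr. Qed.

Lemma conj_real (R : realType) (r : R) : Num.conj r%:C = r%:C :> R[i].
Proof. exact: conjc_real. Qed.

Section UnitalCStar.
Variables (R : realType) (U : algType R[i]) (st : U -> U) (nr : U -> R).
Hypothesis H : unital_cstar st nr.
Implicit Types (a b h x y z s t : U) (c d e r : R).

Local Notation "c %:U" := (c%:C *: (1 : U)) (at level 2, format "c %:U").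
Ltac lin := linear_eq (R[i] : fieldType) U.

Let stK := stK H.
Let stD := stD H.
Let stZ := stZ H.
Let stM := stM H.
Let nr_ge0 := nr_ge0 H.
Let nrD := nrD H.
Let nrZ := nrZ H.
Let nrM := nrM H.

Definition sa h := st h = h.

Lemma st0 : st 0 = 0.
Proof. by rewrite -(scale0r (0 : U)) stZ rmorph0 !scale0r. Qed.
Lemma stN x : st (- x) = - st x.
Proof. by rewrite -scaleN1r stZ rmorphN rmorph1 scaleN1r. Qed.
Lemma stB x y : st (x - y) = st x - st y.
Proof. by rewrite stD stN. Qed.
Lemma st1 : st 1 = 1.
Proof. by rewrite -[LHS]mulr1 -{2}[1]stK -stM mulr1 stK. Qed.
Lemma stZr c x : st (c%:C *: x) = c%:C *: st x.
Proof. by rewrite stZ conj_real. Qed.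

Lemma saD x y : sa x -> sa y -> sa (x + y).
Proof. by move=> hx hy; rewrite /sa stD hx hy. Qed.
Lemma saN x : sa x -> sa (- x).
Proof. by move=> hx; rewrite /sa stN hx. Qed.
Lemma saB x y : sa x -> sa y -> sa (x - y).
Proof. by move=> hx hy; rewrite /sa stB hx hy. Qed.
Lemma saZ c x : sa x -> sa (c%:C *: x).
Proof. by move=> hx; rewrite /sa stZr hx. Qed.
Lemma sa1 : sa 1. Proof. exact: st1. Qed.
Lemma saC c : sa c%:U. Proof. exact/saZ/sa1. Qed.
Lemma saM x y : sa x -> sa y -> x * y = y * x -> sa (x * y).
Proof. by move=> hx hy xy; rewrite /sa stM hx hy xy. Qed.
Lemma sa_stM x : sa (st x * x).
Proof. by rewrite /sa stM stK. Qed.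
Lemma sa_conj x h : sa h -> sa (st x * h * x).
Proof. by move=> hh; rewrite /sa !stM stK hh mulrA. Qed.

Lemma nr0 : nr 0 = 0.
Proof. by rewrite -(scale0r (0 : U)) nrZ ComplexField.Normc.normc0 mul0r. Qed.
Lemma nrZr c x : nr (c%:C *: x) = `|c| * nr x.
Proof. by rewrite nrZ cabs_real. Qed.
Lemma nrN x : nr (- x) = nr x.
Proof.
have -> : - x = (-1 : R)%:C *: x by rewrite rmorphN rmorph1 scaleN1r.
by rewrite nrZr normrN normr1 mul1r.
Qed.
Lemma nrB x y : nr (x - y) <= nr x + nr y.
Proof. by apply: le_trans (nrD _ _) _; rewrite nrN. Qed.
Lemma nrBC x y : nr (x - y) = nr (y - x).
Proof. by rewrite -nrN opprB. Qed.
Lemma nr1 : nr 1 = 1.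
Proof.
have := nr_stM H 1; rewrite mulr1 st1 => /eqP; rewrite expr2 -subr_eq0.
rewrite -[X in X - _]mul1r -mulrBl mulf_eq0 => /orP[|/eqP/(nr_eq0 H)/eqP].
  by rewrite subr_eq0 => /eqP.
by rewrite oner_eq0.
Qed.
Lemma nrC c : nr c%:U = `|c|.
Proof. by rewrite nrZr nr1 mulr1. Qed.
Lemma nr_st x : nr (st x) = nr x.
Proof.
have le y : nr y <= nr (st y).
  have := nr_stM H y; have := nrM (st y) y; have := nr_ge0 y; have := nr_ge0 (st y).
  move=> ? y0 h e; move: y0; rewrite le_eqVlt => /orP[/eqP<- //|y0].
  by rewrite -(ler_pM2r y0); rewrite -expr2 -e.
by apply/eqP; rewrite eq_le -{2}[x]stK !le.
Qed.
Lemma nr_sa_sq h : sa h -> nr (h * h) = nr h ^+ 2.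
Proof. by move=> hh; rewrite -{1}hh (nr_stM H). Qed.

Lemma nr_near0 x c : (forall e, 0 < e -> nr x <= e * c) -> x = 0.
Proof.
move=> h; apply: (nr_eq0 H); apply/eqP; rewrite eq_le nr_ge0 andbT.
apply/ler_addgt0Pl => e e0; rewrite addr0.
have c0 : 0 < `|c| + 1 by rewrite ltr_wpDl.
apply: le_trans (h (e / (`|c| + 1)) _) _; first exact: divr_gt0.
rewrite mulrAC -mulrA ler_piMr ?(ltW e0) // ler_pdivrMr // mul1r.
by have := ler_norm c; lra.
Qed.

(* [s = 1 - y], where [y] is the fixed point of the contraction [y |-> (h + y^2) / 2]. *)
Lemma sqrt_exists h : sa h -> nr h < 1 ->
  exists s, [/\ sa s, s * s = 1 - h, forall z, z * h = h * z -> z * s = s * z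
    & nr (1 - s) <= 1].
Proof.
move=> hh h1; set r := nr h in h1.
have r0 : 0 <= r := nr_ge0 h.
pose T y : U := (2^-1 : R)%:C *: (h + y * y).
pose u n : U := iter n T 0.
have nru n : nr (u n) <= r.
  elim: n => [|n IH]; first by rewrite nr0.
  rewrite /u iterS -/(u n) nrZr ger0_norm ?invr_ge0 //.
  have := nrD h (u n * u n); have := nrM (u n) (u n); have := nr_ge0 (u n).
  rewrite -/r; nra.
have sau n : sa (u n).
  elim: n => [|n IH]; first exact: st0.
  by apply: saZ; apply: saD => //; apply: saM.
have cu z n : z * h = h * z -> z * u n = u n * z.
  move=> zh; elim: n => [|n IH]; first by rewrite mul0r mulr0.
  rewrite /u iterS -/(u n) /T -scalerAr -scalerAl; congr (_ *: _).
  by rewrite mulrDr mulrDl zh mulrA IH -mulrA IH mulrA.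
(* Writing [x^2 - y^2] as [x (x - y) + (x - y) y] avoids any commutation of [x] and [y]. On the ball
   of radius [r] this makes [r] a Lipschitz constant. *)
have Tdist x y : nr x <= r -> nr y <= r -> nr (T x - T y) <= r * nr (x - y).
  move=> xr yr; have -> : T x - T y = (2^-1 : R)%:C *: (x * (x - y) + (x - y) * y).
    by rewrite /T mulrBr mulrBl; lin.
  rewrite nrZr ger0_norm ?invr_ge0 //.
  have := nrD (x * (x - y)) ((x - y) * y); have := nrM x (x - y).
  have := nrM (x - y) y; have := nr_ge0 (x - y); nra.
have du n : nr (u n.+1 - u n) <= r ^+ n.
  elim: n => [|n IH].
    by rewrite expr0 subr0; apply: le_trans (nru 1%N) _; exact: ltW.
  rewrite [u n.+2]iterS [u n.+1 in X in _ - X]iterS -/(u n.+1) -/(u n).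
  by apply: le_trans (Tdist _ _ _ _) _ => //; rewrite exprS ler_wpM2l.
have [|l lP] := nr_complete H (u := u) (r := r) _ du; first by rewrite r0.
have lr : nr l <= r.
  apply/ler_addgt0Pl => e /lP[n [ne _]].
  have -> : l = - (u n - l) + u n by lin.
  by apply: le_trans (nrD _ _) _; rewrite nrN lerD.
have sal : sa l.
  apply/eqP; rewrite -subr_eq0; apply/eqP; apply: (@nr_near0 _ 2) => e /lP[n [ne _]].
  have -> : st l - l = (u n - l) - st (u n - l) by rewrite stB sau; lin.
  by apply: le_trans (nrB _ _) _; rewrite nr_st; lra.
have cl z : z * h = h * z -> z * l = l * z.
  move=> zh; apply/eqP; rewrite -subr_eq0; apply/eqP.
  apply: (@nr_near0 _ (2 * nr z)) => e /lP[n [ne _]].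
  have -> : z * l - l * z = (u n - l) * z - z * (u n - l).
    by rewrite mulrBl mulrBr (cu _ _ zh); lin.
  apply: le_trans (nrB _ _) _.
  have := nrM (u n - l) z; have := nrM z (u n - l); have := nr_ge0 z; nra.
have Tl : T l = l.
  apply/eqP; rewrite -subr_eq0; apply/eqP; apply: (@nr_near0 _ 2) => e /lP[n [ne ne']].
  have -> : T l - l = (u n.+1 - l) - (T (u n) - T l) by rewrite [u _]iterS; lin.
  apply: le_trans (nrB _ _) _.
  have := Tdist _ _ (nru n) lr; have := nr_ge0 (u n - l); nra.
exists (1 - l); split.
- exact/saB/sal/sa1.
- rewrite mulrBl !mulrBr !mul1r mulr1 -[in RHS](addrK (l * l) h).
  have -> : h + l * l = 2%:C *: l by rewrite -[in RHS]Tl scalerA -rmorphM /= mulfV ?pnatr_eq0 // rmorph1 scale1r.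
  by lin.
- by move=> z zh; rewrite mulrBr mulrBl mulr1 mul1r cl.
- by rewrite opprB addrC subrK (le_trans lr) // ltW.
Qed.

Definition pos h := sa h /\ exists2 c, 0 <= c & nr (c%:U - h) <= c.

Lemma pos_sa h : pos h -> sa h. Proof. by case. Qed.

Lemma pos_up h : pos h -> exists2 c0, 0 <= c0 & forall c, c0 <= c -> nr (c%:U - h) <= c.
Proof.
case=> hh [c0 c00 hc0]; exists c0 => // c cc.
have -> : c%:U - h = (c - c0)%:U + (c0%:U - h) by rewrite rmorphB; lin.
by apply: le_trans (nrD _ _) _; rewrite nrC ger0_norm ?subr_ge0 //; lra.
Qed.

Lemma posD x y : pos x -> pos y -> pos (x + y).
Proof.
case=> hx [c c0 cx] [hy [d d0 dy]]; split; first exact: saD.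
exists (c + d); first exact: addr_ge0.
have -> : (c + d)%:U - (x + y) = (c%:U - x) + (d%:U - y) by rewrite rmorphD; lin.
exact: le_trans (nrD _ _) (lerD _ _).
Qed.

Lemma posZ r x : 0 <= r -> pos x -> pos (r%:C *: x).
Proof.
move=> r0 [hx [c c0 cx]]; split; first exact: saZ.
exists (r * c); first exact: mulr_ge0.
have -> : (r * c)%:U - r%:C *: x = r%:C *: (c%:U - x) by rewrite rmorphM; lin.
by rewrite nrZr ger0_norm // ler_wpM2l.
Qed.

Lemma posC r : 0 <= r -> pos r%:U.
Proof. by move=> r0; split; [exact: saC | exists r; rewrite // subrr nr0]. Qed.

Lemma pos0 : pos 0.
Proof. by have := posC (lexx 0); rewrite scale0r. Qed.

Lemma pos_sub_nr c h : sa h -> nr h <= c -> pos (c%:U - h).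
Proof.
move=> hh hc; split; first exact/saB/hh/saC.
exists c; first exact: le_trans (nr_ge0 h) hc.
by rewrite subKr.
Qed.

Lemma pos_add_nr c h : sa h -> nr h <= c -> pos (c%:U + h).
Proof.
by move=> hh hc; rewrite -[h]opprK; apply: pos_sub_nr; rewrite ?nrN //; apply: saN.
Qed.

(** With [C = c + d] one has [h + d = C (1 - g)] for [g = (c - h) / C]. The shift by [d] makes the
    norm of [g] strictly less than 1, as [sqrt_exists] requires. *)
Lemma pos_sqrt h d : pos h -> 0 < d -> exists s,
  [/\ sa s, s * s = h + d%:U, forall z, z * h = h * z -> z * s = s * z & pos s].
Proof.
case=> hh [c c0 hc] d0; pose C := c + d; have C0 : 0 < C by rewrite ltr_wpDl.
pose g := C^-1%:C *: (c%:U - h).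
have sg : sa g by apply: saZ; apply: saB => //; apply: saC.
have [|s [ss s2 cs ps]] := sqrt_exists sg.
  rewrite nrZr ger0_norm ?invr_ge0 1?ltW // mulrC ltr_pdivrMr // mul1r.
  by apply: le_lt_trans hc _; rewrite ltrDl.
pose k := Num.sqrt C; have kk : k * k = C by rewrite -expr2 sqr_sqrtr // ltW.
exists (k%:C *: s); split; first exact: saZ.
- rewrite -scalerAl -scalerAr scalerA -rmorphM /= kk s2 scalerBr /g scalerA -rmorphM.
  by rewrite mulfV ?gt_eqF // scale1r /C rmorphD; lin.
- move=> z zh; rewrite -scalerAl -scalerAr cs // /g -scalerAl -scalerAr; congr (_ *: _).
  by rewrite mulrBr mulrBl zh -scalerAl -scalerAr mulr1 mul1r.
- apply: posZ; first exact: sqrtr_ge0.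
  by split=> //; exists 1; rewrite ?ler01 // scale1r.
Qed.

(* [s + i t] is [c] times a unitary, and [s] is its real part. *)
Lemma nr_le_sumsq s t c : sa s -> sa t -> s * t = t * s -> 0 <= c ->
  s * s + t * t = (c ^+ 2)%:U -> nr s <= c.
Proof.
move=> ss tt st' c0 e; pose u := s + 'i%C *: t.
have su : st u = s - 'i%C *: t.
  rewrite stD stZ ss tt -scaleNr; congr (_ + _ *: _).
  by simpc.
have : nr (st u * u) = c ^+ 2.
  rewrite su -[RHS]ger0_norm ?sqr_ge0 // -nrC -e; congr nr.
  rewrite mulrBl !mulrDr -!scalerAl -!scalerAr !scalerA st'.
  have ii : 'i%C * 'i%C = -1 :> R[i] by rewrite -sqr_i.
  by rewrite ?ii; lin.
rewrite (nr_stM H) => /eqP; rewrite eqrXn2 // => /eqP uc.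
have -> : s = 2^-1%:C *: (u + st u) by rewrite su /u; lin.
rewrite nrZr ger0_norm ?invr_ge0 //.
have := nrD u (st u); rewrite nr_st uc; lra.
Qed.

(** Scale [s] to [g] of norm less than 1 and let [t] be the root of [1 - g^2]. From [t^2 + g^2 = 1]
    follows [|t| <= 1], so [|1 - g^2| = |t^2| <= 1], which is the positivity of [g^2]. *)
Lemma pos_sq s : sa s -> pos (s * s).
Proof.
move=> ss; pose c := nr s + 1; have c0 : 0 < c by rewrite ltr_wpDl.
pose g := c^-1%:C *: s; have sg : sa g by exact: saZ.
have g1 : nr g < 1.
  rewrite nrZr ger0_norm ?invr_ge0 1?ltW // mulrC ltr_pdivrMr // mul1r.
  by rewrite /c ltrDl.
have sgg : sa (g * g) by exact: saM.
have [|t [tt t2 ct _]] := sqrt_exists sgg.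
  by rewrite nr_sa_sq // expr2; have := nr_ge0 g; nra.
have tg : t * g = g * t by rewrite ct // mulrA.
have t1 : nr t <= 1.
  apply: (@nr_le_sumsq t g) => //.
  by rewrite t2 subrK expr1n scale1r.
have -> : s * s = (c ^+ 2)%:C *: (g * g).
  have -> : s = c%:C *: g by rewrite scalerA -rmorphM /= mulfV ?gt_eqF // scale1r.
  by rewrite -scalerAl -scalerAr scalerA -rmorphM /= -expr2.
apply: posZ; first exact: sqr_ge0.
split=> //; exists 1; first exact: ler01.
rewrite scale1r -t2; apply: le_trans (nrM _ _) _.
by have := nr_ge0 t; nra.
Qed.

(** Let [s] and [t] be the roots of [c + d - g] and [c + d + g]. They commute with [g] and with each
    other, and [g^2 + (s t)^2 = (c + d)^2], so [nr_le_sumsq] applies. *)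
Lemma nr_le_pos g c : sa g -> 0 <= c -> pos (c%:U - g) -> pos (c%:U + g) -> nr g <= c.
Proof.
move=> sg c0 p1 p2; apply/ler_addgt0Pl => d d0.
have [s [ss s2 cs _]] := pos_sqrt p1 d0; have [t [tt t2 ct _]] := pos_sqrt p2 d0.
have cC z r x : z * (r%:U + x) = (r%:U + x) * z <-> z * x = x * z.
  rewrite mulrDr mulrDl -scalerAl -scalerAr mul1r mulr1.
  by split=> [/addrI|->].
have gs : g * s = s * g by apply/cs/cC; rewrite mulrN mulNr.
have gt : g * t = t * g by apply/ct/cC.
have sT : s * t = t * s by apply/ct/cC.
apply: (@nr_le_sumsq g (s * t)) => //; first exact: saM.
- by rewrite mulrA gs -mulrA gt mulrA.
- by rewrite addr_ge0 // ltW.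
- have -> : s * t * (s * t) = (s * s) * (t * t).
    by rewrite mulrA -(mulrA s t s) -sT !mulrA.
  rewrite s2 t2 !mulrDl !mulrDr ?mulNr ?mulrN -!scalerAl -!scalerAr !mul1r !mulr1.
  by rewrite rmorphXn rmorphD /= expr2; lin.
Qed.

Lemma nr_le_pos0 g c : pos g -> pos (c%:U - g) -> 0 <= c -> nr g <= c.
Proof.
move=> pg pc c0; apply: nr_le_pos => //; first exact: pos_sa.
by apply: posD => //; exact: posC.
Qed.

Lemma nr_sub_pos h c : pos h -> nr h <= c -> nr (c%:U - h) <= c.
Proof.
move=> ph hc; have c0 := le_trans (nr_ge0 h) hc.
apply: nr_le_pos0; rewrite ?subKr //.
by apply: pos_sub_nr => //; exact: pos_sa.
Qed.

(** By [nr_sub_pos] any bound of the norm can serve as the constant in [pos]; [nr h + 1] serves for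
    all [k] within distance 1 of [h], and the inequality then passes to the limit. *)
Lemma pos_closed h : sa h -> (forall e, 0 < e -> exists2 k, pos k & nr (h - k) <= e) ->
  pos h.
Proof.
move=> sh hk; split=> //; exists (nr h + 1); first by rewrite addr_ge0.
apply/ler_addgt0Pl => e e0.
have m0 : 0 < Num.min e 1 by rewrite lt_min e0 /=.
have [k pk hke] := hk _ m0.
have := hke; rewrite le_min => /andP[h1 h2].
have -> : (nr h + 1)%:U - h = - (h - k) + ((nr h + 1)%:U - k) by lin.
apply: le_trans (nrD _ _) _; rewrite nrN lerD //.
apply: nr_sub_pos => //.
by rewrite -[k](subKr h); apply: le_trans (nrB _ _) _; rewrite lerD2l.
Qed.

(** Together with [pow2_linear_bound] this replaces the spectral radius formula: a bound on the
    growth of powers bounds the norm itself. *)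
Lemma nr_pow2 h k : sa h -> nr (h ^+ (2 ^ k)) = nr h ^+ (2 ^ k).
Proof.
move=> hh; have sap n : sa (h ^+ n).
  elim: n => [|n IH]; first by rewrite expr0; exact: st1.
  by rewrite exprS; apply: saM => //; rewrite -exprS exprSr.
elim: k => [|k IH]; first by rewrite !expr1.
by rewrite expnSr !exprM expr2 nr_sa_sq // IH.
Qed.

End UnitalCStar.

Lemma bernoulli_ge (R : realType) (d : R) n : 0 <= d -> 1 + n%:R * d <= (1 + d) ^+ n.
Proof.
move=> d0; elim: n => [|n IH]; first by rewrite mul0r addr0 expr0.
rewrite exprS -natr1; have n0 : 0 <= n%:R :> R := ler0n _ _.
by apply: le_trans (ler_wpM2l _ IH); nra.
Qed.

(** If [t = 1 + d] with [d > 0], Bernoulli's inequality for [n = 2^k], squared, gives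
    [t^(2n) >= (n d)^2]. This is quadratic in [n] and exceeds [1 + 2 n K] as soon as
    [n d^2 > 2 K + 1]. *)
Lemma pow2_linear_bound (R : realType) (t K : R) : 0 <= t -> 0 <= K ->
  (forall k : nat, t ^+ (2 ^ k) <= 1 + (2 ^ k)%:R * K) -> t <= 1.
Proof.
move=> t0 K0 tK; rewrite leNgt; apply/negP => t1.
pose d := t - 1; have d0 : 0 < d by rewrite subr_gt0.
pose k := Num.bound ((2 * K + 1) / d ^+ 2).
pose n : R := (2 ^ k)%:R.
have n1 : 1 <= n by rewrite ler1n expn_gt0.
have nd : 2 * K + 1 < n * d ^+ 2.
  rewrite -ltr_pdivrMr ?exprn_gt0 //.
  apply: lt_trans (_ : k%:R < n); last by rewrite ltr_nat ltn_expl.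
  apply: le_lt_trans (ler_norm _) _.
  by rewrite ger0_norm ?archi_boundP // divr_ge0 ?sqr_ge0 // addr_ge0 ?mulr_ge0.
have := tK k.+1; rewrite expnSr exprM natrM -/n => h.
have : n * d <= t ^+ (2 ^ k).
  have -> : t = 1 + d by rewrite /d addrC subrK.
  by apply: le_trans (bernoulli_ge _ (ltW d0)); rewrite -/n lerDr.
have nd0 : 0 <= n * d by rewrite mulr_ge0 ?ltW // (lt_le_trans _ n1).
move=> h2; have : (n * d) ^+ 2 <= 1 + n * 2 * K.
  by apply: le_trans h; rewrite lerXn2r // nnegrE exprn_ge0.
rewrite exprMn; have : n * n * d ^+ 2 <= 1 + n * 2 * K -> False by nra.
by rewrite expr2.
Qed.

(** * Positivity of [st x * x] *)

Section Kaplansky.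
Variables (R : realType) (U : algType R[i]) (st : U -> U) (nr : U -> R).
Hypothesis H : unital_cstar st nr.
Implicit Types (a b h x y z s t : U) (c d e r : R).
Local Notation "c %:U" := (c%:C *: (1 : U)) (at level 2, format "c %:U").
Ltac lin := linear_eq (R[i] : fieldType) U.
Local Notation sa := (sa st).
Local Notation pos := (pos st nr).

(* Both sides are polynomials in [y st y] resp. [st y y], related by
   [p (st y y) = p 0 - st y * q (y st y) * y]; the norms of the powers of
   [C - st y y] therefore grow at most linearly faster than those of [C - y st y]. *)
Lemma pos_swap y e : 0 < e -> pos (y * st y + e%:U) -> pos (st y * y + e%:U).
Proof.
move=> e0 py; set b := y * st y; set b' := st y * y.
have [c0 c00 hc] := pos_up H py.
pose c := c0 + e; pose C := c - e.
have Cc0 : C = c0 by rewrite /C /c addrK.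
have cp : 0 < c by rewrite ltr_wpDl.
have Cb : nr (C%:U - b) <= c.
  have -> : C%:U - b = c%:U - (b + e%:U) by rewrite /C rmorphB /=; lin.
  by apply: hc; rewrite lerDl ltW.
(* The recursion is [S' = C^n + (C - b) S], because [y b' = b y]. The bound on [S] is [n c^(n-1)],
   multiplied by [c] to avoid a predecessor in the exponent. *)
have pw n : exists2 S, (C%:U - b') ^+ n = (C ^+ n)%:U - st y * S * y
                     & nr S * c <= n%:R * c ^+ n.
  elim: n => [|n [S eS nS]].
    exists 0; first by rewrite !expr0 mulr0 mul0r subr0 scale1r.
    by rewrite (nr0 H) !mul0r.
  exists ((C ^+ n)%:U + (C%:U - b) * S).
    rewrite exprS eS !mulrBl !mulrBr !mulrDr !mulrDl -!scalerAl -!scalerAr !mul1r !mulr1.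
    rewrite ?(mulrBl, mulrBr, mulrN, mulNr) -?scalerAl ?mul1r -?scalerAr /b /b' ?mulrA.
    by rewrite exprS rmorphM /=; lin.
  have nC : 0 <= C ^+ n <= c ^+ n.
    by rewrite Cc0 exprn_ge0 //= lerXn2r ?nnegrE // ?ltW // ltrDl.
  have := nrD H (C ^+ n)%:U ((C%:U - b) * S); rewrite (nrC H) ger0_norm; last by case/andP: nC.
  have := nrM H (C%:U - b) S; have := nr_ge0 H S; have := nr_ge0 H (C%:U - b).
  rewrite -natr1 exprS => x1 x2 x3 x4.
  have : nr ((C ^+ n)%:U + (C%:U - b) * S) <= c ^+ n + c * nr S.
    by case/andP: nC; nra.
  nra.
have sb' : sa b' by exact: (sa_stM H).
split; first by apply: (saD H) => //; exact: (saC H).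
exists c; first exact: ltW.
have -> : c%:U - (b' + e%:U) = C%:U - b' by rewrite /C rmorphB /=; lin.
set g := C%:U - b'; have sg : sa g by apply: (saB H) => //; exact: (saC H).
rewrite -(ler_pM2r (x := c^-1)) ?invr_gt0 // mulfV ?gt_eqF //.
have Y0 := nr_ge0 H y.
apply: (@pow2_linear_bound _ _ (nr y ^+ 2 / c)).
- by rewrite mulr_ge0 ?(nr_ge0 H) // invr_ge0 ltW.
- by rewrite mulr_ge0 ?sqr_ge0 // invr_ge0 ltW.
move=> k; rewrite exprMn exprVn -(nr_pow2 H k sg); set n := (2 ^ k)%N.
rewrite ler_pdivrMr ?exprn_gt0 // mulrDl mul1r.
have [S -> nS] := pw n.
have nC : C ^+ n <= c ^+ n.
  by rewrite Cc0 lerXn2r ?nnegrE // ?ltW // ltrDl.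
apply: le_trans (nrB H _ _) _; apply: lerD; first by rewrite (nrC H) ger0_norm // Cc0 exprn_ge0.
apply: le_trans (nrM H _ _) _.
have := nrM H (st y) S; rewrite (nr_st H) => hS.
have S0 := nr_ge0 H S.
have : nr (st y * S) * nr y <= nr S * nr y ^+ 2 by rewrite expr2; nra.
move=> h; apply: le_trans h _.
rewrite -(ler_pM2r cp) (_ : n%:R * (nr y ^+ 2 / c) * c ^+ n * c = nr y ^+ 2 * (n%:R * c ^+ n)).
  by rewrite mulrAC -mulrA mulrC -mulrA; rewrite mulrCA ler_wpM2l ?sqr_ge0 // mulrC.
by field; rewrite gt_eqF.
Qed.

(** For [s = y + st y] and [t = i (y - st y)] one has [s^2 + t^2 = 2 (y st y + st y y)]. Hence
    [y st y + e] is a sum of squares plus [e - st y y], so it is positive. [pos_swap] gives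
    [st y y >= -e], and the hypothesis is the other bound. *)
Lemma nr_stM_upper y e : 0 < e -> pos (e%:U - st y * y) -> nr (st y * y) <= e.
Proof.
move=> e0 py.
pose s := y + st y; pose t := 'i%C *: (y - st y).
have ss : sa s by rewrite /sa /s (stD H) (stK H) addrC.
have tt : sa t.
  rewrite /sa /t (stZ H) (stB H) (stK H) (_ : Num.conj 'i%C = - 'i%C :> R[i]); last by simpc.
  by lin.
have ii : 'i%C * 'i%C = -1 :> R[i] by rewrite -sqr_i.
have e2 : y * st y + e%:U = 2^-1%:C *: (s * s + t * t) + (e%:U - st y * y).
  rewrite /s /t -scalerAl -scalerAr scalerA ii !mulrDl !mulrDr !mulNr !mulrN scaleN1r.
  by lin.
have py' : pos (y * st y + e%:U).
  rewrite e2; apply: posD => //; apply: (posZ H); first by rewrite invr_ge0.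
  by apply: (posD H); apply: (pos_sq H).
apply: (nr_le_pos H) => //; [exact: (sa_stM H) | exact: ltW|].
by rewrite addrC; exact: pos_swap.
Qed.

(* Kaplansky's theorem.  With [h = st x * x], [k ~ |h|] and [g = k - h ~ 2 h^-],
   the element [y = x g (2k)^(1/2)] satisfies [st y * y <= O(d)], hence is small by
   [nr_stM_upper], which forces [h g ~ 0] and [h ~ k]. *)
Lemma pos_stM x : pos (st x * x).
Proof.
set h := st x * x; have sh : sa h by exact: (sa_stM H).
have eh : h = st x * x by []; clearbody h.
apply: (pos_closed H sh) => e e0; pose N := nr h; have N0 : 0 <= N := nr_ge0 H h.
(* Since [|g| <= 2 N + 1], the number [B - 1] bounds [2 |h g| + |h g g|], the coefficient of [d] in
   [st y * y] below. *)
pose B := 2 * (N * (2 * N + 1)) + N * (2 * N + 1) ^+ 2 + 1.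
have B0 : 0 < B by rewrite ltr_wpDl // addr_ge0 ?mulr_ge0 ?sqr_ge0 ?addr_ge0 ?mulr_ge0.
(* At the end [|g|^2 <= d + 2 |h g|] and [|h g|^2 <= d B]; the last two conditions make each summand
   at most [e^2 / 2]. *)
have [d [d0 d1 d2 d3]] : exists d, [/\ 0 < d, d <= 1, d <= e ^+ 2 / 2
    & d * B <= (e ^+ 2 / 4) ^+ 2].
  have e20 : 0 < e ^+ 2 by exact: exprn_gt0.
  exists (Num.min 1 (Num.min (e ^+ 2 / 2) ((e ^+ 2 / 4) ^+ 2 / B))); split.
  - by rewrite !lt_min ltr01 /= !divr_gt0 ?exprn_gt0 ?divr_gt0.
  - by rewrite ge_min lexx.
  - by rewrite !ge_min lexx orbT.
  - by rewrite -ler_pdivlMr // !ge_min lexx !orbT.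
have [k [sk k2 ck pk]] := pos_sqrt H (pos_sq H sh) d0.
have hk : h * k = k * h by apply: ck; rewrite mulrA.
have [kk [skk kk2 ckk _]] := pos_sqrt H (posZ H (ler0n R 2) pk) d0.
exists k => //; pose g := k - h; have sg : sa g by exact: (saB H).
have hg : h * g = g * h by rewrite /g mulrBr mulrBl hk.
have gg : g * g = d%:U - 2%:R *: (h * g).
  by rewrite /g mulrBl !mulrBr k2 hk; lin.
have g2k : g * (2%:C *: k) = d%:U + g * g.
  rewrite -scalerAr /g !mulrBl !mulrBr ?mulrBl k2 hk.
  by lin.
have shg : sa (h * g) by exact: (saM H).
have nk : nr k <= N + 1.
  rewrite -(ler_pXn2r (n := 2)) ?nnegrE ?(nr_ge0 H) ?addr_ge0 //.
  rewrite -(nr_sa_sq H) // k2; apply: le_trans (nrD H _ _) _.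
  by rewrite (nr_sa_sq H) // (nrC H) gtr0_norm // -/N; nra.
have ng : nr g <= 2 * N + 1 by apply: le_trans (nrB H _ _) _; rewrite -/N; lra.
have gE : g = k - h by [].
have gk : g * k = k * g by rewrite /g mulrBr mulrBl hk.
clearbody g; pose y := x * g * kk.
have ckz z : z * k = k * z -> z * kk = kk * z.
  by move=> zk; apply: ckk; rewrite -scalerAr -scalerAl zk.
have gkk := ckz _ gk; have hkk := ckz _ hk.
have yy : st y * y = d%:C *: (h * g) + h * g * (d%:U - 2%:R *: (h * g)) + d%:C *: (h * g * g).
  rewrite /y !(stM H) skk sg.
  have -> : kk * (g * st x) * (x * g * kk) = h * g * (g * (2%:C *: k) + d%:C *: g).
    have cg : (g * h * g) * kk = kk * (g * h * g).
      by rewrite -(mulrA (g * h)) gkk mulrA -(mulrA g h kk) hkk (mulrA g) gkk -!mulrA.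
    have -> : kk * (g * st x) * (x * g * kk) = kk * (g * h * g) * kk by rewrite eh !mulrA.
    by rewrite -cg -mulrA kk2 -hg -(mulrA (h * g)) [g * (_ + _)]mulrDr -[g * d%:U]scalerAr mulr1.
  by rewrite g2k gg !(mulrDr, mulrN) -!scalerAr mulr1 ?mulrA; lin.
have hgM : nr (h * g) <= N * (2 * N + 1).
  by apply: le_trans (nrM H _ _) _; apply: ler_pM => //; exact: nr_ge0 H _.
have hggM : nr (h * g * g) <= N * (2 * N + 1) ^+ 2.
  apply: le_trans (nrM H _ _) _; rewrite expr2 mulrA; apply: ler_pM => //; exact: nr_ge0 H _.
(* The only term not of order [d] is [- 2 (h g)^2]. Its sign gives [st y * y <= d B]; once
   [st y * y] is known to be small, solving for [(h g)^2] shows that it is small too. *)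
have yyE : st y * y = - (2%:R *: (h * g * (h * g))) + (2 * d)%:C *: (h * g) + d%:C *: (h * g * g).
  by rewrite yy mulrBr -!scalerAr mulr1 rmorphM /=; lin.
have shgg : sa (h * g * g).
  by apply: (saM H) => //; rewrite mulrA -hg.
have u1 : nr ((2 * d)%:C *: (h * g) + d%:C *: (h * g * g)) <= d * (B - 1).
  apply: le_trans (nrD H _ _) _; rewrite !(nrZr H) !gtr0_norm ?mulr_gt0 // /B.
  by have := nr_ge0 H (h * g); have := nr_ge0 H (h * g * g); nra.
have pup : pos ((d * B)%:U - st y * y).
  have -> : (d * B)%:U - st y * y = 2%:C *: (h * g * (h * g)) +
    ((d * B)%:U - ((2 * d)%:C *: (h * g) + d%:C *: (h * g * g))).
    by rewrite yyE rmorph_nat; lin.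
  apply: (posD H); first by apply: (posZ H) => //; exact: (pos_sq H).
  apply: (pos_sub_nr H); last by apply: le_trans u1 _; rewrite ler_wpM2l ?ltW // ltrBlDr ltrDl.
  by apply: (saD H); exact: (saZ H).
have nyy := nr_stM_upper (mulr_gt0 d0 B0) pup.
have v2 : nr (h * g) ^+ 2 <= d * B.
  rewrite -(nr_sa_sq H) //.
  have -> : h * g * (h * g) =
     2^-1%:C *: ((2 * d)%:C *: (h * g) + d%:C *: (h * g * g) - st y * y) by rewrite yyE; lin.
  rewrite (nrZr H) ger0_norm ?invr_ge0 //.
  have := nrB H ((2 * d)%:C *: (h * g) + d%:C *: (h * g * g)) (st y * y); lra.
have v1 : nr (h * g) <= e ^+ 2 / 4.
  by rewrite -(ler_pXn2r (n := 2)) ?nnegrE ?(nr_ge0 H) ?divr_ge0 ?sqr_ge0 // (le_trans v2).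
have : nr g ^+ 2 <= e ^+ 2.
  have -> : nr g ^+ 2 = nr (d%:U - 2%:C *: (h * g)) by rewrite -(nr_sa_sq H) // gg rmorph_nat.
  apply: le_trans (nrB H _ _) _.
  rewrite (nrC H) gtr0_norm // (nrZr H) normr_nat; lra.
by rewrite ler_pXn2r ?nnegrE ?(nr_ge0 H) ?(ltW e0) // (nrBC H) -gE.
Qed.

(** With [s^2 = h + d] the element [st (s x) (s x)] differs from [st x h x] by [d st x x], which is
    arbitrarily small. *)
Lemma pos_conj x h : pos h -> pos (st x * h * x).
Proof.
move=> ph; apply: (pos_closed H); first exact/(sa_conj H)/pos_sa/ph.
move=> e e0; pose d := e / (nr x ^+ 2 + 1).
have X0 : 0 < nr x ^+ 2 + 1 by rewrite ltr_wpDl ?sqr_ge0.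
have d0 : 0 < d by rewrite divr_gt0.
have [s [ss s2 _ _]] := pos_sqrt H ph d0.
exists (st (s * x) * (s * x)); first exact: pos_stM.
rewrite (stM H) ss mulrA -(mulrA _ s s) s2 mulrDr mulrDl opprD addrA subrr sub0r.
rewrite -scalerAr -scalerAl mulr1 (nrN H) (nrZr H) (nr_stM H) gtr0_norm //.
by rewrite /d mulrAC ler_pdivrMr //; rewrite ler_wpM2l ?lerDl // ltW.
Qed.

Lemma nr_sq_le z c : 0 <= c -> pos (c%:U - st z * z) -> nr z ^+ 2 <= c.
Proof.
move=> c0 pz; rewrite -(nr_stM H); apply: (nr_le_pos0 H) => //; exact: pos_stM.
Qed.

End Kaplansky.

(** * Ideals and approximate units *)

Record closed_ideal (R : realType) (U : algType R[i]) (nr : U -> R) (M : U -> Prop)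
    : Prop := ClosedIdeal {
  ci0 : M 0;
  ciD : forall x y, M x -> M y -> M (x + y);
  ciZ : forall k x, M x -> M (k *: x);
  ciMl : forall x y, M y -> M (x * y);
  ciMr : forall x y, M x -> M (x * y);
  ci_closed : forall x, (forall e, 0 < e -> exists2 m, M m & nr (x - m) <= e) -> M x
}.

Lemma ciN (R : realType) (U : algType R[i]) (nr : U -> R) (M : U -> Prop) :
  closed_ideal nr M -> forall x, M x -> M (- x).
Proof. by move=> HM x Mx; rewrite -scaleN1r; apply: (ciZ HM). Qed.

Lemma ciB (R : realType) (U : algType R[i]) (nr : U -> R) (M : U -> Prop) :
  closed_ideal nr M -> forall x y, M x -> M y -> M (x - y).
Proof. by move=> HM x y Mx My; apply: (ciD HM) => //; exact: (ciN HM). Qed.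

Section Ideals.
Variables (R : realType) (U : algType R[i]) (st : U -> U) (nr : U -> R).
Hypothesis H : unital_cstar st nr.
Variable M : U -> Prop.
Hypothesis HM : closed_ideal nr M.
Implicit Types (a b h x y z s t m j : U) (c d e r : R).
Local Notation "c %:U" := (c%:C *: (1 : U)) (at level 2, format "c %:U").
Ltac lin := linear_eq (R[i] : fieldType) U.
Local Notation sa := (sa st).
Local Notation pos := (pos st nr).

(* [1 - T^k - k (1 - T) T^k >= 0] for [T = t^2], by induction on [k]: the
   increment is [(k+1) ((1 - T) t^k)^2]. *)
Lemma approx_unit m e : M m -> sa m -> 0 < e -> exists j,
  [/\ M j, sa j, nr (1 - j) <= 1 & nr (m * (1 - j)) <= e].
Proof.
move=> Mm sm e0; pose K := nr m + 1; have K0 : 0 < K by rewrite ltr_wpDl // (nr_ge0 H).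
pose n := K^-1%:C *: m; have Mn : M n by exact: (ciZ HM).
have sn : sa n by exact: (saZ H).
have n1 : nr n < 1.
  by rewrite (nrZr H) ger0_norm ?invr_ge0 1?ltW // mulrC ltr_pdivrMr // mul1r ltrDl.
have snn : sa (n * n) by exact: (saM H).
have [|t [tt t2 ct _]] := sqrt_exists H snn.
  by rewrite (nr_sa_sq H) // expr2; have := nr_ge0 H n; nra.
have nt : n * t = t * n by apply: ct; rewrite mulrA.
pose T := 1 - n * n; have nT : n * T = T * n by rewrite /T mulrBr mulrBl mul1r mulr1 mulrA.
have TE : T = 1 - n * n by [].
clearbody T.
have nTk k : n * T ^+ k = T ^+ k * n.
  elim: k => [|k IH]; first by rewrite expr0 mul1r mulr1.
  by rewrite exprS mulrA nT -(mulrA T n) IH (mulrA T).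
have sT : sa T by rewrite TE; apply: (saB H) => //; exact: (sa1 H).
have tX k : T ^+ k = t ^+ k * t ^+ k.
  have tc : GRing.comm t t by [].
  by rewrite -exprMn_comm // t2 TE.
have saX z k : sa z -> sa (z ^+ k).
  move=> sz; elim: k => [|k IH]; first by rewrite expr0; exact: (sa1 H).
  by rewrite exprS; apply: (saM H) => //; rewrite -exprS exprSr.
have nnt : n * n * t = t * (n * n) by rewrite -mulrA nt mulrA nt mulrA.
have nntk k : n * n * t ^+ k = t ^+ k * (n * n).
  elim: k => [|k IH]; first by rewrite expr0 mul1r mulr1.
  by rewrite exprS mulrA nnt -(mulrA t) -IH -[LHS]mulrA.
pose D k := 1 - T ^+ k - (k%:R : R)%:C *: (n * n * T ^+ k).
have Dpos k : pos (D k).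
  elim: k => [|k IH].
    by rewrite /D expr0 subrr rmorph0 scale0r subrr; exact: (pos0 H).
  pose q := n * n * t ^+ k; have sq : sa q.
    by apply: (saM H) => //; exact: saX.
  have -> : D k.+1 = D k + (k.+1%:R : R)%:C *: (q * q).
    have -> : q * q = n * n * T ^+ k * (n * n).
      by rewrite /q tX {2}nntk !mulrA.
    have -> : n * n * T ^+ k * (n * n) = n * n * (n * n) * T ^+ k.
      by rewrite -[LHS]mulrA (mulrA (T ^+ k)) -nTk -(mulrA n (T ^+ k)) -nTk !mulrA.
    rewrite /D exprS -natr1 rmorphD rmorph1.
    have -> : n * n * (T * T ^+ k) = n * n * T ^+ k - n * n * (n * n) * T ^+ k.
      by rewrite [LHS]mulrA (_ : n * n * T = n * n - n * n * (n * n)) ?mulrBl // TE mulrBr mulr1.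
    by rewrite {1}TE mulrBl mul1r; lin.
  by apply: (posD H) => //; apply: (posZ H) => //; exact: (pos_sq H).
(* As [w^2 = T^(2k)], the element [D (2 k) + w^2] is [1 - 2 k (n w)^2], so positivity gives
   [|n w|^2 <= 1 / (2 k)]. Then [|m w| = K |n w| <= e] because [k > (K / e)^2]. *)
pose k := Num.bound ((e / K) ^- 2); pose w := T ^+ k.
have Mjk l : M (1 - T ^+ l).
  elim: l => [|l IH]; first by rewrite expr0 subrr; exact: (ci0 HM).
  have -> : 1 - T ^+ l.+1 = (1 - T ^+ l) + n * n * T ^+ l.
    by rewrite exprS {1}TE mulrBl mul1r; lin.
  by apply: (ciD HM) => //; apply: (ciMr HM); exact: (ciMl HM).
have nT1 : nr T <= 1.
  have := nr_sub_pos H (pos_sq H sn) (c := 1); rewrite scale1r TE; apply.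
  by rewrite (nr_sa_sq H) // expr2; have := nr_ge0 H n; nra.
have nw : nr w <= 1.
  rewrite /w; elim: (k) => [|l IH]; first by rewrite expr0 (nr1 H).
  rewrite exprS; apply: le_trans (nrM H _ _) _.
  by have := nr_ge0 H T; have := nr_ge0 H (T ^+ l); nra.
have ww : T ^+ (2 * k) = w * w by rewrite mulnC exprM expr2.
have snw : sa (n * w) by apply: (saM H) => //; [exact: saX | exact: nTk].
have nww : n * w * (n * w) = n * n * T ^+ (2 * k).
  by rewrite ww -mulrA (mulrA w) -nTk !mulrA.
have nb : (2 * k)%:R * nr (n * w) ^+ 2 <= 1.
  rewrite -(nr_sa_sq H) // -[(2 * k)%:R](ger0_norm (ler0n _ _)) -(nrZr H).
  apply: (nr_le_pos0 H) => //; first by apply: (posZ H) => //; exact: (pos_sq H).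
  have -> : 1%:U - (2 * k)%:R%:C *: (n * w * (n * w)) = D (2 * k)%N + w * w.
    by rewrite nww /D ww; lin.
  by apply: (posD H) => //; apply: (pos_sq H); exact: saX.
exists (1 - w); split; rewrite ?subKr //.
- exact: Mjk.
- by apply: (saB H); [exact: (sa1 H) | exact: saX].
have -> : m * w = K%:C *: (n * w).
  by rewrite scalerAl scalerA -rmorphM /= mulfV ?gt_eqF // scale1r.
rewrite (nrZr H) gtr0_norm // mulrC -ler_pdivlMr //.
have eK : 0 < e / K by rewrite divr_gt0.
rewrite -(ler_pXn2r (n := 2)) ?nnegrE ?(nr_ge0 H) ?(ltW eK) //.
have kb : (e / K) ^- 2 < k%:R.
  by rewrite /k archi_boundP // invr_ge0 sqr_ge0.
move: nb; rewrite natrM; have := sqr_ge0 (nr (n * w)) => q0 nb.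
have E0 : 0 < (e / K) ^+ 2 by exact: exprn_gt0.
have : 1 < k%:R * (e / K) ^+ 2 by rewrite -ltr_pdivrMr // mul1r.
move: (k%:R : R) (ler0n R k) nb => kr kr0 nb h.
rewrite -(ler_pM2l (x := 2 * kr)); last by nra.
nra.
Qed.

(** Take an approximate unit [j] for the self-adjoint element [x st x] of [M]. By the C*-identity
    [|st x (1 - j)|^2 = |(1 - j) x st x (1 - j)|] is small, and [st x j] lies in [M]. *)
Lemma ideal_st x : M x -> M (st x).
Proof.
move=> Mx; apply: (ci_closed HM) => e e0.
have smm : sa (x * st x) by rewrite /sa (stM H) (stK H).
have [j [Mj sj nj nmj]] := approx_unit (ciMr HM (st x) Mx) smm (exprn_gt0 2 e0).
exists (st x * j); first exact: (ciMl HM).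
have -> : st x - st x * j = st x * (1 - j) by rewrite mulrBr mulr1.
rewrite -(ler_pXn2r (n := 2)) ?nnegrE ?(nr_ge0 H) ?(ltW e0) // -(nr_stM H).
rewrite (stM H) (stK H) (stB H) (st1 H) sj -!mulrA (mulrA x).
apply: le_trans (nrM H _ _) _.
have := nr_ge0 H (1 - j); have := nr_ge0 H (x * st x * (1 - j)); nra.
Qed.

(* [st x * x <= c] modulo [M] bounds the quotient norm of [x]: compress by [1 - j],
   with [j] an approximate unit for [m]. *)
Lemma ideal_dominated x m c : M m -> sa m -> 0 <= c -> pos (c%:U - st x * x - m) ->
  forall e, 0 < e -> exists2 j, M j & nr (x * (1 - j)) ^+ 2 <= c + e.
Proof.
move=> Mm sm c0 px e e0; have [j [Mj sj nj nmj]] := approx_unit Mm sm e0.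
exists j => //; have : sa (1 - j) by apply: (saB H) => //; exact: (sa1 H).
move: (1 - j) nj nmj => w nj nmj sw.
apply: (nr_sq_le H); first by rewrite addr_ge0 // ltW.
have -> : (c + e)%:U - st (x * w) * (x * w) = st w * (c%:U - st x * x - m) * w +
   (c%:C *: (1%:U - w * w) + (e%:U + w * (m * w))).
  rewrite (stM H) sw !mulrBr !mulrBl -!scalerAr -!scalerAl mulr1 !mulrA.
  by rewrite rmorphD /=; lin.
have p1 : pos (c%:C *: (1%:U - w * w)).
  apply: (posZ H) => //; apply: (pos_sub_nr H); first exact: (saM H).
  by rewrite (nr_sa_sq H) // expr2; have := nr_ge0 H w; nra.
have p2 : pos (e%:U + w * (m * w)).
  apply: (pos_add_nr H); first by rewrite mulrA -{1}sw; exact: (sa_conj H).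
  apply: le_trans (nrM H _ _) _.
  by have := nr_ge0 H w; have := nr_ge0 H (m * w); nra.
by apply: (posD H); [exact: (pos_conj H) | exact: (posD H)].
Qed.

End Ideals.

(** * Extreme functionals below a sublinear functional *)

Definition real_linear (R : realType) (V : lmodType R[i]) (f : V -> R) : Prop :=
  (forall x y, f (x + y) = f x + f y) /\ (forall r x, f (r%:C *: x) = r * f x).

Record sublinear (R : realType) (V : lmodType R[i]) (p : V -> R) : Prop := Sublinear {
  sublinD : forall x y, p (x + y) <= p x + p y;
  sublinZ : forall r x, 0 < r -> p (r%:C *: x) <= r * p x
}.

Lemma real_linearB (R : realType) (V : lmodType R[i]) (f : V -> R) :
  real_linear f -> forall x y, f (x - y) = f x - f y.
Proof.
case=> fD fZ x y; rewrite fD -scaleN1r (_ : -1 = (-1 : R)%:C) ?fZ ?mulN1r //.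
by rewrite rmorphN rmorph1.
Qed.

Lemma real_linear0 (R : realType) (V : lmodType R[i]) (f : V -> R) :
  real_linear f -> f 0 = 0.
Proof. by move=> lf; rewrite -(subrr 0) real_linearB // subrr. Qed.

Lemma real_linearN (R : realType) (V : lmodType R[i]) (f : V -> R) :
  real_linear f -> forall x, f (- x) = - f x.
Proof. by move=> lf x; rewrite -sub0r real_linearB // real_linear0 // sub0r. Qed.

Section Extreme.
Variables (R : realType) (V : lmodType R[i]).
Implicit Types (p q f g : V -> R) (x y : V) (r s t : R).

Lemma sublinear0 p : sublinear p -> p 0 = 0.
Proof.
case=> pD pZ; have := pZ 2^-1 0; have := pZ 2 0; rewrite !scaler0.
by move=> /(_ (ltr0n _ _)) h /(_ _); rewrite invr_gt0 ltr0n => /(_ isT); lra.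
Qed.

Lemma sublinear_opp p x : sublinear p -> - p (- x) <= p x.
Proof.
by move=> ps; have := sublinD ps x (- x); rewrite subrr sublinear0 //; lra.
Qed.

(* If [q] is the support functional of a set of linear functionals, [push q x]
   is that of its face on which [x] is maximal. *)
Definition push q x y : R := inf [set q (y + t%:C *: x) - t * q x | t in [set t | 0 <= t]].

Lemma push_has_inf q x y : sublinear q ->
  has_inf [set q (y + t%:C *: x) - t * q x | t in [set t | 0 <= t]].
Proof.
move=> qs; split; first by exists (q (y + 0%:C *: x) - 0 * q x); exists 0 => //=.
exists (- q (- y)) => _ [t /= t0 <-].
have : t * q x <= q (y + t%:C *: x) + q (- y).
  have := sublinD qs (y + t%:C *: x) (- y); rewrite addrC addKr.
  move: t0; rewrite le_eqVlt => /orP[/eqP<-|t0].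
    by rewrite scale0r sublinear0 // !mul0r.
  apply: le_trans; have := sublinZ qs (t%:C *: x) (r := t^-1).
  rewrite invr_gt0 => /(_ t0); rewrite scalerA -rmorphM /= mulVf ?gt_eqF // scale1r.
  by rewrite mulrC ler_pdivlMr // mulrC.
by lra.
Qed.

Lemma push_le q x y t : sublinear q -> 0 <= t -> push q x y <= q (y + t%:C *: x) - t * q x.
Proof.
move=> qs t0; apply: ge_inf; last by exists t.
exact: (push_has_inf x y qs).2.
Qed.

Lemma le_push q x y r : sublinear q ->
  (forall t, 0 <= t -> r <= q (y + t%:C *: x) - t * q x) -> r <= push q x y.
Proof.
move=> qs h; apply: lb_le_inf; first exact: (push_has_inf x y qs).1.
by move=> _ [t /= t0 <-]; exact: h.
Qed.

Lemma push_ler q x y : sublinear q -> push q x y <= q y.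
Proof.
by move=> qs; have := push_le x y qs (lexx 0); rewrite scale0r addr0 mul0r subr0.
Qed.

Lemma push_opp q x : sublinear q -> push q x (- x) <= - q x.
Proof.
by move=> qs; have := push_le x (- x) qs ler01; rewrite scale1r addNr sublinear0 // mul1r sub0r.
Qed.

Lemma push_sublinear q x : sublinear q -> sublinear (push q x).
Proof.
move=> qs; split=> [y z|r y r0].
  rewrite -lerBlDl; apply: le_push => // t t0.
  rewrite lerBlDl -lerBlDr; apply: le_push => // u u0.
  rewrite lerBlDr; have tu : 0 <= u + t by exact: addr_ge0.
  apply: le_trans (push_le x (y + z) qs tu) _.
  have -> : y + z + (u + t)%:C *: x = (y + u%:C *: x) + (z + t%:C *: x).
    by rewrite rmorphD scalerDl addrACA.
  by have := sublinD qs (y + u%:C *: x) (z + t%:C *: x); lra.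
rewrite mulrC -ler_pdivrMr //; apply: le_push => // t t0.
rewrite ler_pdivrMr //.
apply: le_trans (push_le x _ qs (_ : 0 <= r * t)) _; first by rewrite mulr_ge0 // ltW.
have -> : r%:C *: y + (r * t)%:C *: x = r%:C *: (y + t%:C *: x).
  by rewrite rmorphM scalerDr scalerA.
by have := sublinZ qs (y + t%:C *: x) r0; lra.
Qed.

(* The faces of the convex set of linear functionals below [p], described by
   their support functions. *)
Definition face p q := sublinear q /\ (forall x, q x <= p x) /\
  forall s f g, 0 < s < 1 -> real_linear f -> real_linear g ->
    (forall x, f x <= p x) -> (forall x, g x <= p x) ->
    (forall x, s * f x + (1 - s) * g x <= q x) ->
    (forall x, f x <= q x) /\ (forall x, g x <= q x).

(** Evaluating the mixture at [-x], where [push q x] is at most [- q x], forces [f x = g x = q x].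
    Then [f y = f (y + t x) - t q x] is bounded by every term of the infimum. *)
Lemma face_push p q x : face p q -> face p (push q x).
Proof.
case=> qs [qp qF]; split; first exact: push_sublinear.
split=> [y|s f g s01 lf lg fp gp fgq]; first exact: le_trans (push_ler _ _ qs) (qp y).
have [fq gq] : (forall x, f x <= q x) /\ (forall x, g x <= q x).
  by apply: (qF s f g s01 lf lg fp gp) => y; apply: le_trans (fgq y) _; exact: push_ler.
have := fgq (- x); rewrite (real_linearN lf) (real_linearN lg) => h.
have := push_opp x qs => h'; have fqx := fq x; have gqx := gq x.
case/andP: s01 => s0 s1.
have fx : f x = q x by apply/eqP; rewrite eq_le fqx /=; nra.
have gx : g x = q x by apply/eqP; rewrite eq_le gqx /=; nra.
split=> y; apply: le_push => // t t0.
  by have := fq (y + t%:C *: x); rewrite lf.1 lf.2 fx; lra.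
by have := gq (y + t%:C *: x); rewrite lg.1 lg.2 gx; lra.
Qed.

(** The pointwise infimum works: for subadditivity, two members that nearly attain it at [x] and at
    [y] are comparable, and the smaller one serves both. *)
Lemma face_chain p (A : set (V -> R)) : A !=set0 ->
  (forall q, A q -> face p q) -> total_on A (fun q1 q2 => forall x, q2 x <= q1 x) ->
  exists2 q, face p q & forall q1, A q1 -> forall x, q x <= q1 x.
Proof.
case=> q0 Aq0 Af Atot; pose S x := [set q x | q in A]; pose q x := inf (S x).
have Sinf x : has_inf (S x).
  split; first by exists (q0 x); exists q0.
  exists (- p (- x)) => _ [r Ar <-].
  have [rs [rp _]] := Af _ Ar.
  by apply: le_trans (sublinear_opp x rs); rewrite lerN2.
have qle (r : V -> R) x : A r -> q x <= r x by move=> Ar; apply: ge_inf; [exact: (Sinf x).2|exists r].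
have qge x c : (forall r : V -> R, A r -> c <= r x) -> c <= q x.
  by move=> h; apply: lb_le_inf; [exact: (Sinf x).1|move=> _ [r Ar <-]; exact: h].
exists q => // [|r Ar x]; last exact: qle.
have qs : sublinear q.
  split=> [x y|r x r0].
    rewrite -lerBlDl; apply: (qge y) => r1 A1; rewrite lerBlDl -lerBlDr.
    apply: (qge x) => r2 A2; rewrite lerBlDr.
    have [r12|r21] := Atot _ _ A1 A2.
      apply: le_trans (qle _ _ A2) _; have [rs _] := Af _ A2.
      by apply: le_trans (sublinD rs _ _) _; rewrite lerD2l.
    apply: le_trans (qle _ _ A1) _; have [rs _] := Af _ A1.
    by apply: le_trans (sublinD rs _ _) _; rewrite lerD2r.
  rewrite mulrC -ler_pdivrMr //; apply: (qge x) => f Af'; rewrite ler_pdivrMr //.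
  apply: le_trans (qle _ _ Af') _; have [rs _] := Af _ Af'.
  by rewrite mulrC; exact: sublinZ.
split=> //; split=> [x|s f g s01 lf lg fp gp fgq].
  by apply: le_trans (qle _ _ Aq0) _; have [_ []] := Af _ Aq0.
have fg (r : V -> R) : A r -> (forall x, f x <= r x) /\ (forall x, g x <= r x).
  move=> Ar; have [rs [rp rF]] := Af _ Ar.
  by apply: (rF s f g s01 lf lg fp gp) => x; apply: le_trans (fgq x) (qle _ _ Ar).
by split=> x; apply: qge => r /fg[].
Qed.

(** Zorn's lemma, for the reversed order, gives a minimal face [q] below [push p b]. Minimality
    gives [q <= push q x] for all [x]; the term [t = 1] of the infimum makes [q] superadditive,
    hence linear, so the face is an extreme point. Lying below [push p b] yields [q (- b) <= - p b],
    hence [q b = p b]. *)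
Lemma extreme_functional p b : sublinear p -> exists f,
  [/\ real_linear f, forall x, f x <= p x, f b = p b
    & forall s g h, 0 < s < 1 -> real_linear g -> real_linear h ->
      (forall x, g x <= p x) -> (forall x, h x <= p x) ->
      (forall x, f x = s * g x + (1 - s) * h x) -> forall x, g x = f x].
Proof.
move=> ps; have pf : face p p by split.
have p0f := face_push b pf; set p0 := push p b in p0f.
pose T := {q : V -> R | face p q /\ forall x, q x <= p0 x}.
pose Rl (u v : T) := `[< forall x, sval v x <= sval u x >].
have t0 : T by exists p0; split.
have [|||[q [qf qp0]] qmax] := @ZL_preorder T t0 Rl.
- by move=> u; apply/asboolP.
- by move=> u v w /asboolP vu /asboolP wv; apply/asboolP => x; exact: le_trans (wv x) (vu x).
- move=> A Atot; have [[a0 Aa0]|A0] := pselect (A !=set0); last first.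
    by exists t0 => s As; case: A0; exists s.
  have [||| q qf ql] := @face_chain p [set sval u | u in A].
  + by exists (sval a0); exists a0.
  + by move=> _ [u _ <-]; case: (svalP u).
  + move=> _ _ [u Au <-] [v Av <-].
    by have [/asboolP h|/asboolP h] := Atot _ _ Au Av; [left|right].
  have qp0 x : q x <= p0 x.
    by apply: le_trans (ql (sval a0) _ x) _; [exists a0|case: (svalP a0)].
  exists (exist _ q (conj qf qp0)) => u Au; apply/asboolP => x /=.
  by apply: ql; exists u.
have [qs [qp qF]] := qf.
have qpush x y : q y <= push q x y.
  have pp : face p (push q x) /\ forall y, push q x y <= p0 y.
    by split=> [|z]; [exact: face_push | exact: le_trans (push_ler _ _ qs) (qp0 z)].
  have /qmax/asboolP : Rl (exist _ q (conj qf qp0)) (exist _ _ pp).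
    by apply/asboolP => z; exact: push_ler.
  exact.
have qD x y : q (x + y) = q x + q y.
  apply/eqP; rewrite eq_le (sublinD qs) /=.
  have := le_trans (qpush x y) (push_le x y qs ler01).
  by rewrite scale1r mul1r addrC [y + x]addrC; lra.
have qN x : q (- x) = - q x.
  by have := qD x (- x); rewrite subrr sublinear0 //; lra.
have qZ0 r x : 0 < r -> q (r%:C *: x) = r * q x.
  move=> r0; apply/eqP; rewrite eq_le (sublinZ qs) //=.
  have := sublinZ qs (r%:C *: x) (r := r^-1); rewrite invr_gt0 => /(_ r0).
  by rewrite scalerA -rmorphM /= mulVf ?gt_eqF // scale1r mulrC ler_pdivlMr // mulrC.
have ql : real_linear q.
  split=> // r x; have [r0|r0|->] := ltgtP r 0; last by rewrite scale0r sublinear0 // mul0r.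
    rewrite -[r]opprK rmorphN scaleNr qN qZ0 ?mulNr // oppr_gt0 //.
  exact: qZ0.
exists q; split=> //.
  apply/eqP; rewrite eq_le qp /=.
  have := le_trans (qp0 (- b)) (push_opp b ps); rewrite qN; lra.
move=> s g h s01 lg lh gp hp qE.
have [gq _] : (forall x, g x <= q x) /\ (forall x, h x <= q x).
  by apply: (qF s g h s01 lg lh gp hp) => x; rewrite qE.
by move=> x; apply/eqP; rewrite eq_le gq /= -lerN2 -qN -real_linearN.
Qed.

End Extreme.

(** * Pure states *)

Section ComplexRe.
Variable R : realType.
Implicit Types x y : R[i].
Lemma ReD x y : complex.Re (x + y) = complex.Re x + complex.Re y.
Proof. by case: x; case: y. Qed.
Lemma ReZr (r : R) x : complex.Re (r%:C * x) = r * complex.Re x.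
Proof. by case: x => a b /=; rewrite mul0r subr0. Qed.
Lemma ReJ x : complex.Re (Num.conj x) = complex.Re x.
Proof. by case: x. Qed.
Lemma Re_le x y : x <= y -> complex.Re x <= complex.Re y.
Proof. by rewrite lecE => /andP[]. Qed.
Lemma ge0_ReE x : 0 <= x -> x = (complex.Re x)%:C.
Proof. by case: x => a b; rewrite lecE /= => /andP[/eqP-> _]. Qed.
Lemma complex_ReE x : x = Complex (complex.Re x) (- complex.Re ('i%C * x)).
Proof. by case: x => a b /=; rewrite mul0r sub0r mul1r opprK. Qed.
End ComplexRe.

Section States.
Variables (R : realType) (U : algType R[i]) (st : U -> U) (nr : U -> R).
Hypothesis H : unital_cstar st nr.
Variable M : U -> Prop.
Hypothesis HM : closed_ideal nr M.
Implicit Types (a b h x y z m j : U) (c d e r t : R).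
Local Notation "c %:U" := (c%:C *: (1 : U)) (at level 2, format "c %:U").
Ltac lin := linear_eq (R[i] : fieldType) U.
Local Notation sa := (sa st).
Local Notation pos := (pos st nr).

Definition re x : U := 2^-1%:C *: (x + st x).

Lemma sa_re x : sa (re x).
Proof. by apply: (saZ H); rewrite /sa (stD H) (stK H) addrC. Qed.

Lemma re_sa x : sa x -> re x = x.
Proof. by rewrite /re => ->; lin. Qed.

Lemma reD x y : re (x + y) = re x + re y.
Proof. by rewrite /re (stD H); lin. Qed.

Lemma reZ r x : re (r%:C *: x) = r%:C *: re x.
Proof. by rewrite /re (stZr H); lin. Qed.

Lemma nr_re x : nr (re x) <= nr x.
Proof.
rewrite (nrZr H) ger0_norm ?invr_ge0 //; have := nrD H x (st x).
by rewrite (nr_st H); lra.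
Qed.

(* The [t] such that [re x <= t] modulo [M]. *)
Definition upper_bounds x : set R :=
  [set t | exists m, [/\ M m, sa m & pos (t%:U - re x - m)]].
(** The support functional of the state space of the quotient by [M]: for proper [M], the real
    linear functionals below it are exactly the states, by [state_le_gauge] and [le_gauge_state]. *)
Definition gauge x : R := inf (upper_bounds x).

Lemma upper_bounds_nr x : upper_bounds x (nr x).
Proof.
exists 0; split; [exact: (ci0 HM) | exact: (st0 H) |].
by rewrite subr0; apply: (pos_sub_nr H); [exact: sa_re | exact: nr_re].
Qed.

Section Proper.
Hypothesis M1 : ~ M 1.

Lemma one_far : exists2 d, 0 < d & forall j, M j -> d <= nr (1 - j).
Proof.
apply/not_exists2P => h; apply: M1; apply: (ci_closed HM) => e e0.
have [//|/existsNP[j /not_implyP[Mj /negP]]] := h e.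
by rewrite -ltNge => /ltW; exists j.
Qed.

Lemma upper_bounds_lb x t : upper_bounds x t -> - (nr x + 1) <= t.
Proof.
case=> m [Mm sm pm]; rewrite leNgt; apply/negP => tx.
have [d d0 dP] := one_far.
(* A bound [t] below [- (nr x + 1)] would give [-1 - m >= 0]. By [ideal_dominated] with constant 0
   the unit would then be arbitrarily close to [M]. *)
have p1 : pos (0%:U - st 1 * 1 - m).
  have -> : 0%:U - st 1 * 1 - m = (t%:U - re x - m) +
     (((nr x)%:U + re x) + (- (t + nr x + 1))%:U).
    by rewrite (st1 H) mulr1 rmorphN !rmorphD /=; lin.
  apply: (posD H) => //; apply: (posD H); last by apply: (posC H); lra.
  by apply: (pos_add_nr H); [exact: sa_re | exact: nr_re].
have d2 : 0 < d ^+ 2 / 2 by rewrite divr_gt0 ?exprn_gt0.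
have [j Mj] := ideal_dominated H HM Mm sm (lexx 0) p1 d2.
by rewrite add0r mul1r; have := dP j Mj; nra.
Qed.

Lemma gauge_has_inf x : has_inf (upper_bounds x).
Proof.
split; first by exists (nr x); exact: upper_bounds_nr.
by exists (- (nr x + 1)) => t; exact: upper_bounds_lb.
Qed.

Lemma gauge_le x t m : M m -> sa m -> pos (t%:U - re x - m) -> gauge x <= t.
Proof.
by move=> Mm sm pm; apply: ge_inf; [exact: (gauge_has_inf x).2 | exists m].
Qed.

Lemma le_gauge x c : (forall t m, M m -> sa m -> pos (t%:U - re x - m) -> c <= t) ->
  c <= gauge x.
Proof.
move=> h; apply: lb_le_inf; first exact: (gauge_has_inf x).1.
by move=> t [m [Mm sm pm]]; exact: h pm.
Qed.

Lemma gauge_sublinear : sublinear gauge.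
Proof.
split=> [x y|r x r0].
  rewrite -lerBlDl; apply: le_gauge => t2 m2 M2 s2 p2.
  rewrite lerBlDl -lerBlDr; apply: le_gauge => t1 m1 M1' s1 p1.
  rewrite lerBlDr; apply: (@gauge_le _ _ (m1 + m2)).
  - exact: (ciD HM).
  - exact: (saD H).
  - have -> : (t1 + t2)%:U - re (x + y) - (m1 + m2) =
      (t1%:U - re x - m1) + (t2%:U - re y - m2) by rewrite reD rmorphD /=; lin.
    exact: (posD H).
rewrite mulrC -ler_pdivrMr //; apply: le_gauge => t m Mm sm pm; rewrite ler_pdivrMr //.
apply: (@gauge_le _ _ (r%:C *: m)); [exact: (ciZ HM) | exact: (saZ H) |].
have -> : (t * r)%:U - re (r%:C *: x) - r%:C *: m = r%:C *: (t%:U - re x - m).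
  by rewrite reZ rmorphM /=; lin.
by apply: (posZ H) => //; exact: ltW.
Qed.

Definition state (f : U -> R) : Prop :=
  [/\ real_linear f, forall h, pos h -> 0 <= f h, f 1 = 1,
      forall x, f (st x) = f x & forall m, M m -> f m = 0].

Lemma state_le_gauge f : state f -> forall x, f x <= gauge x.
Proof.
case=> lf fp f1 fs fM x; apply: le_gauge => t m Mm sm pm.
have := fp _ pm; rewrite !(real_linearB lf) lf.2 f1 mulr1 (fM _ Mm) subr0.
by rewrite /re lf.2 lf.1 fs; lra.
Qed.

Lemma le_gauge_state f : real_linear f -> (forall x, f x <= gauge x) -> state f.
Proof.
move=> lf fg.
have fneg h : pos h -> f (- h) <= 0.
  move=> ph; apply: le_trans (fg _) _; apply: (@gauge_le _ _ 0).
  - exact: (ci0 HM).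
  - exact: (st0 H).
  - rewrite re_sa; last by apply: (saN H); exact: pos_sa ph.
    by rewrite scale0r sub0r opprK subr0.
have fM m : M m -> f m <= 0.
  move=> Mm; apply: le_trans (fg _) _; apply: (@gauge_le _ _ (- re m)).
  - by apply: (ciN HM); apply: (ciZ HM); apply: (ciD HM) => //; exact: (ideal_st H HM).
  - by apply: (saN H); exact: sa_re.
  - by rewrite scale0r sub0r opprK addNr; exact: (pos0 H).
have fs x : f (x - st x) <= 0.
  apply: le_trans (fg _) _; apply: (@gauge_le _ _ 0).
  - exact: (ci0 HM).
  - exact: (st0 H).
  - rewrite /re (stB H) (stK H) (_ : _ - _ - 0 = 0); first exact: (pos0 H).
    by lin.
have f1 c : f c%:U <= c.
  apply: le_trans (fg _) _; apply: (@gauge_le _ _ 0).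
  - exact: (ci0 HM).
  - exact: (st0 H).
  - rewrite re_sa ?subrr ?subr0; first exact: (pos0 H).
    exact: (saC H).
split=> //.
- by move=> h /fneg; rewrite real_linearN // oppr_le0.
- have := f1 1; have := f1 (-1); rewrite !lf.2; lra.
- move=> x; have := fs x; have := fs (st x); rewrite (stK H) !(real_linearB lf); lra.
- move=> m Mm; have := fM _ Mm; have := fM _ (ciN HM Mm); rewrite real_linearN //; lra.
Qed.

(** If [st x x <= t] modulo [M], then [|x (1 - j)|^2 <= t + e] for some [j] in [M], and [x j] is a
    competitor for the distance from [x] to [M]. *)
Lemma gauge_stM x : (forall j, M j -> 1 <= nr (x - j)) -> 1 <= gauge (st x * x).
Proof.
move=> xM; apply: le_gauge => t m Mm sm; rewrite re_sa; last exact: (sa_stM H).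
move=> pm; apply/ler_addgt0Pr => e e0.
have key c : 0 <= c -> pos (c%:U - st x * x - m) -> forall e, 0 < e -> 1 <= c + e.
  move=> c0 pc e' e'0; have [j Mj] := ideal_dominated H HM Mm sm c0 pc e'0.
  apply: le_trans; have := xM _ (ciMl HM x Mj).
  by rewrite mulrBr mulr1; have := nr_ge0 H (x - x * j); nra.
have [t0|t0] := leP 0 t; first exact: key.
(* A negative [t] could be raised to 0, and [key] with [e = 1/2] would give [1 <= 1/2]. *)
have : 1 <= 0 + (2^-1 : R).
  apply: key => //; last by rewrite invr_gt0.
  have -> : 0%:U - st x * x - m = (t%:U - st x * x - m) + (- t)%:U.
    by rewrite rmorphN /=; lin.
  by apply: (posD H) => //; apply: (posC H); rewrite oppr_ge0 ltW.
by lra.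
Qed.

Lemma pure_state_real x : (forall j, M j -> 1 <= nr (x - j)) -> exists f,
  [/\ state f, 1 <= f (st x * x) & forall g, real_linear g ->
      (forall h, pos h -> 0 <= g h <= f h) -> (forall y, g (st y) = g y) ->
      (forall m, M m -> g m = 0) -> forall y, g y = g 1 * f y].
Proof.
move=> xM; have [f [lf fg fx fext]] := extreme_functional (st x * x) gauge_sublinear.
have fS := le_gauge_state lf fg; have [_ fp f1 fs fM] := fS.
exists f; split=> //; first by rewrite fx; exact: gauge_stM.
move=> g lg g01 gs gM y; pose c := g 1.
have p1 : pos 1 by have := posC H ler01; rewrite scale1r.
have /andP[c0 c1] : 0 <= c <= 1 by rewrite -[1 in X in _ && X]f1; exact: g01.
(* Instead of splitting [f] into [g] and [f - g], it is split into [f/4 + g/2] and [3f/4 - g/2]. The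
   weights [s] and [1 - s] then stay in [1/4, 3/4] even when [c] is 0 or 1. *)
pose s : R := 4^-1 + c / 2.
have s01 : 0 < s < 1 by rewrite /s; lra.
pose g1 z := (f z / 4 + g z / 2) / s; pose g2 z := (f z * (3 / 4) - g z / 2) / (1 - s).
have sN : s != 0 by rewrite gt_eqF; case/andP: s01.
have s'0 : 0 < 1 - s by case/andP: s01 => *; rewrite subr_gt0.
have s'N : 1 - s != 0 by rewrite gt_eqF.
have sp : 0 < s by case/andP: s01.
have l1 : real_linear g1.
  by split=> [u v|r u]; rewrite /g1 ?lf.1 ?lg.1 ?lf.2 ?lg.2; ring.
have l2 : real_linear g2.
  by split=> [u v|r u]; rewrite /g2 ?lf.1 ?lg.1 ?lf.2 ?lg.2; ring.
have st1' : state g1.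
  split=> // [h ph||z|m Mm]; rewrite /g1.
  - by rewrite divr_ge0 ?(ltW sp) //; have /andP[] := g01 _ ph; lra.
  - by rewrite f1 -/c mul1r /s; field; rewrite gt_eqF //; lra.
  - by rewrite fs gs.
  - by rewrite fM // gM // !mul0r addr0 mul0r.
have st2' : state g2.
  split=> // [h ph||z|m Mm]; rewrite /g2.
  - by rewrite divr_ge0 ?(ltW s'0) //; have /andP[] := g01 _ ph; lra.
  - rewrite f1 -/c (_ : 1 * (3/4) - c / 2 = 1 - s) ?mulfV //.
    by rewrite /s; field.
  - by rewrite fs gs.
  - by rewrite fM // gM // !mul0r subrr mul0r.
have fE z : f z = s * g1 z + (1 - s) * g2 z.
  rewrite /g1 /g2 mulrCA mulfV // mulr1 mulrCA mulfV // mulr1.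
  by field.
have := fext s g1 g2 s01 l1 l2 (state_le_gauge st1') (state_le_gauge st2') fE y.
rewrite /g1 => /(congr1 (fun v => v * s)); rewrite mulfVK // /s => e.
by rewrite -/c; lra.
Qed.

End Proper.

(** With [s^2 = h + d] the product [c s^2] is congruent modulo [M] to the positive element [s c s],
    and [f] vanishes on [M]. *)
Lemma state_central f (c : U) h : state f -> pos c -> (forall y, M (c * y - y * c)) ->
  pos h -> 0 <= f (c * h).
Proof.
case=> lf fp f1 fs fM pc cM ph; apply/ler_addgt0Pr => e e0.
pose d := e / (f c + 1); have fc := fp _ pc.
have d0 : 0 < d by rewrite divr_gt0 // ltr_wpDl.
have [s [ss s2 _ _]] := pos_sqrt H ph d0.
have : 0 <= f (s * c * s) by apply: fp; rewrite -{1}ss; exact: (pos_conj H).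
have -> : s * c * s = c * (s * s) - (c * s - s * c) * s.
  by rewrite mulrBl !mulrA; lin.
rewrite (real_linearB lf) (fM ((_ - _) * s)) ?subr0; last exact/(ciMr HM)/cM.
rewrite s2 mulrDr -scalerAr mulr1 lf.1 lf.2 => h0; apply: le_trans h0 _.
rewrite lerD2l /d mulrAC ler_pdivrMr; last by rewrite ltr_wpDl.
by nra.
Qed.

Theorem pure_state x : (forall j, M j -> 1 <= nr (x - j)) -> exists F : U -> R[i],
  [/\ [/\ forall y z, F (y + z) = F y + F z, forall k y, F (k *: y) = k * F y
        & forall y, F (st y) = Num.conj (F y)],
      [/\ F 1 = 1, forall m, M m -> F m = 0 & forall h, pos h -> 0 <= F h],
      1 <= F (st x * x),
      forall c : U, (forall y, M (c * y - y * c)) -> forall y, F (c * y) = F c * F y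
    & forall G : U -> R[i], (forall y z, G (y + z) = G y + G z) ->
        (forall k y, G (k *: y) = k * G y) -> (forall y, G (st y) = Num.conj (G y)) ->
        (forall m, M m -> G m = 0) -> (forall y, 0 <= G (st y * y) <= F (st y * y)) ->
        forall y, G y = G 1 * F y].
Proof.
move=> xM; have M1 : ~ M 1.
  move=> M1; have := xM x; rewrite subrr (nr0 H) -{1}[x]mulr1 => /(_ (ciMl HM x M1)).
  by rewrite ler10.
have [f [fS fx fpure]] := pure_state_real M1 xM; have [lf fp f1 fs fM] := fS.
have ii : 'i%C * 'i%C = -1 :> R[i] by rewrite -sqr_i.
have ci : Num.conj 'i%C = - 'i%C :> R[i] by simpc.
(* The complex-linear functional with real part [f]. It is real on self-adjoint elements because [f]
   is invariant under [st]. *)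
pose F y := Complex (f y) (- f ('i%C *: y)).
have lfsa g h : real_linear g -> (forall y, g (st y) = g y) -> sa h -> g ('i%C *: h) = 0.
  move=> lg gs sh; have := gs ('i%C *: h); rewrite (stZ H) ci sh scaleNr real_linearN //.
  by lra.
have Fsa h : sa h -> F h = (f h)%:C by move=> sh; rewrite /F lfsa // oppr0.
have fi y : f ('i%C *: ('i%C *: y)) = - f y by rewrite scalerA ii scaleN1r real_linearN.
have FD y z : F (y + z) = F y + F z.
  by rewrite /F scalerDr !lf.1 opprD; simpc.
have FZ k y : F (k *: y) = k * F y.
  case: k => a b; have -> : (a +i* b) *: y = a%:C *: y + b%:C *: ('i%C *: y).
    by rewrite scalerA -scalerDl; congr (_ *: _); simpc.
  rewrite /F scalerDr 2!(scalerA 'i%C) ![_ * _%:C]mulrC -!scalerA !lf.1 !lf.2 fi.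
  by simpc; congr (_ +i* _); ring.
have Fs y : F (st y) = Num.conj (F y).
  rewrite /F fs (_ : 'i%C *: st y = - st ('i%C *: y)).
    by rewrite real_linearN // fs.
  by rewrite (stZ H) ci scaleNr opprK.
have Fp h : pos h -> 0 <= F h.
  by move=> ph; rewrite Fsa ?ler0c ?fp //; exact: pos_sa ph.
(* Rescale [c] to [c' = (N + c) / (2 N)], for which [0 <= c' <= 1]. By [state_central] for [c'] and
   [1 - c'] the functional [z |-> f (c' z)] lies between 0 and [f], so purity makes it the multiple
   [f c'] of [f]. *)
have Fc (c : U) y : sa c -> (forall y, M (c * y - y * c)) -> F (c * y) = F c * F y.
  move=> sc cM; have [N N0 cN] : exists2 N, 0 < N & nr c <= N.
    by exists (nr c + 1); rewrite ?lerDl // ltr_wpDl // (nr_ge0 H).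
  pose c' := (2 * N)^-1%:C *: (N%:U + c).
  have c'M z : M (c' * z - z * c').
    have -> : c' * z - z * c' = (2 * N)^-1%:C *: (c * z - z * c).
      rewrite /c'; set kk := (_^-1)%:C.
      by rewrite -scalerAl -scalerAr mulrDl mulrDr -scalerAl -scalerAr mul1r mulr1; lin.
    exact: (ciZ HM).
  have pc' : pos c' by apply: (posZ H); [rewrite invr_ge0 mulr_ge0 ?ltW | exact: (pos_add_nr H)].
  have p1c' : pos (1 - c').
    have -> : 1 - c' = (2 * N)^-1%:C *: (N%:U - c).
      have e1 : (2 * N)^-1%:C * N%:C = 2^-1%:C :> R[i].
        by rewrite -rmorphM /=; congr (_%:C); field; rewrite gt_eqF.
      by rewrite /c' scalerDr scalerBr !scalerA e1; move: (_ * _)^-1%:C => kk; lin.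
    by apply: (posZ H); [rewrite invr_ge0 mulr_ge0 ?ltW | exact: (pos_sub_nr H)].
  have cE : c = (2 * N)%:C *: c' - N%:U.
    by rewrite scalerA -rmorphM /= mulfV ?gt_eqF ?mulr_gt0 // scale1r addrC addKr.
  clearbody c'.
  have lg : real_linear (fun z => f (c' * z)).
    by split=> [u v|r u]; rewrite ?mulrDr -?scalerAr ?lf.1 ?lf.2.
  have e' z : f (c' * z) = f c' * f z.
    rewrite (fpure (fun z => f (c' * z))) ?mulr1 //.
    - move=> h ph; rewrite (state_central fS) //=.
      have := @state_central f (1 - c') h fS p1c' _ ph.
      rewrite mulrBl mul1r (real_linearB lf) subr_ge0; apply=> w.
      rewrite mulrBl mulrBr mul1r mulr1 (_ : w - c' * w - (w - w * c') = - (c' * w - w * c')).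
        exact: (ciN HM).
      by lin.
    - move=> w; rewrite -[LHS]fs (stM H) (stK H) (pos_sa pc').
      by have /eqP := fM _ (c'M w); rewrite (real_linearB lf) subr_eq0 => /eqP ->.
    - by move=> m Mm; apply: fM; exact: (ciMl HM).
  have e z : f (c * z) = f c * f z.
    rewrite {1}cE mulrBl -!scalerAl mul1r (real_linearB lf) !lf.2 e'.
    by rewrite {1}cE (real_linearB lf) !lf.2 f1; ring.
  by rewrite {1}/F scalerAr !e Fsa // /F; simpc.

exists F; split.
- by split.
- split=> //; first by rewrite Fsa ?f1 //; exact: (sa1 H).
  by move=> m Mm; rewrite /F !fM ?oppr0 //; exact: (ciZ HM).
- by rewrite Fsa ?lecR //; exact: (sa_stM H).
- move=> c cM y; have sM z : M (st c * z - z * st c).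
    have -> : st c * z - z * st c = st (- (c * st z - st z * c)).
      by rewrite (stN H) (stB H) !(stM H) (stK H) opprB.
    by apply: (ideal_st H HM); exact: (ciN HM).
  pose k := (- 2^-1%:C * 'i%C) *: (c - st c).
  have cE : c = re c + 'i%C *: k.
    by rewrite /re /k scalerA mulrCA ii mulrN1 opprK; lin.
  have sk : sa k.
    rewrite /sa /k (stZ H) (stB H) (stK H).
    rewrite (_ : Num.conj (- 2^-1%:C * 'i%C) = 2^-1%:C * 'i%C :> R[i]); last by rewrite -[Num.conj _]/(conjc _); simpc; rewrite ?oppr0.
    by rewrite mulNr scaleNr -scalerN opprB.
  have rM z : M (re c * z - z * re c).
    have -> : re c * z - z * re c = 2^-1%:C *: ((c * z - z * c) + (st c * z - z * st c)).
      by rewrite /re -scalerAl -scalerAr mulrDl mulrDr; lin.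
    by apply: (ciZ HM); exact: (ciD HM).
  have kM z : M (k * z - z * k).
    have -> : k * z - z * k = (- 2^-1%:C * 'i%C) *: ((c * z - z * c) - (st c * z - z * st c)).
      by rewrite /k -scalerAl -scalerAr mulrBl mulrBr; lin.
    by apply: (ciZ HM); exact: (ciB HM).
  rewrite {1 2}cE; move: (re c) (k) (sa_re c) sk rM kM => h l sh sl hM lM.
  by rewrite mulrDl -scalerAl !FD !FZ (Fc h) // (Fc l) // mulrDl mulrA.
- move=> G GD GZ Gs GM G01 y.
  pose g z := complex.Re (G z).
  have lg : real_linear g.
    by split=> [u v|r u]; rewrite /g ?GD ?GZ ?ReD ?ReZr.
  (* The hypothesis compares [G] and [F] on the elements [st y * y]; a positive [h] becomes such an
     element after adding a small multiple of 1. *)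
  have g01 h : pos h -> 0 <= g h <= f h.
    move=> ph.
    have sq s : sa s -> 0 <= g (s * s) <= f (s * s).
      move=> ss; have := G01 s; rewrite ss Fsa; last exact: (saM H).
      by case/andP=> /Re_le h1 /Re_le h2; rewrite /g h1.
    have g1 : 0 <= g 1 <= f 1 by rewrite -[1]mulr1; apply: sq; exact: (sa1 H).
    apply/andP; split.
      apply/ler_addgt0Pr => e e0; pose d := e / (g 1 + 1).
      have g10 : 0 < g 1 + 1 by case/andP: g1; lra.
      have d0 : 0 < d by rewrite divr_gt0.
      have [s [ss s2 _ _]] := pos_sqrt H ph d0.
      have /andP[] := sq _ ss; rewrite s2 lg.1 lg.2 => h0 _; apply: le_trans h0 _.
      by rewrite lerD2l /d mulrAC ler_pdivrMr //; nra.
    apply/ler_addgt0Pr => e e0; pose d := e.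
    have [s [ss s2 _ _]] := pos_sqrt H ph e0.
    have /andP[_] := sq _ ss; rewrite s2 lg.1 lg.2 lf.1 lf.2 f1.
    by case/andP: g1; nra.
  have gs z : g (st z) = g z by rewrite /g Gs ReJ.
  have gE : forall y, g y = g 1 * f y.
    by apply: fpure => // m Mm; rewrite /g GM.
  have G1 : G 1 = (g 1)%:C.
    by have /andP[+ _] := G01 1; rewrite (st1 H) mulr1 => /ge0_ReE.
  have GE z : G z = Complex (g z) (- g ('i%C *: z)) by rewrite {1}[G z]complex_ReE /g GZ.
  by rewrite GE (gE y) (gE ('i%C *: y)) G1 /F; simpc.
Qed.
End States.

(** * Hilbert space completion *)

Section ComplexAbs.
Variable R : realType.
Implicit Types (x y z : R[i]) (e r : R).

Lemma normcE x : `|x| = (cabs x)%:C. Proof. by []. Qed.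
Lemma cabs_ge0 x : 0 <= cabs x.
Proof. by rewrite -ler0c -normcE normr_ge0. Qed.
Lemma cabs0 : cabs (0 : R[i]) = 0. Proof. exact: ComplexField.Normc.normc0. Qed.
Lemma cabs_eq0 x : cabs x = 0 -> x = 0. Proof. exact: ComplexField.Normc.eq0_normc. Qed.
Lemma cabsM x y : cabs (x * y) = cabs x * cabs y.
Proof. exact: ComplexField.Normc.normcM. Qed.
Lemma cabsD x y : cabs (x + y) <= cabs x + cabs y.
Proof. by rewrite -lecR rmorphD /= -!normcE ler_normD. Qed.
Lemma cabsN x : cabs (- x) = cabs x.
Proof. by apply: complexI; rewrite -!normcE normrN. Qed.
Lemma cabsBC x y : cabs (x - y) = cabs (y - x).
Proof. by rewrite -cabsN opprB. Qed.
Lemma cabsJ x : cabs (Num.conj x) = cabs x.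
Proof. by case: x => a b /=; rewrite sqrrN. Qed.
Lemma mulJ x : x * Num.conj x = (cabs x ^+ 2)%:C.
Proof. by rewrite -normCK normcE rmorphXn. Qed.
Lemma cabs_triangle x y z : cabs (x - z) <= cabs (x - y) + cabs (y - z).
Proof. by rewrite -[x - z](subrKA y) cabsD. Qed.
Lemma Re_le_cabs x : `|complex.Re x| <= cabs x.
Proof. by case: x => a b /=; rewrite -sqrtr_sqr ler_wsqrtr // lerDl sqr_ge0. Qed.
Lemma Im_le_cabs x : `|complex.Im x| <= cabs x.
Proof. by case: x => a b /=; rewrite -sqrtr_sqr ler_wsqrtr // lerDr sqr_ge0. Qed.
Lemma cabs_le_ReIm x : cabs x <= `|complex.Re x| + `|complex.Im x|.
Proof.
have -> : x = (complex.Re x)%:C + 'i%C * (complex.Im x)%:C by exact: complexE.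
apply: le_trans (cabsD _ _) _; rewrite cabsM !cabs_real.
by case: x => a b /=; rewrite !(mul0r, mulr0, subr0, addr0, mul1r, expr0n, add0r, expr1n) sqrtr1 mul1r.
Qed.
Lemma ImB x y : complex.Im (x - y) = complex.Im x - complex.Im y.
Proof. by case: x; case: y. Qed.
Lemma ReB x y : complex.Re (x - y) = complex.Re x - complex.Re y.
Proof. by case: x; case: y. Qed.

Lemma cabs_near0 x r : (forall e, 0 < e -> cabs x <= e * r) -> x = 0.
Proof.
move=> h; apply: cabs_eq0; apply/eqP; rewrite eq_le cabs_ge0 andbT.
apply/ler_addgt0Pl => e e0; rewrite addr0.
have r0 : 0 < `|r| + 1 by rewrite ltr_wpDl.
apply: le_trans (h (e / (`|r| + 1)) _) _; first exact: divr_gt0.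
rewrite mulrAC -mulrA ler_piMr ?(ltW e0) // ler_pdivrMr // mul1r.
by have := ler_norm r; lra.
Qed.

(** The intervals of radius [C / (n + 1)] around [a n] meet pairwise, so the supremum of their left
    ends lies in all of them. *)
Lemma cauchy_rate_real (a : nat -> R) (C : R) : 0 <= C ->
  (forall n m, `|a n - a m| <= C / n.+1%:R + C / m.+1%:R) ->
  exists l, forall n, `|a n - l| <= C / n.+1%:R.
Proof.
move=> C0 aC; pose S := range (fun n => a n - C / n.+1%:R).
have ub n : ubound S (a n + C / n.+1%:R).
  move=> _ [m _ <-]; have := aC m n; rewrite ler_norml => /andP[_].
  by move: (C / m.+1%:R) (C / n.+1%:R) => u v; lra.
exists (sup S) => n; rewrite ler_norml; apply/andP; split.
  suff : sup S <= a n + C / n.+1%:R by move: (C / _) => c'; lra.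
  by apply: ge_sup => //; exists (a 0%N - C / 1%:R); exists 0%N.
suff : a n - C / n.+1%:R <= sup S by move: (C / _) => c'; lra.
by apply: sup_upper_bound; [split; [exists (a n - C / n.+1%:R); exists n | exists (a n + C / n.+1%:R)] | exists n].
Qed.

Lemma cauchy_rate (a : nat -> R[i]) (C : R) : 0 <= C ->
  (forall n m, cabs (a n - a m) <= C / n.+1%:R + C / m.+1%:R) ->
  exists l, forall n, cabs (a n - l) <= 2 * C / n.+1%:R.
Proof.
move=> C0 aC.
have [n m|u uP] := @cauchy_rate_real (fun n => complex.Re (a n)) C C0.
  by rewrite -ReB (le_trans (Re_le_cabs _)).
have [n m|v vP] := @cauchy_rate_real (fun n => complex.Im (a n)) C C0.
  by rewrite -ImB (le_trans (Im_le_cabs _)).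
exists (Complex u v) => n; apply: le_trans (cabs_le_ReIm _) _.
by rewrite ReB ImB /=; rewrite -mulrA; have /= := uP n; have /= := vP n; move: (C / _) => c'; lra.
Qed.

Lemma ge0_near z : (forall e, 0 < e -> exists2 b, 0 <= b & cabs (z - b) <= e) -> 0 <= z.
Proof.
move=> h; rewrite lecE /=; apply/andP; split.
  rewrite -normr_eq0 eq_le normr_ge0 andbT; apply/ler_addgt0Pl => e e0.
  have [b b0 zb] := h _ e0; rewrite addr0 -[complex.Im z]subr0.
  have -> : 0 = complex.Im b by rewrite ger0_Im.
  by rewrite -ImB (le_trans (Im_le_cabs _)).
apply/ler_addgt0Pr => e e0; have [b b0 zb] := h _ e0.
have := le_trans (Re_le_cabs _) zb; rewrite ReB ler_norml => /andP[+ _].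
by have := Re_le b0; rewrite /=; lra.
Qed.

End ComplexAbs.

Record psd_form (R : realType) (V : lmodType R[i]) := PsdForm {
  form :> V -> V -> R[i];
  formDl : forall x y z, form (x + y) z = form x z + form y z;
  formZl : forall k x y, form (k *: x) y = k * form x y;
  formC : forall x y, form y x = Num.conj (form x y);
  form_ge0 : forall x, 0 <= form x x
}.

Section PsdForm.
Variables (R : realType) (V : lmodType R[i]) (B : psd_form V).
Implicit Types (x y z v w : V) (k : R[i]).

Lemma formDr x y z : B x (y + z) = B x y + B x z.
Proof. by rewrite formC formDl rmorphD /= -!formC. Qed.
Lemma formZr k x y : B x (k *: y) = Num.conj k * B x y.
Proof. by rewrite formC formZl rmorphM /= -formC. Qed.
Lemma formNl x y : B (- x) y = - B x y.
Proof. by rewrite -scaleN1r formZl mulN1r. Qed.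
Lemma formNr x y : B x (- y) = - B x y.
Proof. by rewrite formC formNl rmorphN /= -formC. Qed.
Lemma formBl x y z : B (x - y) z = B x z - B y z.
Proof. by rewrite formDl formNl. Qed.
Lemma formBr x y z : B x (y - z) = B x y - B x z.
Proof. by rewrite formDr formNr. Qed.
Lemma form0l x : B 0 x = 0.
Proof. by rewrite -(subrr 0) formBl subrr. Qed.

Definition snorm x : R := Num.sqrt (complex.Re (B x x)).

Lemma snorm_ge0 x : 0 <= snorm x. Proof. exact: sqrtr_ge0. Qed.
Lemma snorm_sq x : snorm x ^+ 2 = complex.Re (B x x).
Proof. by rewrite sqr_sqrtr //; have := Re_le (form_ge0 B x). Qed.
Lemma snorm_sqC x : (snorm x ^+ 2)%:C = B x x.
Proof. by rewrite snorm_sq -ge0_ReE // form_ge0. Qed.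

Lemma snormZ k x : snorm (k *: x) = cabs k * snorm x.
Proof.
apply/eqP; rewrite -(@eqrXn2 _ 2) ?snorm_ge0 ?mulr_ge0 ?cabs_ge0 ?snorm_ge0 //; apply/eqP; apply: complexI.
by rewrite snorm_sqC exprMn rmorphM /= snorm_sqC -mulJ formZl formZr mulrA.
Qed.

Lemma cauchy_schwarz x y : cabs (B x y) <= snorm x * snorm y.
Proof.
have sxy : 0 <= snorm x * snorm y by rewrite mulr_ge0 ?snorm_ge0.
rewrite -(ler_pXn2r (n := 2)) ?nnegrE ?cabs_ge0 // exprMn.
set a := snorm x ^+ 2; set c := snorm y ^+ 2; set m := cabs (B x y) ^+ 2.
have a0 : 0 <= a by exact: sqr_ge0.
have c0 : 0 <= c by exact: sqr_ge0.
have m0 : 0 <= m by exact: sqr_ge0.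
have key (r : R) : 0 <= a - 2 * r * m + r ^+ 2 * m * c.
  have := form_ge0 B (x - (r%:C * B x y) *: y).
  rewrite formBl !formBr !formZl !formZr rmorphM /= conj_real (formC B x y).
  have -> : B x x - r%:C * Num.conj (B x y) * B x y -
     (r%:C * B x y * Num.conj (B x y) - r%:C * B x y * (r%:C * Num.conj (B x y) * B y y)) =
     B x x - 2 * r%:C * (B x y * Num.conj (B x y)) + r%:C ^+ 2 * (B x y * Num.conj (B x y)) * B y y.
    by ring.
  rewrite mulJ -!snorm_sqC -/a -/c -/m.
  have -> : a%:C - 2 * r%:C * m%:C + r%:C ^+ 2 * m%:C * c%:C =
      (a - 2 * r * m + r ^+ 2 * m * c)%:C by ring.
  by rewrite ler0c.
(* The form may be degenerate. If [y] has seminorm 0 and [m > 0], then [key] at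
   [r = (a + 1) / (2 m)] reads [0 <= -1]; otherwise [r = 1 / c] is the minimizer. *)
move: c0; rewrite le_eqVlt => /orP[/eqP c0|c0].
  rewrite -c0 mulr0; rewrite leNgt; apply/negP => mp.
  have := key ((a + 1) / (2 * m)); rewrite -c0 mulr0 addr0.
  have -> : 2 * ((a + 1) / (2 * m)) * m = a + 1 by field; rewrite gt_eqF.
  by lra.
have := key c^-1.
have -> : a - 2 / c * m + c^-1 ^+ 2 * m * c = a - m / c by field; rewrite gt_eqF.
by rewrite subr_ge0 ler_pdivrMr.
Qed.

Lemma snormD x y : snorm (x + y) <= snorm x + snorm y.
Proof.
rewrite -(ler_pXn2r (n := 2)) ?nnegrE ?addr_ge0 ?snorm_ge0 //.
rewrite snorm_sq formDl !formDr !ReD (formC B x y) ReJ -!snorm_sq.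
have := le_trans (ler_norm _) (le_trans (Re_le_cabs _) (cauchy_schwarz x y)).
by nra.
Qed.

Lemma snormN x : snorm (- x) = snorm x.
Proof. by rewrite /snorm formNl formNr opprK. Qed.

Lemma snormBC x y : snorm (x - y) = snorm (y - x).
Proof. by rewrite -snormN opprB. Qed.

Lemma snorm_triangle x y z : snorm (x - z) <= snorm (x - y) + snorm (y - z).
Proof. by rewrite -[x - z](subrKA y) snormD. Qed.

End PsdForm.

(* The completion of a pre-Hilbert space, realized as the conjugate-linear
   functionals that are norm limits of functionals [B v]. *)
Section Completion.
Variables (R : realType) (V : lmodType R[i]) (B : psd_form V).
Implicit Types (u v w : V) (d e r : R).

Definition approx e (f : V -> R[i]) v := forall w, cabs (f w - B v w) <= e * snorm B w.

Record hcompl := HCompl {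
  hfun : V -> R[i];
  hcomplP : forall e, 0 < e -> exists v, approx e hfun v
}.
Implicit Types f g h : hcompl.

Lemma hcompl_eq f g : hfun f =1 hfun g -> f = g.
Proof.
case: f g => f fP [g gP] /= /funext fg; subst g; congr HCompl; exact: Prop_irrelevance.
Qed.

HB.instance Definition _ := gen_eqMixin hcompl.
HB.instance Definition _ := gen_choiceMixin hcompl.

Lemma approxD d e (f g : V -> R[i]) v w : approx d f v -> approx e g w ->
  approx (d + e) (fun x => f x + g x) (v + w).
Proof.
move=> fv gw x; rewrite formDl opprD addrACA mulrDl.
exact: le_trans (cabsD _ _) (lerD _ _).
Qed.
Lemma approxZ k e (f : V -> R[i]) v : approx e f v ->
  approx (cabs k * e) (fun x => k * f x) (k *: v).
Proof.
by move=> fv x; rewrite formZl -mulrBr cabsM -mulrA ler_wpM2l ?cabs_ge0.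
Qed.
Lemma approx_le d e (f : V -> R[i]) v : d <= e -> approx d f v -> approx e f v.
Proof. by move=> de fv x; apply: le_trans (fv x) _; rewrite ler_wpM2r ?snorm_ge0. Qed.

Lemma embP v : forall e, 0 < e -> exists w, approx e (B v) w.
Proof.
by move=> e e0; exists v => w; rewrite subrr cabs0 mulr_ge0 ?snorm_ge0 // ltW.
Qed.
Definition emb v := HCompl (embP v).

Lemma haddP f g e : 0 < e -> exists v, approx e (fun x => hfun f x + hfun g x) v.
Proof.
move=> e0; have e20 : 0 < e / 2 by rewrite divr_gt0.
have [v fv] := hcomplP f e20; have [w gw] := hcomplP g e20.
exists (v + w); apply: (approx_le _ (approxD fv gw)).
by lra.
Qed.
Definition hadd f g := HCompl (@haddP f g).

Lemma hscaleP k f e : 0 < e -> exists v, approx e (fun x => k * hfun f x) v.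
Proof.
move=> e0; have k0 : 0 < cabs k + 1 by rewrite ltr_wpDl ?cabs_ge0.
have ek : 0 < e / (cabs k + 1) by rewrite divr_gt0.
have [v fv] := hcomplP f ek; exists (k *: v).
apply: (approx_le _ (approxZ k fv)).
rewrite mulrCA ler_piMr ?(ltW e0) // ler_pdivrMr // mul1r.
by rewrite lerDl.
Qed.
Definition hscale k f := HCompl (@hscaleP k f).
Definition hopp f := hscale (-1) f.

Lemma haddA : associative hadd.
Proof. by move=> f g h; apply: hcompl_eq => x /=; rewrite addrA. Qed.
Lemma haddC : commutative hadd.
Proof. by move=> f g; apply: hcompl_eq => x /=; rewrite addrC. Qed.
Lemma hadd0 : left_id (emb 0) hadd.
Proof. by move=> f; apply: hcompl_eq => x /=; rewrite form0l add0r. Qed.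
Lemma haddN : left_inverse (emb 0) hopp hadd.
Proof. by move=> f; apply: hcompl_eq => x /=; rewrite form0l mulN1r addNr. Qed.
HB.instance Definition _ := GRing.isZmodule.Build hcompl haddA haddC hadd0 haddN.

Lemma hscaleA a b f : hscale a (hscale b f) = hscale (a * b) f.
Proof. by apply: hcompl_eq => x /=; rewrite mulrA. Qed.
Lemma hscale1 : left_id 1 hscale.
Proof. by move=> f; apply: hcompl_eq => x /=; rewrite mul1r. Qed.
Lemma hscaleDr : right_distributive hscale +%R.
Proof. by move=> k f g; apply: hcompl_eq => x /=; rewrite mulrDr. Qed.
Lemma hscaleDl f : {morph hscale^~ f : a b / a + b}.
Proof. by move=> a b; apply: hcompl_eq => x /=; rewrite mulrDl. Qed.
HB.instance Definition _ := GRing.Zmodule_isLmodule.Build R[i] hcompl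
  hscaleA hscale1 hscaleDr hscaleDl.

Lemma hfunD f g x : hfun (f + g) x = hfun f x + hfun g x. Proof. by []. Qed.
Lemma hfunZ k f x : hfun (k *: f) x = k * hfun f x. Proof. by []. Qed.
Lemma hfunB f g x : hfun (f - g) x = hfun f x - hfun g x.
Proof. by rewrite -scaleN1r hfunD hfunZ mulN1r. Qed.

Lemma embD v w : emb (v + w) = emb v + emb w.
Proof. by apply: hcompl_eq => x; rewrite hfunD /= formDl. Qed.
Lemma embZ k v : emb (k *: v) = k *: emb v.
Proof. by apply: hcompl_eq => x; rewrite hfunZ /= formZl. Qed.

Lemma hfun_addr f v w : hfun f (v + w) = hfun f v + hfun f w.
Proof.
apply/eqP; rewrite -subr_eq0; apply/eqP.
apply: (@cabs_near0 _ _ (snorm B (v + w) + snorm B v + snorm B w)) => e e0.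
have [u fu] := hcomplP f e0.
have -> : hfun f (v + w) - (hfun f v + hfun f w) = (hfun f (v + w) - B u (v + w)) -
   (hfun f v - B u v) - (hfun f w - B u w) by rewrite formDr; ring.
apply: le_trans (cabsD _ _) _; rewrite cabsN mulrDr lerD //.
by apply: le_trans (cabsD _ _) _; rewrite cabsN mulrDr lerD.
Qed.

Lemma hfun_scaler f k v : hfun f (k *: v) = Num.conj k * hfun f v.
Proof.
apply/eqP; rewrite -subr_eq0; apply/eqP.
apply: (@cabs_near0 _ _ (2 * cabs k * snorm B v)) => e e0.
have [u fu] := hcomplP f e0.
have -> : hfun f (k *: v) - Num.conj k * hfun f v = (hfun f (k *: v) - B u (k *: v)) -
   Num.conj k * (hfun f v - B u v) by rewrite formZr; ring.
apply: le_trans (cabsD _ _) _; rewrite cabsN cabsM cabsJ.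
have h1 := fu (k *: v); rewrite snormZ in h1.
have h2 := ler_wpM2l (cabs_ge0 k) (fu v).
by lra.
Qed.

Lemma hfun_subr f v w : hfun f (v - w) = hfun f v - hfun f w.
Proof. by rewrite hfun_addr -scaleN1r hfun_scaler rmorphN rmorph1 mulN1r. Qed.

Definition fbound r (f : V -> R[i]) := forall w, cabs (f w) <= r * snorm B w.

Lemma approx_fbound e (f : V -> R[i]) v : approx e f v -> fbound (snorm B v + e) f.
Proof.
move=> fv w; rewrite -[f w](subrK (B v w)); apply: le_trans (cabsD _ _) _.
by rewrite mulrDl addrC lerD // cauchy_schwarz.
Qed.

Lemma hfun_bounded f : exists2 r, 0 < r & fbound r (hfun f).
Proof.
have [v fv] := hcomplP f ltr01; exists (snorm B v + 1); last exact: approx_fbound.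
by rewrite ltr_wpDl ?snorm_ge0.
Qed.

Lemma approx_dist d e (f : V -> R[i]) v w : 0 <= d -> 0 <= e -> approx d f v -> approx e f w ->
  snorm B (v - w) <= d + e.
Proof.
move=> d0 e0 fv fw; set s := snorm B (v - w).
have s0 : 0 <= s by exact: snorm_ge0.
have h : s ^+ 2 <= (d + e) * s.
  rewrite snorm_sq; apply: le_trans (ler_norm _) (le_trans (Re_le_cabs _) _).
  rewrite formBl; have -> : B v (v - w) - B w (v - w) =
     - (f (v - w) - B v (v - w)) + (f (v - w) - B w (v - w)) by ring.
  by apply: le_trans (cabsD _ _) _; rewrite cabsN mulrDl lerD.
move: s0; rewrite le_eqVlt => /orP[/eqP s0|s0]; last by rewrite -(ler_pM2r s0) -expr2.
by rewrite -s0 addr_ge0.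
Qed.

Lemma approx_snorm r e (f : V -> R[i]) v : 0 <= r -> 0 <= e -> fbound r f ->
  approx e f v -> snorm B v <= r + e.
Proof.
move=> r0 e0 fr fv; set s := snorm B v.
have s0 : 0 <= s by exact: snorm_ge0.
have h : s ^+ 2 <= (r + e) * s.
  rewrite snorm_sq; apply: le_trans (ler_norm _) (le_trans (Re_le_cabs _) _).
  have -> : B v v = f v - (f v - B v v) by ring.
  by apply: le_trans (cabsD _ _) _; rewrite cabsN mulrDl lerD.
move: s0; rewrite le_eqVlt => /orP[/eqP s0|s0]; last by rewrite -(ler_pM2r s0) -expr2.
by rewrite -s0 addr_ge0.
Qed.

Lemma inv_nat_small r e : 0 <= r -> 0 < e -> exists n : nat, r / n.+1%:R <= e.
Proof.
move=> r0 e0; exists (Num.bound (r / e)); set n := Num.bound _.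
have h : r / e < n%:R by rewrite archi_boundP // divr_ge0 // ltW.
rewrite ler_pdivrMr ?ltr0n // mulrC -ler_pdivrMr //; apply: ltW.
by apply: lt_trans h _; rewrite ltr_nat.
Qed.

(** The limit is specified by its error bound, for every bound of [f] and every approximation of
    [g]. Since [e] may be arbitrarily small, the bound determines [l], and identities for [hinner]
    follow by comparing bounds. *)
Definition inner_spec f g (l : R[i]) := forall r e w, 0 <= r -> 0 <= e ->
  fbound r (hfun f) -> approx e (hfun g) w -> cabs (l - hfun f w) <= r * e.

Lemma inner_ex f g : exists l, inner_spec f g l.
Proof.
have inv n : 0 < n.+1%:R^-1 :> R by rewrite invr_gt0 ltr0n.
have /choice[ap apP] : forall n : nat, exists v, approx n.+1%:R^-1 (hfun g) v.
  by move=> n; exact: (hcomplP g (inv n)).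
have [K K0 fK] := hfun_bounded f.
have [|n m|l lP] := @cauchy_rate _ (fun n => hfun f (ap n)) K; first exact: ltW.
  rewrite -hfun_subr -mulrDr; apply: le_trans (fK _) _; rewrite ler_wpM2l ?(ltW K0) //.
  by apply: (approx_dist _ _ (apP n) (apP m)); rewrite ltW.
exists l => r e w r0 e0 fr gw; apply/ler_addgt0Pr => d d0.
have Kr : 0 <= 2 * K + r by lra.
have [n nd] := inv_nat_small Kr d0.
apply: le_trans (cabs_triangle _ (hfun f (ap n)) _) _.
rewrite cabsBC -hfun_subr.
have h1 := lP n; have h2 := fr (ap n - w).
have h3 : r * snorm B (ap n - w) <= r * (n.+1%:R^-1 + e).
  by rewrite ler_wpM2l //; exact: (approx_dist (ltW (inv n)) e0 (apP n) gw).
move: nd h1 h3; move: (n.+1%:R^-1) => q nd /= h1 h3; lra.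
Qed.

(* [hinner f g] is the limit of [hfun f w] when [w] approximates [g]. *)
Definition hinner f g : R[i] := xget 0 [set l | inner_spec f g l].

Lemma hinnerP f g : inner_spec f g (hinner f g).
Proof. by have [l lP] := inner_ex f g; rewrite /hinner; case: xgetP => [_ -> //|/(_ l)]. Qed.

Lemma hinner_emb f w : hinner f (emb w) = hfun f w.
Proof.
have [r r0 fr] := hfun_bounded f.
have w0 : approx 0 (hfun (emb w)) w by move=> x; rewrite subrr cabs0 mul0r.
have := hinnerP (ltW r0) (lexx 0) fr w0; rewrite mulr0 => h.
by apply/eqP; rewrite -subr_eq0; apply/eqP/cabs_eq0/eqP; rewrite eq_le h cabs_ge0.
Qed.

Lemma hinner_approx f g : exists2 C, 0 <= C & forall e v w, 0 < e -> e <= 1 ->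
  approx e (hfun f) v -> approx e (hfun g) w -> cabs (hinner f g - B v w) <= e * C.
Proof.
have [r r0 fr] := hfun_bounded f; have [s s0 gs] := hfun_bounded g.
exists (r + s + 1); first by lra.
move=> e v w e0 e1 fv gw; apply: le_trans (cabs_triangle _ (hfun f w) _) _.
have h1 := hinnerP (ltW r0) (ltW e0) fr gw; have h2 := fv w.
have := approx_snorm (ltW s0) (ltW e0) gs gw; nra.
Qed.

Lemma cabs_near0_le1 (x : R[i]) r : (forall e, 0 < e -> e <= 1 -> cabs x <= e * r) -> x = 0.
Proof.
move=> h; apply: (@cabs_near0 _ _ `|r|) => e e0.
have m0 : 0 < Num.min e 1 by rewrite lt_min e0 ltr01.
have m1 : Num.min e 1 <= 1 by rewrite ge_min lexx orbT.
apply: le_trans (h _ m0 m1) _; apply: le_trans (ler_wpM2l (ltW m0) (ler_norm r)) _.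
by rewrite ler_wpM2r ?normr_ge0 // ge_min lexx.
Qed.

Lemma hinnerDl f g h : hinner (f + g) h = hinner f h + hinner g h.
Proof.
have [r r0 fr] := hfun_bounded f; have [s s0 gs] := hfun_bounded g.
have [t t0 fgt] := hfun_bounded (f + g).
apply/eqP; rewrite -subr_eq0; apply/eqP; apply: (@cabs_near0 _ _ (t + r + s)) => e e0.
have [w hw] := hcomplP h e0.
have -> : hinner (f + g) h - (hinner f h + hinner g h) = (hinner (f + g) h - hfun (f + g) w)
   - (hinner f h - hfun f w) - (hinner g h - hfun g w) by rewrite hfunD; ring.
have h1 := hinnerP (ltW r0) (ltW e0) fr hw; have h2 := hinnerP (ltW s0) (ltW e0) gs hw.
have h3 := hinnerP (ltW t0) (ltW e0) fgt hw.
rewrite mulrC in h1; rewrite mulrC in h2; rewrite mulrC in h3.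
apply: le_trans (cabsD _ _) _; rewrite cabsN mulrDr lerD //.
by apply: le_trans (cabsD _ _) _; rewrite cabsN mulrDr lerD.
Qed.

Lemma hinnerZl k f g : hinner (k *: f) g = k * hinner f g.
Proof.
have [r r0 fr] := hfun_bounded f; have [s s0 gs] := hfun_bounded (k *: f).
apply/eqP; rewrite -subr_eq0; apply/eqP; apply: (@cabs_near0 _ _ (s + cabs k * r)) => e e0.
have [w gw] := hcomplP g e0.
have -> : hinner (k *: f) g - k * hinner f g = (hinner (k *: f) g - hfun (k *: f) w)
   - k * (hinner f g - hfun f w) by rewrite hfunZ; ring.
have h1 := hinnerP (ltW r0) (ltW e0) fr gw; have h2 := hinnerP (ltW s0) (ltW e0) gs gw.
apply: le_trans (cabsD _ _) _; rewrite cabsN cabsM mulrDr lerD //; first by rewrite mulrC.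
by rewrite mulrCA ler_wpM2l ?cabs_ge0 // mulrC.
Qed.

Lemma hinnerC f g : hinner g f = Num.conj (hinner f g).
Proof.
have [C C0 fgC] := hinner_approx f g; have [D D0 gfD] := hinner_approx g f.
apply/eqP; rewrite -subr_eq0; apply/eqP; apply: (@cabs_near0_le1 _ (D + C)) => e e0 e1.
have [v fv] := hcomplP f e0; have [w gw] := hcomplP g e0.
have -> : hinner g f - Num.conj (hinner f g) = (hinner g f - B w v) -
   Num.conj (hinner f g - B v w) by rewrite rmorphB /= (formC B v w); ring.
apply: le_trans (cabsD _ _) _; rewrite cabsN cabsJ mulrDr lerD //; first exact: gfD.
exact: fgC.
Qed.

Lemma hinner_ge0 f : 0 <= hinner f f.
Proof.
have [C C0 fC] := hinner_approx f f; apply: ge0_near => e e0.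
have C1 : 0 < C + 1 by rewrite ltr_wpDl.
pose d := Num.min 1 (e / (C + 1)).
have d0 : 0 < d by rewrite lt_min ltr01 divr_gt0.
have d1 : d <= 1 by rewrite ge_min lexx.
have [v fv] := hcomplP f d0; exists (B v v); first exact: form_ge0.
apply: le_trans (fC _ _ _ d0 d1 fv fv) _.
have : d <= e / (C + 1) by rewrite ge_min lexx orbT.
rewrite ler_pdivlMr // mulrDr mulr1; have := ltW d0; lra.
Qed.

Definition hform := PsdForm hinnerDl hinnerZl hinnerC hinner_ge0.

Lemma snorm_emb v : snorm hform (emb v) = snorm B v.
Proof. by rewrite /snorm /= hinner_emb. Qed.

Lemma hfun_le f w : cabs (hfun f w) <= snorm hform f * snorm B w.
Proof. by rewrite -hinner_emb -snorm_emb; exact: (cauchy_schwarz hform). Qed.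

Lemma hnorm0_eq0 f : snorm hform f = 0 -> f = 0.
Proof.
move=> f0; apply: hcompl_eq => w; rewrite [RHS]form0l; apply: cabs_eq0; apply/eqP.
by rewrite eq_le cabs_ge0 andbT; have := hfun_le f w; rewrite f0 mul0r.
Qed.

(** With [hfun_le] this identifies the Hilbert norm with the norm of the functional. If [w]
    approximates [f] within [q], then [hinner f f] is within [r q] of [hfun f w], which is at most
    [r (r + q)]; hence the denominator [2 r + 1]. *)
Lemma hnorm_le f r : 0 <= r -> fbound r (hfun f) -> snorm hform f <= r.
Proof.
move=> r0 fr; rewrite -(ler_pXn2r (n := 2)) ?nnegrE ?snorm_ge0 //.
apply/ler_addgt0Pr => e e0; have e2 : 0 < e / (2 * r + 1) by rewrite divr_gt0 //; lra.
have [w fw] := hcomplP f e2.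
have h1 := hinnerP r0 (ltW e2) fr fw; have h2 := approx_snorm r0 (ltW e2) fr fw.
have h3 := fr w.
rewrite snorm_sq; apply: le_trans (ler_norm _) (le_trans (Re_le_cabs _) _) => /=.
rewrite -[hinner f f](subrK (hfun f w)); apply: le_trans (cabsD _ _) _.
have e3 : e / (2 * r + 1) * (2 * r + 1) = e by rewrite divfK // gt_eqF //; lra.
move: (e / (2 * r + 1)) e2 h1 h2 e3 => q q0 h1 h2 e3; nra.
Qed.

Lemma emb_dense f e : 0 < e -> exists v, snorm hform (f - emb v) <= e.
Proof.
move=> e0; have [v fv] := hcomplP f e0; exists v; apply: hnorm_le; first exact: ltW.
by move=> w; rewrite hfunB; exact: fv.
Qed.

Definition hnorm f : R[i] := (snorm hform f)%:C.

Lemma hnormD f g : hnorm (f + g) <= hnorm f + hnorm g.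
Proof. by rewrite /hnorm -rmorphD lecR snormD. Qed.
Lemma hnormZ k f : hnorm (k *: f) = `|k| * hnorm f.
Proof. by rewrite /hnorm (snormZ hform) rmorphM. Qed.
Lemma hnorm_eq0 f : hnorm f = 0 -> f = 0.
Proof. by move=> /complexI; exact: hnorm0_eq0. Qed.

HB.instance Definition _ := Lmodule_isNormed.Build R[i] hcompl hnormD hnormZ hnorm_eq0.

Lemma hcompl_normE f : `|f| = (snorm hform f)%:C. Proof. by []. Qed.

Lemma hcompl_ball f g e : ball f (e%:C : R[i]) g <-> snorm hform (f - g) < e.
Proof. by rewrite -ball_normE /ball_ /= hcompl_normE ltcR. Qed.

Lemma hcompl_complete (F : set_system hcompl) : ProperFilter F -> cauchy F -> cvg F.
Proof.
move=> FF /cauchyP Fc.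
have inv n : 0 < n.+1%:R^-1 :> R by rewrite invr_gt0 ltr0n.
have /choice[x xP] : forall n : nat, exists x, F (ball x (n.+1%:R^-1%:C : R[i])).
  by move=> n; apply: Fc; rewrite ltcR.
have xD n m : snorm hform (x n - x m) <= n.+1%:R^-1 + m.+1%:R^-1.
  have [y [/hcompl_ball ny /hcompl_ball my]] := filter_ex (filterI (xP n) (xP m)).
  by apply: le_trans (snorm_triangle _ _ y _) _; rewrite (snormBC _ y) lerD // ltW.
(* The limit is taken pointwise in [w]. The rate is proportional to [snorm B w], so [l] is again a
   norm limit of functionals [B v]. *)
have /choice[l lP] : forall w, exists l, forall n, cabs (hfun (x n) w - l) <=
    2 * snorm B w / n.+1%:R.
  move=> w; apply: cauchy_rate; first exact: snorm_ge0.
  move=> n m; rewrite -hfunB; apply: le_trans (hfun_le _ _) _.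
  by rewrite -mulrDr mulrC ler_wpM2l ?snorm_ge0.
have lH e : 0 < e -> exists v, approx e l v.
  move=> e0; have e2 : 0 < e / 2 by rewrite divr_gt0.
  have [n ne] := inv_nat_small (ler0n R 2) e2.
  have [v xv] := hcomplP (x n) e2; exists v => w.
  apply: le_trans (cabs_triangle _ (hfun (x n) w) _) _.
  rewrite cabsBC; have h1 := lP w n; have h2 := xv w.
  rewrite mulrAC in h1; have h3 := le_trans h1 (ler_wpM2r (snorm_ge0 B w) ne).
  by move: h2 h3; clear; lra.
pose f := HCompl lH.
have fx n : snorm hform (x n - f) <= 2 / n.+1%:R.
  apply: hnorm_le; first by rewrite divr_ge0.
  by move=> w; rewrite hfunB mulrAC; exact: lP.
apply/cvg_ex; exists f; apply/cvg_ballP => e e0.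
have eE := ge0_ReE (ltW e0); have := e0; rewrite {1}eE ltcR.
move: (complex.Re e) eE => r -> r0.
have r2 : 0 < r / 4 by rewrite divr_gt0.
have [n nr] := inv_nat_small (ler0n R 2) r2.
have nr' : n.+1%:R^-1 <= r / 4.
  by apply: le_trans nr; rewrite ler_peMl ?invr_ge0 // ler1n.
apply: filterS (xP n) => y /hcompl_ball ny; apply/hcompl_ball.
apply: le_lt_trans (snorm_triangle _ _ (x n) _) _.
rewrite (snormBC _ f); have h := le_trans (fx n) nr; have h' := lt_le_trans ny nr'.
by move: h h'; clear -r0; lra.
Qed.

HB.instance Definition _ := Uniform_isComplete.Build hcompl hcompl_complete.

Lemma hcompl_inner_norm f : hinner f f = `|f| ^+ 2.
Proof. by rewrite hcompl_normE -rmorphXn /= (snorm_sqC hform). Qed.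

HB.instance Definition _ := isHilbert.Build R hcompl hinnerDl hinnerZl hinnerC hcompl_inner_norm.

End Completion.

Theorem hilbert_completion (R : realType) (V : lmodType R[i]) (B : psd_form V) :
  exists (K : hilbertType R) (j : V -> K),
    [/\ forall v w, j (v + w) = j v + j w, forall k v, j (k *: v) = k *: j v,
        forall v w, inner (j v) (j w) = B v w
      & forall (x : K) (e : R), 0 < e -> exists v, `|x - j v| <= e%:C].
Proof.
exists (hcompl B : hilbertType R), (@emb R V B); split.
- exact: embD.
- exact: embZ.
- by move=> v w; exact: hinner_emb.
- by move=> f e /(emb_dense f)[v fv]; exists v; rewrite hcompl_normE lecR.
Qed.

(** * Geometry of Hilbert spaces *)

Lemma complete_seq (K : numFieldType) (A : completeNormedModType K) (a : nat -> A) :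
  (forall e : K, 0 < e -> exists N : nat, forall n m, (N <= n)%N -> (N <= m)%N -> `|a n - a m| < e) ->
  exists l, forall e : K, 0 < e -> exists N : nat, forall n, (N <= n)%N -> `|a n - l| < e.
Proof.
move=> aC; have : cauchy (a @ \oo).
  apply/cauchy_exP => e e0; have [N aN] := aC e e0; exists (a N).
  by exists N => // n /= Nn; rewrite -ball_normE /ball_ /=; exact: aN.
move=> /cauchy_cvg/cvg_ex[l al]; exists l => e e0.
have /cvgrPdist_lt/(_ e e0)[N _ aN] := al.
by exists N => n Nn; rewrite distrC; exact: aN.
Qed.

Section NormedComplex.
Variables (R : realType) (A : normedModType R[i]).
Implicit Types (x y : A).

Definition rnorm x : R := complex.Re `|x|.

Lemma rnormE x : `|x| = (rnorm x)%:C. Proof. exact: ge0_ReE (normr_ge0 x). Qed.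
Lemma rnorm_ge0 x : 0 <= rnorm x. Proof. by rewrite -lecR -rnormE normr_ge0. Qed.
Lemma rnorm0 : rnorm (0 : A) = 0. Proof. by apply: complexI; rewrite -rnormE normr0. Qed.
Lemma rnorm_eq0 x : rnorm x = 0 -> x = 0.
Proof. by move=> x0; apply/eqP; rewrite -normr_eq0 rnormE x0. Qed.
Lemma rnormD x y : rnorm (x + y) <= rnorm x + rnorm y.
Proof. by rewrite -lecR rmorphD /= -!rnormE ler_normD. Qed.
Lemma rnormN x : rnorm (- x) = rnorm x.
Proof. by rewrite /rnorm normrN. Qed.
Lemma rnormBC x y : rnorm (x - y) = rnorm (y - x).
Proof. by rewrite -rnormN opprB. Qed.
Lemma rnormZ (k : R[i]) x : rnorm (k *: x) = cabs k * rnorm x.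
Proof. by apply: complexI; rewrite -rnormE normrZ rmorphM /= -rnormE. Qed.
Lemma rnorm_triangle x y z : rnorm (x - z) <= rnorm (x - y) + rnorm (y - z).
Proof. by rewrite -[x - z](subrKA y) rnormD. Qed.
Lemma rnorm_near0 x (c : R) : (forall e : R, 0 < e -> rnorm x <= e * c) -> x = 0.
Proof.
move=> h; apply: rnorm_eq0; have : (rnorm x)%:C = 0 :> R[i].
  apply: (@cabs_near0 _ _ c) => e e0; rewrite cabs_real ger0_norm ?rnorm_ge0 //.
  exact: h.
by move/complexI.
Qed.

Lemma closureP (S : set A) x :
  closure S x <-> forall e : R, 0 < e -> exists2 y, S y & rnorm (x - y) < e.
Proof.
split=> [cx e e0|h].
  have [|y [Sy]] := cx (ball x (e%:C)); first by apply: nbhsx_ballx; rewrite ltcR.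
  by rewrite -ball_normE /ball_ /= rnormE ltcR => xy; exists y.
move=> B /nbhs_ballP[e /= e0 eB].
have eE := ge0_ReE (ltW e0); have re : 0 < complex.Re e by rewrite -ltcR -eE.
have [y Sy xy] := h _ re; exists y; split=> //; apply: eB.
by rewrite -ball_normE /ball_ /= rnormE eE ltcR.
Qed.

Lemma closed_rnorm (S : set A) x : closed S ->
  (forall e : R, 0 < e -> exists2 y, S y & rnorm (x - y) < e) -> S x.
Proof. by move=> cS h; apply: cS; apply/closureP. Qed.

End NormedComplex.

Lemma complete_rate (R : realType) (A : completeNormedModType R[i]) (a : nat -> A) (C : R) :
  0 <= C ->
  (forall n m, rnorm (a n - a m) <= C / n.+1%:R + C / m.+1%:R) ->
  exists l, forall n, rnorm (a n - l) <= C / n.+1%:R.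
Proof.
move=> C0 aC.
have mono n m : (n <= m)%N -> C / m.+1%:R <= C / n.+1%:R.
  by move=> nm; rewrite ler_wpM2l // lef_pV2 ?posrE ?ltr0n // ler_nat.
have [e e0|l al] := @complete_seq _ A a.
  have eE := ge0_ReE (ltW e0); have re : 0 < complex.Re e by rewrite -ltcR -eE.
  have re3 : 0 < complex.Re e / 3 by rewrite divr_gt0.
  have [N Ne] := inv_nat_small C0 re3.
  exists N => n m Nn Nm; rewrite rnormE eE ltcR; apply: le_lt_trans (aC n m) _.
  by have h1 := le_trans (mono _ _ Nn) Ne; have h2 := le_trans (mono _ _ Nm) Ne; move: h1 h2 re; clear; move: (C / _) (C / _) => u v; lra.
exists l => n; apply/ler_addgt0Pr => e e0.
have e2 : 0 < e / 2 by rewrite divr_gt0.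
have [N1 N1e] := inv_nat_small C0 e2.
have [|N2 N2e] := al ((e / 2)%:C); first by rewrite ltcR.
pose m := maxn N1 N2.
have h1 := le_trans (mono _ _ (leq_maxl N1 N2)) N1e.
have := N2e m (leq_maxr _ _); rewrite rnormE ltcR => h2.
apply: le_trans (rnorm_triangle _ (a m) _) _.
have h3 := aC n m; move: h1 h2 h3; rewrite -/m; move: (C / _) (C / _) => u v; lra.
Qed.

Section HilbertGeometry.
Variables (R : realType) (K : hilbertType R).
Implicit Types (x y z u : K) (k : R[i]).

Lemma inner_ge0 x : 0 <= inner x x.
Proof. by rewrite inner_norm exprn_ge0. Qed.

Definition inner_form := PsdForm (@innerDl R K) (@innerZl R K) (@innerC R K) inner_ge0.

Lemma snorm_rnorm x : snorm inner_form x = rnorm x.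
Proof.
apply/eqP; rewrite -(@eqrXn2 _ 2) ?snorm_ge0 ?rnorm_ge0 //; apply/eqP; apply: complexI.
by rewrite snorm_sqC /= inner_norm rnormE rmorphXn.
Qed.

Lemma inner_rnorm x : inner x x = (rnorm x ^+ 2)%:C.
Proof. by rewrite inner_norm rnormE rmorphXn. Qed.

Lemma innerDr x y z : inner x (y + z) = inner x y + inner x z.
Proof. exact: (formDr inner_form). Qed.
Lemma innerZr k x y : inner x (k *: y) = Num.conj k * inner x y.
Proof. exact: (formZr inner_form). Qed.
Lemma innerBl x y z : inner (x - y) z = inner x z - inner y z.
Proof. exact: (formBl inner_form). Qed.
Lemma innerBr x y z : inner x (y - z) = inner x y - inner x z.
Proof. exact: (formBr inner_form). Qed.
Lemma inner0l x : inner 0 x = 0.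
Proof. exact: (form0l inner_form). Qed.
Lemma inner0r x : inner x 0 = 0.
Proof. by rewrite innerC inner0l rmorph0. Qed.
Lemma inner_le x y : cabs (inner x y) <= rnorm x * rnorm y.
Proof. by rewrite -!snorm_rnorm; exact: (cauchy_schwarz inner_form). Qed.
Lemma inner_eq0 x : inner x x = 0 -> x = 0.
Proof. by rewrite inner_norm => /eqP; rewrite expf_eq0 normr_eq0 => /eqP. Qed.

Lemma rnorm_sq_sub x y (r : R) : rnorm (x - (r%:C * inner x y) *: y) ^+ 2 =
  rnorm x ^+ 2 - 2 * r * cabs (inner x y) ^+ 2 + r ^+ 2 * cabs (inner x y) ^+ 2 * rnorm y ^+ 2.
Proof.
apply: complexI; rewrite -inner_rnorm.
rewrite innerBl !innerBr !innerZl !innerZr rmorphM /= conj_real (innerC x y).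
have -> : inner x x - r%:C * Num.conj (inner x y) * inner x y -
     (r%:C * inner x y * Num.conj (inner x y)
       - r%:C * inner x y * (r%:C * Num.conj (inner x y) * inner y y)) =
   inner x x - 2 * r%:C * (inner x y * Num.conj (inner x y))
   + r%:C ^+ 2 * (inner x y * Num.conj (inner x y)) * inner y y by ring.
by rewrite mulJ !inner_rnorm; ring.
Qed.

Lemma parallelogram x y :
  rnorm (x + y) ^+ 2 + rnorm (x - y) ^+ 2 = 2 * rnorm x ^+ 2 + 2 * rnorm y ^+ 2.
Proof.
have d2 (a b : R) : 2 * a + 2 * b = (a + b) + (a + b) by ring.
apply: complexI; rewrite d2 !rmorphD /= -!inner_rnorm.
by rewrite innerBl !innerBr innerDl !innerDr; ring.
Qed.

Lemma dense_orth (S : set K) x :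
  (forall (y : K) (e : R), 0 < e -> exists2 v, S v & rnorm (y - v) <= e) ->
  (forall v, S v -> inner x v = 0) -> x = 0.
Proof.
move=> dS xS; apply: inner_eq0; apply: (@cabs_near0 _ _ (rnorm x)) => e e0.
have [v Sv xv] := dS x e e0.
rewrite -[inner x x]subr0 -(xS _ Sv) -innerBr mulrC.
by apply: le_trans (inner_le _ _) _; rewrite ler_wpM2l ?rnorm_ge0.
Qed.

Lemma orth_projection (L : set K) x : is_subspace L -> closed L ->
  exists2 y, L y & forall v, L v -> inner (x - y) v = 0.
Proof.
case=> L0 LD LZ Lc.
pose S := [set rnorm (x - v) ^+ 2 | v in L].
have S0 : S !=set0 by exists (rnorm (x - 0) ^+ 2); exists 0.
have Slb : has_lbound S by exists 0 => _ [v _ <-]; exact: sqr_ge0.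
pose d := inf S.
have dle v : L v -> d <= rnorm (x - v) ^+ 2 by move=> Lv; apply: ge_inf => //; exists v.
(* With squared excess, the parallelogram law at the midpoint of [v n] and [v m] gives the linear
   Cauchy rate that [complete_rate] expects. *)
have /choice[v vP] : forall n : nat, exists v, L v /\ rnorm (x - v) ^+ 2 <= d + n.+1%:R^-1 ^+ 2.
  move=> n; have e0 : 0 < n.+1%:R^-1 ^+ 2 :> R by rewrite exprn_gt0 // invr_gt0 ltr0n.
  have [_ [v Lv <-] h] := inf_adherent e0 (conj S0 Slb).
  by exists v; split=> //; exact: ltW.
have vD n m : rnorm (v n - v m) <= 2 / n.+1%:R + 2 / m.+1%:R.
  have [Ln nd] := vP n; have [Lm md] := vP m.
  have := parallelogram (x - v n) (x - v m).
  have -> : x - v n - (x - v m) = - (v n - v m) by rewrite !opprB addrC addrA subrK.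
  have -> : x - v n + (x - v m) = 2%:C *: (x - 2^-1%:C *: (v n + v m)).
    by linear_eq (R[i] : fieldType) K.
  rewrite rnormN rnormZ cabs_real normr_nat exprMn.
  have := dle (2^-1%:C *: (v n + v m)) (LZ _ _ (LD _ _ Ln Lm)).
  have : 0 <= n.+1%:R^-1 :> R by rewrite invr_ge0.
  have : 0 <= m.+1%:R^-1 :> R by rewrite invr_ge0.
  move: nd md (rnorm_ge0 (v n - v m)); move: n.+1%:R^-1 m.+1%:R^-1 => p q.
  move: (rnorm (v n - v m)) (rnorm (x - v n) ^+ 2) (rnorm (x - v m) ^+ 2).
  move: (rnorm (x - _) ^+ 2) => s1 s2 s3 s4; clear => *.
  rewrite -(ler_pXn2r (n := 2)) ?nnegrE //; first by nra.
  by rewrite addr_ge0 ?mulr_ge0.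
have [y yP] := complete_rate (ler0n R 2) vD.
have Ly : L y.
  apply: (closed_rnorm Lc) => e e0; have e2 : 0 < e / 2 by rewrite divr_gt0.
  have [n ne] := inv_nat_small (ler0n R 2) e2; exists (v n); first by case: (vP n).
  by rewrite rnormBC; apply: le_lt_trans (le_trans (yP n) ne) _; lra.
have yd : rnorm (x - y) ^+ 2 <= d.
  apply/ler_addgt0Pr => e e0; pose N := rnorm (x - y).
  have N0 : 0 <= N by exact: rnorm_ge0.
  have e2 : 0 < Num.min 1 (e / (4 * N + 8)).
    by rewrite lt_min ltr01 divr_gt0 //; lra.
  have [n ne] := inv_nat_small (ler0n R 2) e2.
  have [_ nd] := vP n; have h := le_trans (yP n) ne.
  have N8 : 0 < 4 * N + 8 by lra.
  move: h; rewrite le_min ler_pdivlMr // => /andP[h1 h2].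
  move: ne; rewrite le_min ler_pdivlMr // => /andP[h3 h4].
  have h5 : N <= rnorm (x - v n) + rnorm (v n - y) by exact: rnorm_triangle.
  have q0 : 0 <= n.+1%:R^-1 :> R by rewrite invr_ge0.
  rewrite -/N; move: (rnorm_ge0 (x - v n)) (rnorm_ge0 (v n - y)) nd h1 h2 h3 h4 h5 q0.
  move: n.+1%:R^-1 (rnorm (x - v n)) (rnorm (v n - y)) => q s t s0 t0 nd h1 h2 h3 h4 h5 q0.
  have [Ns|Ns] := leP N t; first by nra.
  have : (N - t) ^+ 2 <= s ^+ 2 by rewrite lerXn2r ?nnegrE; lra.
  nra.
exists y => // w Lw; apply: cabs_eq0; apply/eqP; rewrite -sqrf_eq0.
set m := cabs _ ^+ 2; have m0 : 0 <= m by exact: sqr_ge0.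
apply/eqP; apply/eqP; rewrite eq_le m0 andbT.
pose c := rnorm w ^+ 2; have c0 : 0 <= c by exact: sqr_ge0.
have c1 : 0 < c + 1 by lra.
(* Moving [y] along [w] cannot bring it closer to [x]. The step [1 / (c + 1)] instead of the optimal
   [1 / c] covers [w = 0]. *)
have := dle (y + ((c + 1)^-1%:C * inner (x - y) w) *: w) (LD _ _ Ly (LZ _ _ Lw)).
rewrite opprD addrA rnorm_sq_sub -/m -/c => h.
have h2 := le_trans yd h; rewrite leNgt; apply/negP => mp.
have : (c + 1)^-1 * (c + 1) = 1 by rewrite mulVf // gt_eqF.
have : 0 < (c + 1)^-1 by rewrite invr_gt0.
move: h2; move: ((c + 1)^-1) (rnorm (x - y) ^+ 2) => p s h2 p0 pc.
have : 2 * p * m <= p ^+ 2 * m * c by lra.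
have -> : p ^+ 2 * m * c = p * m * (p * (c + 1) - p) by ring.
by rewrite pc; have := mulr_gt0 p0 mp; nra.
Qed.

Lemma extend_operator (V : lmodType R[i]) (j : V -> K) (T : V -> V) (c : R) :
  0 <= c ->
  (forall v w, j (v + w) = j v + j w) -> (forall k v, j (k *: v) = k *: j v) ->
  (forall x (e : R), 0 < e -> exists v, rnorm (x - j v) <= e) ->
  (forall v w, T (v + w) = T v + T w) -> (forall k v, T (k *: v) = k *: T v) ->
  (forall v, rnorm (j (T v)) <= c * rnorm (j v)) ->
  exists S : {linear K -> K}, (forall v, S (j v) = j (T v)) /\
    (forall x, rnorm (S x) <= c * rnorm x).
Proof.
move=> c0 jD jZ jd TD TZ Tb.
have jB v w : j (v - w) = j v - j w by rewrite jD -scaleN1r jZ scaleN1r.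
have TB v w : T (v - w) = T v - T w by rewrite TD -scaleN1r TZ scaleN1r.
(* The property quantifies over all approximations [v] of [x], so it fixes [S x] independently of
   the sequence that constructs it; linearity then follows from [Suniq]. *)
have /choice[S SP] : forall x, exists y, forall v (e : R),
    rnorm (x - j v) <= e -> rnorm (y - j (T v)) <= c * e.
  move=> x; have inv n : 0 < n.+1%:R^-1 :> R by rewrite invr_gt0 ltr0n.
  have /choice[v vP] : forall n : nat, exists v, rnorm (x - j v) <= n.+1%:R^-1.
    by move=> n; exact: jd.
  have [n m|y yP] := @complete_rate R K (fun n => j (T (v n))) c c0.
    rewrite -jB -TB; apply: le_trans (Tb _) _; rewrite -mulrDr ler_wpM2l // jB.
    by apply: le_trans (rnorm_triangle _ x _) _; rewrite rnormBC lerD.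
  exists y => w e xe; apply/ler_addgt0Pr => d d0.
  have c20 : 0 <= 2 * c by lra.
  have [n nd] := inv_nat_small c20 d0.
  apply: le_trans (rnorm_triangle _ (j (T (v n))) _) _.
  have h1 := yP n; rewrite rnormBC -jB -TB.
  have h2 := Tb (v n - w); rewrite jB in h2.
  have h3 : rnorm (j (v n) - j w) <= n.+1%:R^-1 + e.
    by apply: le_trans (rnorm_triangle _ x _) _; rewrite rnormBC lerD.
  have h4 := ler_wpM2l c0 h3.
  move: nd h1 h2 h4; move: n.+1%:R^-1 => q /=; move=> nd h1 h2 h4; lra.
have near x y : (forall e : R, 0 < e -> rnorm (x - y) <= e * (1 + c)) -> x = y.
  by move=> h; apply/eqP; rewrite -subr_eq0; apply/eqP; exact: rnorm_near0 h.
have Sj v : S (j v) = j (T v).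
  apply/eqP; rewrite -subr_eq0; apply/eqP/rnorm_eq0/eqP; rewrite eq_le rnorm_ge0 andbT.
  by have := SP (j v) v 0; rewrite subrr rnorm0 mulr0; apply.
have Suniq x y : (forall e : R, 0 < e -> exists v d, rnorm (x - j v) <= d /\
    rnorm (y - j (T v)) <= e /\ d <= e) -> y = S x.
  move=> h; apply: near => e e0; have [v [d [xd [ye de]]]] := h e e0.
  apply: le_trans (rnorm_triangle _ (j (T v)) _) _.
  have := SP x v d xd; rewrite (rnormBC (S x)); have := ler_wpM2l c0 de; lra.
have SD x y : S (x + y) = S x + S y.
  apply/esym/Suniq => e e0; pose q := e / (2 * (c + 1)).
  have c1 : 0 < 2 * (c + 1) by lra.
  have q0 : 0 < q by rewrite divr_gt0.
  have [v xv] := jd x q q0; have [w yw] := jd y q q0.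
  have qe : q * (2 * (c + 1)) = e by rewrite /q divfK // gt_eqF.
  exists (v + w), (q + q); split; last split.
  - by rewrite jD opprD addrACA; apply: le_trans (rnormD _ _) (lerD _ _).
  - rewrite TD jD opprD addrACA; apply: le_trans (rnormD _ _) _.
    have := SP x v q xv; have := SP y w q yw; nra.
  - nra.
have SZ k x : S (k *: x) = k *: S x.
  apply/esym/Suniq => e e0; pose q := e / ((cabs k + 1) * (c + 1)).
  have k0 := cabs_ge0 k.
  have c1 : 0 < (cabs k + 1) * (c + 1) by rewrite mulr_gt0 //; lra.
  have q0 : 0 < q by rewrite divr_gt0.
  have [v xv] := jd x q q0.
  have qe : q * ((cabs k + 1) * (c + 1)) = e by rewrite /q divfK // gt_eqF.
  have kq : 0 <= cabs k * q by rewrite mulr_ge0 // ltW.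
  have cq : 0 <= c * q by rewrite mulr_ge0 // ltW.
  exists (k *: v), (cabs k * q); split; last split.
  - by rewrite jZ -scalerBr rnormZ ler_wpM2l.
  - rewrite TZ jZ -scalerBr rnormZ; apply: le_trans (ler_wpM2l k0 (SP x v q xv)) _.
    nra.
  - nra.
have Sl : linear S by move=> k x y; rewrite SD SZ.
pose SL : {linear K -> K} := HB.pack S (GRing.isLinear.Build _ _ _ _ S Sl).
exists SL; split=> [v|x]; first exact: Sj.
apply/ler_addgt0Pr => e e0.
have c1 : 0 < 2 * c + 1 by lra.
have q0 : 0 < e / (2 * c + 1) by rewrite divr_gt0.
have [v xv] := jd x _ q0.
have h1 := SP x v _ xv; have h2 := Tb v.
have h3 : rnorm (SL x) <= rnorm (S x - j (T v)) + rnorm (j (T v)).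
  by rewrite -[SL x](subrK (j (T v))) rnormD.
have h4 : rnorm (j v) <= rnorm x + rnorm (x - j v).
  by rewrite -{1}[j v](subKr x) opprB addrC; apply: le_trans (rnormD _ _) _; rewrite rnormBC addrC.
have := ler_wpM2l c0 h4; have := ler_wpM2l c0 xv.
have : e / (2 * c + 1) * (2 * c + 1) = e by rewrite divfK // gt_eqF.
move: h1 h2 h3 q0; move: (e / _) => q; lra.
Qed.

End HilbertGeometry.

(** * The GNS construction for a pure state *)

Section GNS.
Variables (R : realType) (U : algType R[i]) (st : U -> U) (nr : U -> R).
Hypothesis H : unital_cstar st nr.
Variable M : U -> Prop.
Hypothesis HM : closed_ideal nr M.

Theorem gns_pure (x : U) : (forall j, M j -> 1 <= nr (x - j)) ->
  exists (K : hilbertType R) (pi : U -> {linear K -> K}),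
  [/\ [/\ forall a b v, pi (a + b) v = pi a v + pi b v,
          forall k a v, pi (k *: a) v = k *: pi a v,
          forall a b v, pi (a * b) v = pi a (pi b v),
          forall a v w, inner (pi (st a) v) w = inner v (pi a w)
        & forall v, pi 1 v = v],
      (exists v : K, v <> 0) /\ (forall a v, rnorm (pi a v) <= nr a * rnorm v),
      forall m v, M m -> pi m v = 0,
      (forall y, M (x * y - y * x)) ->
        exists2 l, 1 <= cabs l & forall v, pi x v = l *: v
    & forall L : set K, is_subspace L -> closed L ->
        (forall a v, L v -> L (pi a v)) -> L = [set 0] \/ L = setT].
Proof.
move=> xM; have [Fn [[FD FZ Fs] [F1 FM Fp] Fx Fc Fpure]] := pure_state H HM xM.
have st1 := st1 H; have stK := stK H; have stM := stM H; have stD := stD H.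
pose B0 (y z : U) := Fn (st z * y).
have B0D a b c : B0 (a + b) c = B0 a c + B0 b c by rewrite /B0 mulrDr FD.
have B0Z k a b : B0 (k *: a) b = k * B0 a b by rewrite /B0 -scalerAr FZ.
have B0C a b : B0 b a = Num.conj (B0 a b) by rewrite /B0 -Fs stM stK.
have B0p a : 0 <= B0 a a by apply: Fp; exact: (pos_stM H).
pose B := PsdForm B0D B0Z B0C B0p.
have [K [j [jD jZ jB jd0]]] := hilbert_completion B.
have jd (y : K) (e : R) : 0 < e -> exists v, rnorm (y - j v) <= e.
  by move=> e0; have [v] := jd0 y e e0; rewrite rnormE lecR => h; exists v.
have jr y : (rnorm (j y) ^+ 2)%:C = Fn (st y * y) by rewrite -inner_rnorm jB.
(* This is [F] applied to [st y (|a|^2 - st a a) y], positive by [pos_conj]. *)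
have jbound a y : rnorm (j (a * y)) <= nr a * rnorm (j y).
  rewrite -(ler_pXn2r (n := 2)) ?nnegrE ?rnorm_ge0 ?mulr_ge0 ?rnorm_ge0 ?(nr_ge0 H) //.
  rewrite -lecR exprMn [leRHS]rmorphM /= !jr stM.
  have : 0 <= Fn (st y * ((nr a ^+ 2)%:C *: 1 - st a * a) * y).
    apply/Fp/(pos_conj H)/(pos_sub_nr H); first exact: (sa_stM H).
    by rewrite (nr_stM H).
  rewrite mulrBr mulrBl -scalerAr mulr1 -scalerAl -scaleN1r FD !FZ mulN1r subr_ge0.
  by rewrite !mulrA.
have /choice[pi piP] : forall a, exists S : {linear K -> K},
    (forall v, S (j v) = j (a * v)) /\ (forall v, rnorm (S v) <= nr a * rnorm v).
  move=> a; apply: (@extend_operator _ _ _ j (fun v => a * v)) => //.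
  - exact: (nr_ge0 H).
  - by move=> v w; rewrite mulrDr.
  - by move=> k v; rewrite -scalerAr.
have pij a v : pi a (j v) = j (a * v) by case: (piP a).
have pib a v : rnorm (pi a v) <= nr a * rnorm v by case: (piP a).
have jdense (y : K) (e : R) : 0 < e -> exists2 v, range j v & rnorm (y - v) <= e.
  by move=> /(jd y)[v yv]; exists (j v).
have adjj a v z : inner (pi a v) (j z) = inner v (j (st a * z)).
  apply/eqP; rewrite -subr_eq0; apply/eqP.
  apply: (@cabs_near0 _ _ (nr a * rnorm (j z) + rnorm (j (st a * z)))) => e e0.
  have [y vy] := jd v e e0.
  have -> : inner (pi a v) (j z) - inner v (j (st a * z)) =
      inner (pi a (v - j y)) (j z) - inner (v - j y) (j (st a * z)).
    by rewrite linearB /= !innerBl pij !jB /= /B0 stM stK mulrA; ring.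
  have h1 := inner_le (pi a (v - j y)) (j z).
  have h2 := inner_le (v - j y) (j (st a * z)).
  have h3 := pib a (v - j y).
  apply: le_trans (cabsD _ _) _; rewrite cabsN.
  have z0 := rnorm_ge0 (j z); have w0 := rnorm_ge0 (j (st a * z)).
  have h4 := ler_wpM2l (nr_ge0 H a) vy.
  have h5 := ler_wpM2r z0 (le_trans h3 h4).
  have h6 := ler_wpM2r w0 vy.
  lra.
have jeq u w : (forall z, inner u (j z) = inner w (j z)) -> u = w.
  move=> h; apply/eqP; rewrite -subr_eq0; apply/eqP; apply: (dense_orth jdense).
  by move=> _ [z _ <-]; rewrite innerBl h subrr.
have stZ := stZ H.
have piD a b v : pi (a + b) v = pi a v + pi b v.
  by apply: jeq => z; rewrite innerDl !adjj stD mulrDl jD innerDr.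
have piZ k a v : pi (k *: a) v = k *: pi a v.
  by apply: jeq => z; rewrite innerZl !adjj stZ -scalerAl jZ innerZr conjCK.
have piM a b v : pi (a * b) v = pi a (pi b v).
  by apply: jeq => z; rewrite !adjj stM mulrA.
have pi1 v : pi 1 v = v by apply: jeq => z; rewrite adjj st1 mul1r.
have adj a v w : inner (pi (st a) v) w = inner v (pi a w).
  apply/eqP; rewrite -subr_eq0; apply/eqP.
  apply: (@cabs_near0 _ _ (nr (st a) * rnorm v + nr a * rnorm v)) => e e0.
  have [y wy] := jd w e e0.
  have -> : inner (pi (st a) v) w - inner v (pi a w) =
      inner (pi (st a) v) (w - j y) - inner v (pi a (w - j y)).
    by rewrite linearB /= !innerBr pij adjj stK; ring.
  have h1 := inner_le (pi (st a) v) (w - j y).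
  have h2 := inner_le v (pi a (w - j y)).
  have h3 := pib a (w - j y); have h4 := pib (st a) v.
  apply: le_trans (cabsD _ _) _; rewrite cabsN.
  have v0 := rnorm_ge0 v; have w0 := rnorm_ge0 (w - j y).
  have h5 := ler_pM (rnorm_ge0 _) w0 h4 wy.
  have h6 := ler_wpM2l v0 (le_trans h3 (ler_wpM2l (nr_ge0 H a) wy)).
  lra.
have Mst := ideal_st H HM.
have jM m : M m -> j m = 0.
  move=> Mm; apply: rnorm_eq0; apply/eqP; rewrite -sqrf_eq0; apply/eqP.
  by apply: complexI; rewrite jr FM //; exact: (ciMl HM).
have piMz m v : M m -> pi m v = 0.
  move=> Mm; apply: jeq => z; rewrite adjj inner0l jM ?inner0r //.
  by apply: (ciMr HM); exact: Mst.
pose xi := j 1.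
have Fpi y : Fn y = inner (pi y xi) xi by rewrite /xi pij mulr1 jB /= /B0 st1 mul1r.
have xi0 : xi <> 0.
  move=> xi0; have := Fpi 1; rewrite F1 xi0 inner0r => /eqP.
  by rewrite oner_eq0.
exists K, pi; split=> //.
- by split=> //; exists xi.
- move=> xc; have sxc y : M (st x * y - y * st x).
    have -> : st x * y - y * st x = st (st y * x - x * st y).
      by rewrite (stB H) !stM stK.
    by apply: Mst; rewrite -opprB; exact: (ciN HM).
  (* Modulo [M], [st z c y] is [c st z y], on which [F] is multiplicative. Below, the scalar for
     [st x] on the dense range of [j] is carried over to [x] on all vectors by taking adjoints. *)
  have pc c y : (forall y, M (c * y - y * c)) -> pi c (j y) = Fn c *: j y.
    move=> cc; apply: jeq => z; rewrite pij innerZl !jB /= /B0 -Fc //.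
    have -> : st z * (c * y) = c * (st z * y) - (c * st z - st z * c) * y.
      by rewrite mulrBl !mulrA opprB addrC subrK.
    by rewrite -scaleN1r FD FZ (FM (_ * y)) ?mulr0 ?addr0 //; exact: (ciMr HM).
  exists (Fn x).
    have : 1 <= Fn (st x) * Fn x by rewrite -Fc.
    rewrite Fs mulrC mulJ -(rmorph1 (real_complex R)) lecR => h.
    rewrite leNgt; apply/negP => l1.
    have := cabs_ge0 (Fn x); nra.
  by move=> v; apply: jeq => z; rewrite adjj -pij (pc _ _ sxc) innerZr innerZl Fs conjCK.
move=> L Ls Lc Linv.
have [L0 LD LZ] := Ls.
(* The vector functional of the projection [y] is dominated by [F], because [pi a y] and
   [pi a (xi - y)] are orthogonal. Purity makes it a multiple of [F], so [y] is a multiple of the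
   cyclic vector [xi]: either [L] is orthogonal to all [pi a xi], or it contains them. *)
have [y Ly yo] := orth_projection xi Ls Lc.
have xiE : xi = y + (xi - y) by rewrite addrC subrK.
have yo' v : L v -> inner v (xi - y) = 0 by move=> /yo h; rewrite innerC h rmorph0.
pose Gn a := inner (pi a y) y.
have GE a : inner (pi a y) xi = Gn a.
  by rewrite {1}xiE innerDr yo' ?addr0 //; exact: Linv.
have Gp a : Gn (st a * a) = (rnorm (pi a y) ^+ 2)%:C.
  by rewrite /Gn piM adj inner_rnorm.
have GF a : 0 <= Gn (st a * a) <= Fn (st a * a).
  have cross : inner (pi a y) (pi a (xi - y)) = 0.
    by rewrite -adj -piM yo' //; exact: Linv.
  have cross' : inner (pi a (xi - y)) (pi a y) = 0 by rewrite innerC cross rmorph0.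
  have e : pi a xi = pi a y + pi a (xi - y) by rewrite {1}xiE linearD.
  rewrite Gp ler0c sqr_ge0 /= Fpi piM adj e innerDl !innerDr cross cross' addr0 add0r.
  by rewrite !inner_rnorm -rmorphD lecR lerDl sqr_ge0.
have Gl := Fpure Gn.
have GeqF : forall a, Gn a = Gn 1 * Fn a.
  apply: Gl => // [a b|k a|a|m Mm]; rewrite /Gn.
  - by rewrite piD innerDl.
  - by rewrite piZ innerZl.
  - by rewrite adj innerC.
  - by rewrite piMz // inner0l.
have yt : y = Gn 1 *: xi.
  apply: jeq => z; rewrite innerZl.
  have -> : j z = pi (st (st z)) xi by rewrite stK /xi pij mulr1.
  by rewrite -!adj stK GE GeqF Fpi.
have [t0|t0] := eqVneq (Gn 1) 0.
  left; apply/seteqP; split=> [v Lv|_ -> //]; apply: jeq => z; rewrite inner0l.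
  have -> : j z = pi z xi by rewrite /xi pij mulr1.
  have y0 : y = 0 by rewrite yt t0 scale0r.
  by rewrite -adj; have := yo' _ (Linv (st z) _ Lv); rewrite y0 subr0.
right; apply/seteqP; split=> // v _.
have Lxi : L xi.
  have -> : xi = (Gn 1)^-1 *: y by rewrite yt scalerA mulVf // scale1r.
  exact: LZ.
apply: (closed_rnorm Lc) => e e0; have e2 : 0 < e / 2 by rewrite divr_gt0.
have [w vw] := jd v _ e2; exists (j w); last by apply: le_lt_trans vw _; lra.
by have := Linv w _ Lxi; rewrite /xi pij mulr1.
Qed.

End GNS.

(** * Unitization *)

Section CStarFacts.
Variables (R : realType) (A : cstarAlgType R).
Implicit Types a b c : A.

Lemma cmulNl a b : (- a) ** b = - (a ** b).
Proof. by rewrite -scaleN1r cmulZl scaleN1r. Qed.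
Lemma cmulNr a b : a ** (- b) = - (a ** b).
Proof. by rewrite -scaleN1r cmulZr scaleN1r. Qed.
Lemma cmul0l a : 0 ** a = 0.
Proof. by rewrite -(scale0r (0 : A)) cmulZl !scale0r. Qed.
Lemma cmul0r a : a ** 0 = 0.
Proof. by rewrite -(scale0r (0 : A)) cmulZr !scale0r. Qed.
Lemma cmulBl a b c : (a - b) ** c = a ** c - b ** c.
Proof. by rewrite cmulDl cmulNl. Qed.
Lemma cmulBr a b c : a ** (b - c) = a ** b - a ** c.
Proof. by rewrite cmulDr cmulNr. Qed.
Lemma rnormM a b : rnorm (a ** b) <= rnorm a * rnorm b.
Proof. by rewrite -lecR rmorphM /= -!rnormE cnormM. Qed.
Lemma rnorm_starM a : rnorm (cstar a ** a) = rnorm a ^+ 2.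
Proof. by apply: complexI; rewrite rmorphXn /= -!rnormE cnorm_star. Qed.
Lemma rnorm_star a : rnorm (cstar a) = rnorm a.
Proof.
have le b : rnorm b <= rnorm (cstar b).
  have := rnormM (cstar b) b; rewrite rnorm_starM.
  by have := rnorm_ge0 b; have := rnorm_ge0 (cstar b); nra.
by apply/eqP; rewrite eq_le -{2}[a]cstarK !le.
Qed.
End CStarFacts.

Section Unitization.
Variables (R : realType) (A : cstarAlgType R).

Record unitz := Unitz { uscal : R[i]; uelem : A }.
Implicit Types (x y z : unitz) (a b : A) (k : R[i]).

Lemma unitz_eq x y : uscal x = uscal y -> uelem x = uelem y -> x = y.
Proof. by case: x y => [k a] [l b] /= -> ->. Qed.

HB.instance Definition _ := gen_eqMixin unitz.
HB.instance Definition _ := gen_choiceMixin unitz.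

Definition uadd x y := Unitz (uscal x + uscal y) (uelem x + uelem y).
Definition uopp x := Unitz (- uscal x) (- uelem x).
Definition uscale k x := Unitz (k * uscal x) (k *: uelem x).
Definition umul x y := Unitz (uscal x * uscal y)
  (uscal x *: uelem y + uscal y *: uelem x + uelem x ** uelem y).
Definition ustar x := Unitz (Num.conj (uscal x)) (cstar (uelem x)).

Lemma uaddA : associative uadd.
Proof. by move=> x y z; apply: unitz_eq; rewrite /= addrA. Qed.
Lemma uaddC : commutative uadd.
Proof. by move=> x y; apply: unitz_eq; rewrite /= addrC. Qed.
Lemma uadd0 : left_id (Unitz 0 0) uadd.
Proof. by move=> x; apply: unitz_eq; rewrite /= add0r. Qed.
Lemma uaddN : left_inverse (Unitz 0 0) uopp uadd.
Proof. by move=> x; apply: unitz_eq; rewrite /= addNr. Qed.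
HB.instance Definition _ := GRing.isZmodule.Build unitz uaddA uaddC uadd0 uaddN.

Lemma uscaleA k l x : uscale k (uscale l x) = uscale (k * l) x.
Proof. by apply: unitz_eq; rewrite /= ?mulrA ?scalerA. Qed.
Lemma uscale1 : left_id 1 uscale.
Proof. by move=> x; apply: unitz_eq; rewrite /= ?mul1r ?scale1r. Qed.
Lemma uscaleDr : right_distributive uscale +%R.
Proof. by move=> k x y; apply: unitz_eq; rewrite /= ?mulrDr ?scalerDr. Qed.
Lemma uscaleDl x : {morph uscale^~ x : k l / k + l}.
Proof. by move=> k l; apply: unitz_eq; rewrite /= ?mulrDl ?scalerDl. Qed.
HB.instance Definition _ := GRing.Zmodule_isLmodule.Build R[i] unitz
  uscaleA uscale1 uscaleDr uscaleDl.

Lemma uscalD x y : uscal (x + y) = uscal x + uscal y. Proof. by []. Qed.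
Lemma uelemD x y : uelem (x + y) = uelem x + uelem y. Proof. by []. Qed.
Lemma uscalZ k x : uscal (k *: x) = k * uscal x. Proof. by []. Qed.
Lemma uelemZ k x : uelem (k *: x) = k *: uelem x. Proof. by []. Qed.
Lemma uscalB x y : uscal (x - y) = uscal x - uscal y. Proof. by []. Qed.
Lemma uelemB x y : uelem (x - y) = uelem x - uelem y. Proof. by []. Qed.

Ltac alin := linear_eq (R[i] : fieldType) A.

Lemma umulA : associative umul.
Proof.
move=> [k a] [l b] [m c]; apply: unitz_eq; rewrite /= ?mulrA //.
by rewrite !(cmulDl, cmulDr, cmulZl, cmulZr) cmulA; alin.
Qed.
Lemma umul1l : left_id (Unitz 1 0) umul.
Proof.
by move=> [k a]; apply: unitz_eq; rewrite /= ?mul1r // cmul0l scale1r scaler0 !addr0.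
Qed.
Lemma umul1r : right_id (Unitz 1 0) umul.
Proof.
by move=> [k a]; apply: unitz_eq; rewrite /= ?mulr1 // cmul0r scale1r scaler0 addr0 add0r.
Qed.
Lemma umulDl : left_distributive umul +%R.
Proof.
move=> [k a] [l b] [m c]; apply: unitz_eq; rewrite /= ?mulrDl //.
by rewrite !(cmulDl, cmulDr, cmulZl, cmulZr); alin.
Qed.
Lemma umulDr : right_distributive umul +%R.
Proof.
move=> [k a] [l b] [m c]; apply: unitz_eq; rewrite /= ?mulrDr //.
by rewrite !(cmulDl, cmulDr, cmulZl, cmulZr); alin.
Qed.
Lemma uone_neq0 : Unitz 1 0 != 0.
Proof. by apply/eqP => -[/eqP]; rewrite oner_eq0. Qed.
HB.instance Definition _ := GRing.Zmodule_isNzRing.Build unitz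
  umulA umul1l umul1r umulDl umulDr uone_neq0.

Lemma uscaleAl k x y : k *: (x * y) = (k *: x) * y.
Proof.
case: x y => [l a] [m b]; apply: unitz_eq; rewrite /= ?mulrA //.
by rewrite !(cmulDl, cmulDr, cmulZl, cmulZr); alin.
Qed.
HB.instance Definition _ := GRing.Lmodule_isLalgebra.Build R[i] unitz uscaleAl.
Lemma uscaleAr k x y : k *: (x * y) = x * (k *: y).
Proof.
case: x y => [l a] [m b]; apply: unitz_eq; first by rewrite /= mulrCA.
rewrite /=.
by rewrite !(cmulDl, cmulDr, cmulZl, cmulZr); alin.
Qed.
HB.instance Definition _ := GRing.Lalgebra_isAlgebra.Build R[i] unitz uscaleAr.

Definition uact x a : A := uscal x *: a + uelem x ** a.

Lemma uactM x y a : uact (x * y) a = uact x (uact y a).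
Proof.
case: x y => [k b] [l c]; rewrite /uact /=.
by rewrite !(cmulDl, cmulDr, cmulZl, cmulZr) cmulA; alin.
Qed.
Lemma uactD x y a : uact (x + y) a = uact x a + uact y a.
Proof. by rewrite /uact uscalD uelemD cmulDl; alin. Qed.
Lemma uactZ k x a : uact (k *: x) a = k *: uact x a.
Proof. by rewrite /uact uscalZ uelemZ cmulZl; alin. Qed.
Lemma uact_scale k x a : uact x (k *: a) = k *: uact x a.
Proof. by rewrite /uact cmulZr; alin. Qed.

Definition uact_norms x : set R := [set rnorm (uact x a) | a in [set a | rnorm a <= 1]].
(* The operator norm of left multiplication alone is only a seminorm when [A] has
   a unit; the maximum makes it a complete C*-norm in all cases. *)
Definition unorm x : R := Num.max (cabs (uscal x)) (sup (uact_norms x)).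

Lemma uact_bound x a : rnorm (uact x a) <= (cabs (uscal x) + rnorm (uelem x)) * rnorm a.
Proof.
apply: le_trans (rnormD _ _) _; rewrite rnormZ mulrDl lerD //.
exact: rnormM.
Qed.

Lemma uact_norms_sup x : has_sup (uact_norms x).
Proof.
split; first by exists (rnorm (uact x 0)); exists 0 => //=; rewrite rnorm0 ler01.
exists (cabs (uscal x) + rnorm (uelem x)) => _ [a /= a1 <-].
apply: le_trans (uact_bound x a) _.
by rewrite ler_piMr // addr_ge0 ?cabs_ge0 ?rnorm_ge0.
Qed.

Lemma uscal_le x : cabs (uscal x) <= unorm x.
Proof. by rewrite le_max lexx. Qed.

Lemma unorm_ge0 x : 0 <= unorm x.
Proof. exact: le_trans (cabs_ge0 _) (uscal_le x). Qed.

Lemma uact_le x a : rnorm (uact x a) <= unorm x * rnorm a.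
Proof.
have [a0|a0] := eqVneq (rnorm a) 0.
  by have := uact_bound x a; rewrite a0 !mulr0.
have ap : 0 < rnorm a by rewrite lt_neqAle eq_sym a0 rnorm_ge0.
rewrite -ler_pdivrMr // le_max; apply/orP; right.
have -> : rnorm (uact x a) / rnorm a = rnorm (uact x ((rnorm a)^-1%:C *: a)).
  by rewrite uact_scale rnormZ cabs_real ger0_norm ?invr_ge0 ?rnorm_ge0 // mulrC.
apply: sup_upper_bound; first exact: uact_norms_sup.
exists ((rnorm a)^-1%:C *: a) => //=.
by rewrite rnormZ cabs_real ger0_norm ?invr_ge0 ?rnorm_ge0 // mulVf.
Qed.

Lemma unorm_le x (c : R) : cabs (uscal x) <= c ->
  (forall a, rnorm (uact x a) <= c * rnorm a) -> unorm x <= c.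
Proof.
move=> xc h; rewrite ge_max xc /=; apply: ge_sup; first exact: (uact_norms_sup x).1.
move=> _ [a /= a1 <-]; apply: le_trans (h a) _; rewrite ler_piMr //.
exact: le_trans (cabs_ge0 _) xc.
Qed.

Lemma unormD x y : unorm (x + y) <= unorm x + unorm y.
Proof.
apply: unorm_le => [|a]; first exact: le_trans (cabsD _ _) (lerD (uscal_le _) (uscal_le _)).
rewrite uactD mulrDl; apply: le_trans (rnormD _ _) (lerD _ _); exact: uact_le.
Qed.

Lemma unormM x y : unorm (x * y) <= unorm x * unorm y.
Proof.
apply: unorm_le => [|a].
  by rewrite /= cabsM ler_pM ?cabs_ge0 ?uscal_le.
rewrite uactM; apply: le_trans (uact_le _ _) _; rewrite -mulrA ler_wpM2l ?unorm_ge0 //.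
exact: uact_le.
Qed.

Lemma unormZ k x : unorm (k *: x) = cabs k * unorm x.
Proof.
have le l y : unorm (l *: y) <= cabs l * unorm y.
  apply: unorm_le => [|a]; first by rewrite uscalZ cabsM ler_wpM2l ?cabs_ge0 ?uscal_le.
  by rewrite uactZ rnormZ -mulrA ler_wpM2l ?cabs_ge0 ?uact_le.
apply/eqP; rewrite eq_le le /=.
have [->|k0] := eqVneq k 0; first by rewrite cabs0 mul0r unorm_ge0.
have kp : 0 < cabs k.
  by rewrite lt_neqAle cabs_ge0 andbT eq_sym; apply: contra_neq k0 => /cabs_eq0.
rewrite mulrC -ler_pdivlMr // mulrC.
have := le k^-1 (k *: x); rewrite scalerA mulVf // scale1r.
by rewrite ComplexField.Normc.normcV.
Qed.

Lemma ustarK x : ustar (ustar x) = x.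
Proof. by apply: unitz_eq; rewrite /= ?conjCK ?cstarK. Qed.
Lemma ustarD x y : ustar (x + y) = ustar x + ustar y.
Proof. by apply: unitz_eq; rewrite /= ?rmorphD ?cstarD. Qed.
Lemma ustarZ k x : ustar (k *: x) = Num.conj k *: ustar x.
Proof. by apply: unitz_eq; rewrite /= ?rmorphM ?cstarZ. Qed.
Lemma ustarM x y : ustar (x * y) = ustar y * ustar x.
Proof.
apply: unitz_eq; first by rewrite /= rmorphM mulrC.
rewrite /=.
by rewrite !cstarD !cstarZ cstarM; alin.
Qed.

Lemma uact_star x a : cstar (uact x a) ** uact x a = cstar a ** uact (ustar x * x) a.
Proof.
have e b : cstar (uact x a) ** b = cstar a ** uact (ustar x) b.
  by rewrite /uact cstarD cstarZ cstarM /= cmulDl cmulDr cmulZl cmulZr cmulA.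
by rewrite uactM e.
Qed.

(** The C*-identity of [A] gives [|x a|^2 = |a^* (x^* x a)| <= |x^* x| |a|^2], hence one inequality;
    it also yields [|x| <= |x^*|], and then submultiplicativity gives the other. *)
Lemma unorm_starM x : unorm (ustar x * x) = unorm x ^+ 2.
Proof.
have le y : unorm y ^+ 2 <= unorm (ustar y * y).
  have n0 := unorm_ge0 (ustar y * y).
  rewrite -[leRHS]sqr_sqrtr // lerXn2r ?nnegrE ?unorm_ge0 ?sqrtr_ge0 //.
  apply: unorm_le => [|a].
    rewrite -(ler_pXn2r (n := 2)) ?nnegrE ?cabs_ge0 ?sqrtr_ge0 // sqr_sqrtr //.
    by apply: le_trans (uscal_le _); rewrite /= cabsM cabsJ expr2.
  rewrite -(ler_pXn2r (n := 2)) ?nnegrE ?rnorm_ge0 ?mulr_ge0 ?sqrtr_ge0 ?rnorm_ge0 //.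
  rewrite exprMn sqr_sqrtr // -rnorm_starM uact_star.
  apply: le_trans (rnormM _ _) _; rewrite rnorm_star mulrC expr2 mulrA.
  by rewrite ler_wpM2r ?rnorm_ge0 // uact_le.
have le' y : unorm y <= unorm (ustar y).
  have := le_trans (le y) (unormM _ _).
  by have := unorm_ge0 y; have := unorm_ge0 (ustar y); nra.
apply/eqP; rewrite eq_le le andbT; apply: le_trans (unormM _ _) _.
by rewrite expr2 ler_wpM2r ?unorm_ge0 // -{2}[x]ustarK.
Qed.

Definition uemb a : unitz := Unitz 0 a.

(** The operator norm is attained at [cstar a], since [|a a^*| = |a|^2]. *)
Lemma unorm_emb a : unorm (uemb a) = rnorm a.
Proof.
apply/eqP; rewrite eq_le; apply/andP; split.
  apply: unorm_le => [|b]; first by rewrite -[uscal _]/0 cabs0 rnorm_ge0.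
  by rewrite /uact /= scale0r add0r rnormM.
have := uact_le (uemb a) (cstar a); rewrite /uact /= scale0r add0r rnorm_star.
rewrite -[X in rnorm (X ** _)]cstarK rnorm_starM rnorm_star expr2.
have [->|a0] := eqVneq (rnorm a) 0; first by rewrite unorm_ge0.
by rewrite ler_pM2r // lt_neqAle eq_sym a0 rnorm_ge0.
Qed.

Lemma unitz_split x : x = uscal x *: 1 + uemb (uelem x).
Proof.
by apply: unitz_eq; rewrite ?uscalD ?uelemD /= ?mulr1 ?addr0 // scaler0 add0r.
Qed.

Lemma unorm1 : unorm 1 <= 1.
Proof.
apply: unorm_le => [|a]; first by rewrite /= expr1n expr0n addr0 sqrtr1.
by rewrite /uact /= cmul0l addr0 scale1r mul1r.
Qed.

Lemma unorm_split x : unorm x <= cabs (uscal x) + rnorm (uelem x).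
Proof.
rewrite {1}(unitz_split x); apply: le_trans (unormD _ _) _.
by rewrite unormZ unorm_emb lerD // ler_piMr ?cabs_ge0 // unorm1.
Qed.

Lemma uelem_le x : rnorm (uelem x) <= 2 * unorm x.
Proof.
rewrite -unorm_emb; have -> : uemb (uelem x) = x - uscal x *: 1.
  by rewrite {2}(unitz_split x) addrC addKr.
apply: le_trans (unormD _ _) _; rewrite -scaleNr unormZ cabsN.
have := uscal_le x; have := cabs_ge0 (uscal x); have := unorm1; nra.
Qed.

Lemma unorm_eq0 x : unorm x = 0 -> x = 0.
Proof.
move=> x0; apply: unitz_eq.
  by apply: cabs_eq0; apply/eqP; rewrite eq_le cabs_ge0 andbT -x0 uscal_le.
apply: rnorm_eq0; apply/eqP; rewrite eq_le rnorm_ge0 andbT.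
by have := uelem_le x; rewrite x0 mulr0.
Qed.

Lemma geometric_small (r e : R) : 0 <= r < 1 -> 0 < e ->
  exists N, forall n, (N <= n)%N -> r ^+ n < e.
Proof.
case/andP=> r0 r1 e0; have [->|rn0] := eqVneq r 0.
  by exists 1%N => -[//|n] _; rewrite expr0n.
have rp : 0 < r by rewrite lt_neqAle eq_sym rn0.
pose d := r^-1 - 1; have d0 : 0 < d by rewrite subr_gt0 invf_gt1.
pose N := Num.bound (e^-1 / d); exists N => n Nn.
have h : e^-1 / d < n%:R.
  apply: lt_le_trans (_ : N%:R <= _); last by rewrite ler_nat.
    by rewrite archi_boundP //; apply: divr_ge0; rewrite ?invr_ge0; apply: ltW.
rewrite ltr_pdivrMr // in h.
have := bernoulli_ge n (ltW d0); rewrite (_ : 1 + d = r^-1); last by rewrite addrC subrK.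
rewrite exprVn => h2; have h3 : e^-1 < (r ^+ n)^-1 by lra.
by rewrite ltf_pV2 ?posrE ?exprn_gt0 // in h3.
Qed.

Lemma complete_seq_complex (a : nat -> R[i]) :
  (forall e : R, 0 < e -> exists N : nat, forall n m, (N <= n)%N -> (N <= m)%N ->
    cabs (a n - a m) < e) ->
  exists l, forall e : R, 0 < e -> exists N : nat, forall n, (N <= n)%N -> cabs (a n - l) < e.
Proof.
move=> aC.
have [e e0|u uP] := @complete_seq R R (fun n => complex.Re (a n)).
  have [N aN] := aC e e0; exists N => n m Nn Nm.
  by rewrite -ReB; apply: le_lt_trans (Re_le_cabs _) (aN _ _ Nn Nm).
have [e e0|v vP] := @complete_seq R R (fun n => complex.Im (a n)).
  have [N aN] := aC e e0; exists N => n m Nn Nm.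
  by rewrite -ImB; apply: le_lt_trans (Im_le_cabs _) (aN _ _ Nn Nm).
exists (Complex u v) => e e0; have e2 : 0 < e / 2 by rewrite divr_gt0.
have [N1 h1] := uP _ e2; have [N2 h2] := vP _ e2; exists (maxn N1 N2) => n.
rewrite geq_max => /andP[/h1 + /h2] => x1 x2.
by apply: le_lt_trans (cabs_le_ReIm _) _; rewrite ReB ImB /=; lra.
Qed.

Lemma unitz_complete (u : nat -> unitz) (r : R) : 0 <= r < 1 ->
  (forall n, unorm (u n.+1 - u n) <= r ^+ n) ->
  exists l, forall e, 0 < e -> exists n, unorm (u n - l) <= e /\ unorm (u n.+1 - l) <= e.
Proof.
move=> r01 ur; have [r0 r1] := andP r01; have s0 : 0 < 1 - r by rewrite subr_gt0.
have tail n (p : nat) : unorm (u (p + n)%N - u n) <= (r ^+ n - r ^+ (p + n)) / (1 - r).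
  elim: p => [|p IH].
    by rewrite !subrr mul0r -(scale0r 0) unormZ cabs0 mul0r.
  have -> : u (p.+1 + n)%N - u n = (u (p + n).+1 - u (p + n)%N) + (u (p + n)%N - u n).
    by rewrite subrKA.
  apply: le_trans (unormD _ _) _; apply: le_trans (lerD (ur _) IH) _.
  rewrite ler_pdivlMr // mulrDl divfK ?gt_eqF // addSn exprS; lra.
have C e : 0 < e -> exists N, forall n m, (N <= n)%N -> (N <= m)%N -> unorm (u n - u m) < e.
  move=> e0; have e1 : 0 < e * (1 - r) by rewrite mulr_gt0.
  have [N rN] := geometric_small r01 e1; exists N.
  have key n m : (N <= n)%N -> (n <= m)%N -> unorm (u m - u n) < e.
    move=> Nn nm; have := tail n (m - n)%N; rewrite subnK // => h.
    apply: le_lt_trans h _; rewrite ltr_pdivrMr //.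
    have := rN n Nn; have := exprn_ge0 m r0; lra.
  move=> n m Nn Nm; case/orP: (leq_total n m) => nm; last exact: key.
  by rewrite -opprB -scaleN1r unormZ cabsN ComplexField.Normc.normc1 mul1r; exact: key.
have [e /C[N uN]|k kP] := @complete_seq_complex (fun n => uscal (u n)).
  exists N => n m Nn Nm; rewrite -uscalB.
  by apply: le_lt_trans (uscal_le _) (uN _ _ Nn Nm).
have [e e0|a aP] := @complete_seq _ A (fun n => uelem (u n)).
  have eE := ge0_ReE (ltW e0); have re : 0 < complex.Re e / 2.
    by rewrite divr_gt0 // -ltcR -eE.
  have [N uN] := C _ re; exists N => n m Nn Nm; rewrite -uelemB rnormE eE ltcR.
  apply: le_lt_trans (uelem_le _) _; have := uN _ _ Nn Nm; lra.
exists (Unitz k a) => e e0; have e2 : 0 < e / 2 by rewrite divr_gt0.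
have [N1 h1] := kP _ e2; have [|N2 h2] := aP ((e / 2)%:C); first by rewrite ltcR.
have key n : (maxn N1 N2 <= n)%N -> unorm (u n - Unitz k a) <= e.
  rewrite geq_max => /andP[/h1 + /h2]; rewrite rnormE ltcR => x1 x2.
  apply: le_trans (unorm_split _) _; rewrite uscalB uelemB /=; lra.
by exists (maxn N1 N2); split; apply: key.
Qed.

Lemma unitz_cstar : unital_cstar ustar unorm.
Proof.
split.
- exact: ustarK.
- exact: ustarD.
- exact: ustarZ.
- exact: ustarM.
- exact: unorm_ge0.
- exact: unorm_eq0.
- exact: unormD.
- exact: unormZ.
- exact: unormM.
- exact: unorm_starM.
- exact: unitz_complete.
Qed.

Lemma uembD a b : uemb (a + b) = uemb a + uemb b.
Proof. by apply: unitz_eq; rewrite /= ?addr0. Qed.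
Lemma uembZ k a : uemb (k *: a) = k *: uemb a.
Proof. by apply: unitz_eq; rewrite /= ?mulr0. Qed.
Lemma uembM a b : uemb (a ** b) = uemb a * uemb b.
Proof. by apply: unitz_eq; rewrite /= ?mulr0 // !scale0r !add0r. Qed.
Lemma uemb_star a : uemb (cstar a) = ustar (uemb a).
Proof. by apply: unitz_eq; rewrite /= ?rmorph0. Qed.
Lemma uemb_sub a b : uemb (a - b) = uemb a - uemb b.
Proof. by apply: unitz_eq; rewrite /= ?subr0. Qed.

End Unitization.

(** * Orthonormal families and traces *)

Lemma bounded_linear_continuous (R : realType) (V W : normedModType R[i])
    (f : {linear V -> W}) (c : R) : (forall x, rnorm (f x) <= c * rnorm x) -> continuous f.
Proof.
move=> fb x; apply/cvg_ballP => e e0.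
have eE := ge0_ReE (ltW e0); have re : 0 < complex.Re e by rewrite -ltcR -eE.
have c1 : 0 < `|c| + 1 by rewrite ltr_wpDl.
have d0 : 0 < complex.Re e / (`|c| + 1) by rewrite divr_gt0.
apply/nbhs_ballP; exists ((complex.Re e / (`|c| + 1))%:C); first by rewrite /= ltcR.
move=> y; rewrite -!ball_normE /ball_ /= !rnormE eE !ltcR => xy.
rewrite -linearB; apply: le_lt_trans (fb _) _; rewrite ltr_pdivlMr // in xy.
by have := rnorm_ge0 (x - y); have := ler_norm c; nra.
Qed.

Section Subspaces.
Variables (R : realType) (V : lmodType R[i]).
Implicit Types (S L : set V).

Lemma subspace_sum L : is_subspace L -> forall n (F : 'I_n -> V),
  (forall i, L (F i)) -> L (\sum_(i < n) F i).
Proof.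
case=> L0 LD _ n F LF; elim: n F LF => [|n IH] F LF; first by rewrite big_ord0.
by rewrite big_ord_recr /=; apply: LD => //; apply: IH.
Qed.

Lemma subspaceB L x y : is_subspace L -> L x -> L y -> L (x - y).
Proof. by case=> _ LD LZ Lx Ly; apply: LD => //; rewrite -scaleN1r; exact: LZ. Qed.

Lemma lin_span_sub S L : is_subspace L -> S `<=` L -> lin_span S `<=` L.
Proof.
move=> Ls SL _ [n [k [v [Sv ->]]]]; apply: subspace_sum => // i.
by case: Ls => _ _; apply; exact: SL.
Qed.

Lemma sub_lin_span S : S `<=` lin_span S.
Proof.
move=> x Sx; exists 1%N, (fun=> 1), (fun=> x); split=> //.
by rewrite big_ord1 scale1r.
Qed.

Lemma lin_span_subspace S : is_subspace (lin_span S).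
Proof.
split.
- by exists 0%N, (fun=> 0), (fun=> 0); split=> [[]|]; rewrite ?big_ord0.
- move=> _ _ [n [k [v [Sv ->]]]] [m [l [w [Sw ->]]]].
  exists (n + m)%N, (fun i => match fintype.split i with inl i => k i | inr i => l i end),
    (fun i => match fintype.split i with inl i => v i | inr i => w i end); split.
    by move=> i; case: (fintype.split i).
  rewrite big_split_ord /=; congr (_ + _); apply: eq_bigr => i _.
    by rewrite (unsplitK (inl i)).
  by rewrite (unsplitK (inr i)).
- move=> c _ [n [k [v [Sv ->]]]]; exists n, (fun i => c * k i), v; split=> //.
  by rewrite scaler_sumr; apply: eq_bigr => i _; rewrite scalerA.
Qed.

Lemma lin_span_mono S L : S `<=` L -> lin_span S `<=` lin_span L.
Proof.
move=> SL; apply: lin_span_sub; first exact: lin_span_subspace.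
by apply: subset_trans SL _; exact: sub_lin_span.
Qed.

End Subspaces.

Section Orthonormal.
Variables (R : realType) (K : hilbertType R).
Implicit Types (x y z : K) (e s : seq K).

Fixpoint orthonormal e : Prop :=
  if e is y :: e' then
    [/\ inner y y = 1, forall z, z \in e' -> inner y z = 0 & orthonormal e']
  else True.

Definition oproj e x : K := \sum_(y <- e) inner x y *: y.

Lemma oproj_linear e k x y : oproj e (k *: x + y) = k *: oproj e x + oproj e y.
Proof.
rewrite /oproj scaler_sumr -big_split /=; apply: eq_bigr => z _.
by rewrite innerDl innerZl scalerDl scalerA.
Qed.

Lemma inner_sum (I : Type) (r : seq I) (F : I -> K) y :
  inner (\sum_(i <- r) F i) y = \sum_(i <- r) inner (F i) y.
Proof.
elim: r => [|i r IH]; first by rewrite !big_nil inner0l.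
by rewrite !big_cons innerDl IH.
Qed.

Lemma inner_oproj e x y : orthonormal e -> y \in e -> inner (oproj e x) y = inner x y.
Proof.
elim: e => //= z e IH [zz ze oe].
rewrite /oproj big_cons -/(oproj e x) innerDl innerZl in_cons => /orP[/eqP->|ye].
  rewrite zz mulr1 /oproj inner_sum big_seq big1 ?addr0 // => w we.
  by rewrite innerZl (innerC z w) ze // rmorph0 mulr0.
by rewrite ze // mulr0 add0r IH.
Qed.

Lemma oproj_orth e x y : (forall z, z \in e -> inner y z = 0) -> inner (oproj e x) y = 0.
Proof.
move=> h; rewrite /oproj inner_sum big_seq big1 // => w we.
by rewrite innerZl (innerC y w) h // rmorph0 mulr0.
Qed.

Lemma oproj_fixed_subspace e : is_subspace [set x | oproj e x = x].
Proof.
split=> [|x y /= ex ey|k x /= ex].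
- by rewrite /= /oproj big1 // => y _; rewrite inner0l scale0r.
- by have := oproj_linear e 1 x y; rewrite !scale1r ex ey.
- have := oproj_linear e k x 0; rewrite !addr0 ex => ->.
  by rewrite /oproj big1 ?addr0 // => y _; rewrite inner0l scale0r.
Qed.

Lemma oproj_in (L : set K) e x : is_subspace L -> (forall y, y \in e -> L y) -> L (oproj e x).
Proof.
case=> L0 LD LZ; rewrite /oproj; elim: e => [|y e IH] eL; first by rewrite big_nil.
rewrite big_cons; apply: LD; first by apply/LZ/eL; rewrite mem_head.
by apply: IH => z ze; apply: eL; rewrite in_cons ze orbT.
Qed.

(** The second clause puts [s] in the span of [e], the last puts [e] in the span of [s]. Vectors
    dependent on the later ones in [s] contribute nothing to [e]. *)
Lemma gram_schmidt s : exists e, [/\ orthonormal e, forall x, x \in s -> oproj e x = x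
  & forall L : set K, is_subspace L -> (forall x, x \in s -> L x) ->
      forall y, y \in e -> L y].
Proof.
elim: s => [|v s [e [oe se eL]]]; first by exists [::].
pose r := v - oproj e v.
have re z : z \in e -> inner r z = 0 by move=> ze; rewrite innerBl inner_oproj // subrr.
have sL (L : set K) : (forall x, x \in v :: s -> L x) -> forall x, x \in s -> L x.
  by move=> h x xs; apply: h; rewrite in_cons xs orbT.
have [r0|r0] := eqVneq r 0.
  exists e; split=> // [x|L Ls vL]; last by apply: eL => //; exact: sL.
  rewrite in_cons => /orP[/eqP->|]; last exact: se.
  by apply/esym/eqP; rewrite -subr_eq0 -/r r0.
have rn : rnorm r != 0 by apply: contra_neq r0 => /rnorm_eq0.
pose y := (rnorm r)^-1%:C *: r.
have ye z : z \in e -> inner y z = 0 by move=> ze; rewrite innerZl re ?mulr0.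
have yy : inner y y = 1.
  rewrite innerZl innerZr conj_real inner_rnorm -!rmorphM /= expr2.
  by rewrite mulKf // mulVf.
exists (y :: e); split=> /=.
- by split.
- move=> x; rewrite in_cons /oproj big_cons -/(oproj e x) => /orP[/eqP->|xs].
    have -> : inner v y = (rnorm r)%:C.
      rewrite -(subrK (oproj e v) v) -/r innerDl oproj_orth // addr0 innerZr conj_real.
      by rewrite inner_rnorm -rmorphM /= expr2 mulKf.
    by rewrite scalerA -rmorphM /= mulfV // scale1r subrK.
  by rewrite -{1}(se _ xs) oproj_orth // scale0r add0r se.
- move=> L Ls vL z; rewrite in_cons => /orP[/eqP->|]; last by apply: eL => //; exact: sL.
  have [_ _ LZ] := Ls; apply: LZ; apply: subspaceB => //; first by apply: vL; rewrite mem_head.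
  by apply: oproj_in => // w we; apply: eL we => //; exact: sL.
Qed.

Lemma orthonormal_inner e y : orthonormal e -> y \in e -> inner y y = 1.
Proof.
elim: e => //= z e IH [zz _ oe]; rewrite in_cons => /orP[/eqP->//|]; exact: IH.
Qed.

Lemma orthonormal_rnorm e y : orthonormal e -> y \in e -> rnorm y = 1.
Proof.
move=> oe /(orthonormal_inner oe); rewrite inner_rnorm -(rmorph1 (real_complex R)).
move=> /complexI/eqP; rewrite sqrf_eq1 => /orP[/eqP//|/eqP h].
by have := rnorm_ge0 y; rewrite h ler0N1.
Qed.

Definition otrace e (T : K -> K) : R[i] := \sum_(y <- e) inner (T y) y.

(** Invariance of the span of [e] lets both traces expand into a double sum over products of matrix
    entries, and these sums agree after exchanging indices. *)
Lemma otrace_comm e (T S : {linear K -> K}) : 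
  (forall y, y \in e -> oproj e (T y) = T y) -> (forall y, y \in e -> oproj e (S y) = S y) ->
  otrace e (fun y => T (S y)) = otrace e (fun y => S (T y)).
Proof.
have key (P Q : {linear K -> K}) : (forall y, y \in e -> oproj e (Q y) = Q y) ->
    otrace e (fun y => P (Q y)) = \sum_(y <- e) \sum_(z <- e) inner (Q y) z * inner (P z) y.
  move=> hQ; rewrite /otrace big_seq [RHS]big_seq; apply: eq_bigr => y ye.
  rewrite -{1}(hQ _ ye) /oproj linear_sum inner_sum; apply: eq_bigr => z _.
  by rewrite linearZ /= innerZl.
move=> hT hS; rewrite key // [RHS]key // exchange_big /=.
by apply: eq_bigr => y _; apply: eq_bigr => z _; rewrite mulrC.
Qed.

Lemma otrace_le e (T : K -> K) (c : R) : orthonormal e ->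
  (forall y, y \in e -> rnorm (T y) <= c) -> cabs (otrace e T) <= c * (size e)%:R.
Proof.
move=> oe h; have {}oe y (ye : y \in e) := orthonormal_rnorm oe ye.
elim: e h oe => [|y e IH] h oe; first by rewrite /otrace big_nil cabs0 mulr0.
rewrite /otrace big_cons /= -natr1 mulrDr mulr1 [leRHS]addrC.
apply: le_trans (cabsD _ _) (lerD _ _).
  apply: le_trans (inner_le _ _) _; rewrite (oe y) ?mem_head // mulr1.
  by apply: h; rewrite mem_head.
by apply: IH => z ze; [apply: h | apply: oe]; rewrite in_cons ze orbT.
Qed.

End Orthonormal.

(** * Commutators and central elements modulo an ideal *)

Section Representation.
Variables (R : realType) (A : cstarAlgType R).
Implicit Types (a b : A) (M I : set A).

Lemma unitz_ideal M : is_ideal M ->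
  closed_ideal (@unorm R A) (fun x => uscal x = 0 /\ M (uelem x)).
Proof.
case=> -[M0 MD MZ] MM Mc; split=> //.
- by move=> x y [x0 Mx] [y0 My]; rewrite uscalD uelemD x0 y0 addr0; split=> //; exact: MD.
- by move=> k x [x0 Mx]; rewrite uscalZ uelemZ x0 mulr0; split=> //; exact: MZ.
- move=> [k a] [l b] /= [-> Mb]; rewrite mulr0 scale0r addr0; split=> //.
  by apply: MD; [exact: MZ | case: (MM a b Mb)].
- move=> [k a] [l b] /= [-> Ma]; rewrite mul0r scale0r add0r; split=> //.
  by apply: MD; [exact: MZ | case: (MM b a Ma)].
- move=> x h; split.
    apply: (@cabs_near0 _ _ 1) => e e0; have [m [m0 _] xm] := h e e0.
    by rewrite mulr1 -[uscal x]subr0 -m0 -uscalB; exact: le_trans (uscal_le _) xm.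
  apply: (closed_rnorm Mc) => e e0; have e4 : 0 < e / 4 by rewrite divr_gt0.
  have [m [_ Mm] xm] := h _ e4; exists (uelem m) => //.
  by rewrite -uelemB; apply: le_lt_trans (uelem_le _) _; lra.
Qed.

(** The GNS representation of the unitization is taken for [M] viewed as an ideal there. Its
    restriction to [A] stays irreducible because scalars preserve every subspace, and it is nonzero
    because [a] acts as [l]. *)
Theorem irreducible_with_scalar M a : is_ideal M ->
  (forall b, M (a ** b - b ** a)) -> (forall m, M m -> 1 <= rnorm (a - m)) ->
  exists (K : hilbertType R) (pi : A -> {linear K -> K}),
    [/\ is_irreducible pi, forall b v, rnorm (pi b v) <= rnorm b * rnorm v,
        forall m v, M m -> pi m v = 0,
        exists v : K, v <> 0
      & exists2 l, 1 <= cabs l & forall v, pi a v = l *: v].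
Proof.
move=> Mi ac aM; have HM := unitz_ideal Mi.
have [|K [pi [[piD piZ piM piS pi1] [[v0 v00] pib] piM0 pia pirr]]] :=
    gns_pure (unitz_cstar A) HM (x := uemb a).
  move=> [k m] [/= -> Mm]; rewrite (_ : Unitz 0 m = uemb m) // -uemb_sub unorm_emb.
  exact: aM.
have [l l1 lP] : exists2 l, 1 <= cabs l & forall v, pi (uemb a) v = l *: v.
  apply: pia => -[k b]; rewrite uscalB uelemB /= mul0r mulr0 subrr; split=> //.
  rewrite !scale0r add0r addr0 (_ : _ - _ = a ** b - b ** a); first exact: ac.
  by linear_eq (R[i] : fieldType) A.
exists K, (fun b => pi (uemb b)); split.
- split.
  + split.
    * by move=> b; exact: (bounded_linear_continuous (pib (uemb b))).
    * by move=> b c v; rewrite uembD piD.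
    * by move=> k b v; rewrite uembZ piZ.
    * by move=> b c v; rewrite uembM piM.
    * by move=> b v w; rewrite uemb_star piS.
  + exists a, v0; rewrite lP => /eqP; rewrite scaler_eq0 => /orP[/eqP l0|/eqP//].
    by move: l1; rewrite l0 cabs0 ler10.
  + move=> L Ls Lc Linv; apply: pirr => // x v Lv.
    have [_ LD LZ] := Ls; rewrite (unitz_split x) piD piZ pi1.
    by apply: LD; [exact: LZ | exact: Linv].
- by move=> b v; rewrite -unorm_emb.
- by move=> m v Mm; apply: piM0.
- by exists v0.
- by exists l.
Qed.

Definition commutators_of (B : set A) : set A :=
  [set x | exists a b, [/\ B a, B b & x = a ** b - b ** a]].

(* The trace of [pi x] on the span of [e] vanishes, that of [l] is [l * size e]. *)
Lemma trace_obstruction (K : hilbertType R) (pi : A -> {linear K -> K}) (e : seq K)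
    (B : set A) x (l : R[i]) (c : R) :
  is_representation pi -> orthonormal e -> e != [::] ->
  (forall b y, B b -> y \in e -> oproj e (pi b y) = pi b y) ->
  lin_span (commutators_of B) x ->
  (forall y, y \in e -> rnorm (pi x y - l *: y) <= c) -> cabs l <= c.
Proof.
case=> _ piD piZ piM _ oe e0 eB xB xl.
have pi0 v : pi 0 v = 0 by rewrite -(scale0r 0) piZ scale0r.
have piB a b v : pi (a - b) v = pi a v - pi b v.
  by rewrite piD -scaleN1r piZ scaleN1r.
have tD a b : otrace e (pi (a + b)) = otrace e (pi a) + otrace e (pi b).
  rewrite /otrace -big_split /=; apply: eq_bigr => y _.
  by rewrite piD innerDl.
have tZ k a : otrace e (pi (k *: a)) = k * otrace e (pi a).
  rewrite /otrace mulr_sumr; apply: eq_bigr => y _.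
  by rewrite piZ innerZl.
have tx : otrace e (pi x) = 0.
  suff : lin_span (commutators_of B) `<=` [set x | otrace e (pi x) = 0] by apply.
  apply: lin_span_sub.
    split=> [|a b /= ta tb|k a /= ta]; rewrite /= ?tD ?tZ ?ta ?tb ?addr0 ?mulr0 //.
    by rewrite /otrace big1 // => y _; rewrite pi0 inner0l.
  move=> _ [a [b [Ba Bb ->]]] /=.
  have /eqP := otrace_comm (fun y => eB a y Ba) (fun y => eB b y Bb).
  rewrite -subr_eq0 => /eqP <-; rewrite /otrace -sumrB; apply: eq_bigr => y _.
  by rewrite piB !piM innerBl.
have := otrace_le oe xl.
have -> : otrace e (fun y => pi x y - l *: y) = - (l * (size e)%:R).
  have : otrace e (fun y => pi x y - l *: y) = otrace e (pi x) - \sum_(y <- e) l.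
    rewrite /otrace -sumrB big_seq [RHS]big_seq; apply: eq_bigr => y ye.
    by rewrite innerBl innerZl (orthonormal_inner oe ye) mulr1.
  move=> ->; rewrite tx sub0r; congr (- _).
  by rewrite big_const_seq count_predT -[iter _ _ _]/(_) iter_addr_0 mulr_natr.
rewrite cabsN cabsM (_ : cabs (size e)%:R = (size e)%:R); last first.
  by rewrite -(rmorph_nat (real_complex R)) cabs_real ger0_norm.
by rewrite ler_pM2r // ltr0n lt0n size_eq0.
Qed.

Lemma algebraic_ideal_closure J : is_subspace J ->
  (forall a b, J b -> J (a ** b) /\ J (b ** a)) -> is_ideal (closure J).
Proof.
case=> J0 JD JZ JM; split; last exact: closed_closure.
- split; first exact: subset_closure.
  + move=> x y /closureP cx /closureP cy; apply/closureP => e e0.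
    have e2 : 0 < e / 2 by rewrite divr_gt0.
    have [u Ju xu] := cx _ e2; have [v Jv yv] := cy _ e2.
    exists (u + v); first exact: JD.
    by rewrite opprD addrACA; apply: le_lt_trans (rnormD _ _) _; lra.
  + move=> k x /closureP cx; apply/closureP => e e0.
    have k1 : 0 < cabs k + 1 by rewrite ltr_wpDl ?cabs_ge0.
    have e2 : 0 < e / (cabs k + 1) by rewrite divr_gt0.
    have [u Ju xu] := cx _ e2; exists (k *: u); first exact: JZ.
    rewrite -scalerBr rnormZ; rewrite ltr_pdivlMr // in xu.
    by have := rnorm_ge0 (x - u); have := cabs_ge0 k; nra.
- move=> a b /closureP cb.
  have key e : 0 < e -> exists2 u, J u & rnorm a * rnorm (b - u) < e.
    move=> e0; have a1 : 0 < rnorm a + 1 by rewrite ltr_wpDl ?rnorm_ge0.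
    have e2 : 0 < e / (rnorm a + 1) by rewrite divr_gt0.
    have [u Ju bu] := cb _ e2; exists u => //; rewrite ltr_pdivlMr // in bu.
    by have := rnorm_ge0 (b - u); nra.
  split; apply/closureP => e /key[u Ju bu]; have [Jau Jua] := JM a u Ju.
    exists (a ** u) => //; rewrite -cmulBr; exact: le_lt_trans (rnormM _ _) bu.
  exists (u ** a) => //; rewrite -cmulBl; apply: le_lt_trans (rnormM _ _) _.
  by rewrite mulrC.
Qed.

Lemma dist_closure a J (c : R) : (forall m, J m -> c <= rnorm (a - m)) ->
  forall m, closure J m -> c <= rnorm (a - m).
Proof.
move=> h m /closureP cm; apply/ler_addgt0Pr => e e0; have [u Ju mu] := cm e e0.
apply: le_trans (h u Ju) _; apply: le_trans (rnorm_triangle _ m _) _.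
by rewrite lerD2l ltW.
Qed.

(** The upper bound of a chain is the closure of its union. Merely avoiding [a] could be lost in
    that closure, whereas distance at least 1 survives; this is why [a] is rescaled. *)
Lemma maximal_far_ideal I a : is_ideal I -> (forall i, I i -> 1 <= rnorm (a - i)) ->
  exists M, [/\ is_ideal M, I `<=` M, forall m, M m -> 1 <= rnorm (a - m)
    & forall J, is_ideal J -> M `<=` J -> (forall m, J m -> 1 <= rnorm (a - m)) -> J `<=` M].
Proof.
move=> Ii Ia.
pose T := {M : set A | [/\ is_ideal M, I `<=` M & forall m, M m -> 1 <= rnorm (a - m)]}.
pose Rl (u v : T) := `[< sval u `<=` sval v >].
have t0 : T by exists I; split.
have [|||[M [Mi IM Ma]] Mmax] := @ZL_preorder T t0 Rl.
- by move=> u; apply/asboolP.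
- by move=> u v w /asboolP uv /asboolP vw; apply/asboolP; exact: subset_trans uv vw.
- move=> F Ftot; have [[f0 Ff0]|F0] := pselect (F !=set0); last first.
    by exists t0 => s Fs; case: F0; exists s.
  pose J := \bigcup_(u in F) sval u.
  have Js : is_subspace J.
    split.
    + by exists f0 => //; case: (svalP f0) => -[[]].
    + move=> x y [u Fu ux] [v Fv vy].
      have [/asboolP uv|/asboolP vu] := Ftot _ _ Fu Fv.
        by exists v => //; case: (svalP v) => -[[_ vD _] _ _] _ _; apply: vD => //; exact: uv.
      by exists u => //; case: (svalP u) => -[[_ uD _] _ _] _ _; apply: uD => //; exact: vu.
    + by move=> k x [u Fu ux]; exists u => //; case: (svalP u) => -[[_ _ uZ] _ _] _ _; exact: uZ.
  have JM b c : J c -> J (b ** c) /\ J (c ** b).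
    case=> u Fu uc; case: (svalP u) => -[_ uM _] _ _.
    by case: (uM b c uc) => h1 h2; split; exists u.
  have Ja m : closure J m -> 1 <= rnorm (a - m).
    apply: dist_closure => {}m [u Fu um]; by case: (svalP u) => _ _; apply.
  have IJ : I `<=` closure J.
    move=> x Ix; apply: subset_closure; exists f0 => //.
    by case: (svalP f0) => _ h _; exact: h.
  exists (exist _ (closure J) (And3 (algebraic_ideal_closure Js JM) IJ Ja)) => u Fu.
  by apply/asboolP => x ux /=; apply: subset_closure; exists u.
exists M; split=> // J Ji MJ Ja.
have h : [/\ is_ideal J, I `<=` J & forall m, J m -> 1 <= rnorm (a - m)].
  by split=> //; exact: subset_trans IM MJ.
have /Mmax/asboolP : Rl (exist _ M (And3 Mi IM Ma)) (exist _ J h) by apply/asboolP.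
exact.
Qed.

End Representation.

(** * Compactness of rank one operators *)

Section RankOne.
Variables (R : realType) (K : hilbertType R).
Implicit Types v w : K.

Definition rank_one v w : K := inner w v *: v.

Lemma rank_one_linear v : linear (rank_one v).
Proof. by move=> k x y; rewrite /rank_one innerDl innerZl scalerDl scalerA. Qed.

(** The scalars range over a square, so that the set is a continuous image of a product of two
    compact real segments. *)
Lemma disc_image_compact v (r : R) :
  compact [set z *: v | z in [set z : R[i] | `|complex.Re z| <= r /\ `|complex.Im z| <= r]].
Proof.
pose f (p : R * R) : K := p.1%:C *: v + p.2%:C *: ('i%C *: v).
have fc : continuous f.
  move=> p; apply/cvg_ballP => e e0.
  have eE := ge0_ReE (ltW e0); have re : 0 < complex.Re e by rewrite -ltcR -eE.
  pose C := rnorm v + rnorm ('i%C *: v) + 1.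
  have C1 : 0 < C by have := rnorm_ge0 v; have := rnorm_ge0 ('i%C *: v); rewrite /C; lra.
  apply/(@nbhs_ballP R (R * R)%type); exists (complex.Re e / C); first by rewrite /= divr_gt0.
  move=> q [/= b1 b2]; rewrite -ball_normE /ball_ /= rnormE eE ltcR.
  have -> : f p - f q = (p.1 - q.1)%:C *: v + (p.2 - q.2)%:C *: ('i%C *: v).
    by rewrite /f !rmorphB /=; linear_eq (R[i] : fieldType) K.
  apply: le_lt_trans (rnormD _ _) _; rewrite [rnorm (_ *: v)]rnormZ [rnorm (_ *: (_ *: v))]rnormZ !cabs_real.
  move: b1 b2; rewrite -!ball_normE /ball_ /= => b1 b2.
  have h1 := ler_wpM2r (rnorm_ge0 v) (ltW b1).
  have h2 := ler_wpM2r (rnorm_ge0 ('i%C *: v)) (ltW b2).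
  have : complex.Re e / C * C = complex.Re e by rewrite divfK // gt_eqF.
  have : 0 < complex.Re e / C by rewrite divr_gt0.
  move: h1 h2; rewrite /C; move: (complex.Re e / _) => q'; lra.
have -> : [set z *: v | z in [set z : R[i] | `|complex.Re z| <= r /\ `|complex.Im z| <= r]]
    = f @` (`[- r, r] `*` `[- r, r]).
  apply/seteqP; split=> [_ [z [z1 z2] <-]|_ [[x y] [/= xr yr] <-]].
    exists (complex.Re z, complex.Im z); first by split; rewrite /= in_itv /= -ler_norml.
    rewrite /f /= scalerA -scalerDl; congr (_ *: _); rewrite [RHS]complexE.
    by rewrite (mulrC 'i%C).
  exists (x%:C + y%:C * 'i%C).
    move: xr yr; rewrite !in_itv /= -!ler_norml => xr yr.
    by rewrite !(mul0r, mulr0, subr0, addr0, add0r, mulr1).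
  by rewrite /f /= scalerA -scalerDl.
apply: continuous_compact; first exact: continuous_subspaceT.
by apply: compact_setX; exact: segment_compact.
Qed.

Lemma rank_one_compact v (T : {linear K -> K}) : T =1 rank_one v -> compact_operator T.
Proof.
move=> Tv; have Qc := @disc_image_compact v (rnorm v).
set Q := [set _ | _ in _] in Qc.
have Qcl : closed Q by apply: compact_closed => //; exact: norm_hausdorff.
apply: (subclosed_compact _ Qc); first exact: closed_closure.
rewrite [X in _ `<=` X](closure_id Q).1 //; apply: closureS => _ [x /= x1 <-].
exists (inner x v); last by rewrite Tv.
have : cabs (inner x v) <= rnorm v.
  apply: le_trans (inner_le _ _) _; rewrite ler_piMl ?rnorm_ge0 //.
  by rewrite -lecR -rnormE.
by move=> h; split; [apply: le_trans (Re_le_cabs _) h | apply: le_trans (Im_le_cabs _) h].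
Qed.

End RankOne.

(** * The AF case and the postliminal case *)

Section Corollary.
Variables (R : realType) (A : cstarAlgType R).
Implicit Types (a b : A) (I : set A).

Lemma commutators_setT : commutators A `<=` commutators_of setT.
Proof. by move=> _ [a [b ->]]; exists a, b. Qed.

Lemma AF_commutators (B : nat -> set A) a : (forall n, fd_cstar_subalgebra (B n)) ->
  (forall n, B n `<=` B n.+1) -> closure (\bigcup_n B n) = setT ->
  closure (lin_span (commutators A)) a ->
  forall e : R, 0 < e -> exists n, exists2 x, lin_span (commutators_of (B n)) x & rnorm (a - x) < e.
Proof.
move=> Bfd Bmono Bd ac.
have Ble n m : (n <= m)%N -> B n `<=` B m.
  elim: m => [|m IH]; first by rewrite leqn0 => /eqP->.
  by rewrite leq_eqVlt => /orP[/eqP->//|/IH h]; exact: subset_trans h (Bmono m).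
have Cle n m : (n <= m)%N -> lin_span (commutators_of (B n)) `<=` lin_span (commutators_of (B m)).
  move=> nm; apply: lin_span_mono => _ [b [c [Bb Bc ->]]].
  by exists b, c; split=> //; exact: Ble nm _ _.
pose D := \bigcup_n lin_span (commutators_of (B n)).
suff : closure (lin_span (commutators A)) `<=` closure D.
  by move=> /(_ a ac)/closureP h e /h[x [n _ nx] ax]; exists n, x.
have Ds : is_subspace D.
  split.
  - by exists 0%N => //; case: (lin_span_subspace (commutators_of (B 0%N))).
  - move=> x y [n _ nx] [m _ my]; exists (maxn n m) => //.
    have [_ + _] := lin_span_subspace (commutators_of (B (maxn n m))); apply.
      exact: Cle (leq_maxl _ _) _ nx.
    exact: Cle (leq_maxr _ _) _ my.
  - move=> k x [n _ nx]; exists n => //.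
    by have [_ _] := lin_span_subspace (commutators_of (B n)); apply.
have clD : is_subspace (closure D).
  split; first by apply: subset_closure; case: Ds.
    move=> x y /closureP cx /closureP cy; apply/closureP => e e0.
    have e2 : 0 < e / 2 by rewrite divr_gt0.
    have [u Du xu] := cx _ e2; have [v Dv yv] := cy _ e2.
    exists (u + v); first by case: Ds => _ + _; apply.
    by rewrite opprD addrACA; apply: le_lt_trans (rnormD _ _) _; lra.
  move=> k x /closureP cx; apply/closureP => e e0.
  have k1 : 0 < cabs k + 1 by rewrite ltr_wpDl ?cabs_ge0.
  have e2 : 0 < e / (cabs k + 1) by rewrite divr_gt0.
  have [u Du xu] := cx _ e2; exists (k *: u); first by case: Ds => _ _; apply.
  rewrite -scalerBr rnormZ; rewrite ltr_pdivlMr // in xu.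
  by have := rnorm_ge0 (x - u); have := cabs_ge0 k; nra.
have BD b : closure (\bigcup_n B n) b by rewrite Bd.
suff h : commutators A `<=` closure D.
  rewrite [X in _ `<=` X](closure_id (closure D)).1; last exact: closed_closure.
  by apply: closureS; exact: lin_span_sub.
move=> _ [b [c ->]]; apply/closureP => e e0.
(* If [b'] and [c'] are within [d <= 1] of [b] and [c], the two commutators differ by at most
   [2 d (|b| + |c| + 1) = d N]; the extra factor 2 in [d] makes the final inequality strict. *)
pose N := 2 * (rnorm b + rnorm c + 1).
have N0 : 0 < N by rewrite /N; have := rnorm_ge0 b; have := rnorm_ge0 c; lra.
pose d := Num.min 1 (e / (2 * N)).
have d0 : 0 < d by rewrite lt_min ltr01 divr_gt0 // mulr_gt0.
have d1 : d <= 1 by rewrite ge_min lexx.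
have dN : d * (2 * N) <= e.
  have : d <= e / (2 * N) by rewrite ge_min lexx orbT.
  by rewrite ler_pdivlMr // mulr_gt0.
have [b' [n _ nb] bb] := (closureP _ _).1 (BD b) d d0.
have [c' [m _ mc] cc] := (closureP _ _).1 (BD c) d d0.
exists (b' ** c' - c' ** b').
  exists (maxn n m) => //; apply: sub_lin_span; exists b', c'; split=> //.
    exact: Ble (leq_maxl _ _) _ nb.
  exact: Ble (leq_maxr _ _) _ mc.
have -> : b ** c - c ** b - (b' ** c' - c' ** b') =
    (b ** (c - c') + (b - b') ** c') - ((c - c') ** b + c' ** (b - b')).
  by rewrite !cmulBr !cmulBl; linear_eq (R[i] : fieldType) A.
have c1 : rnorm c' <= rnorm c + 1.
  by rewrite -[c'](subKr c) opprB addrC; apply: le_trans (rnormD _ _) _; rewrite rnormBC addrC lerD2l (le_trans (ltW cc)).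
have h1 := rnormM b (c - c'); have h2 := rnormM (b - b') c'.
have h3 := rnormM (c - c') b; have h4 := rnormM c' (b - b').
have b0 := rnorm_ge0 b; have c0 := rnorm_ge0 c; have c0' := rnorm_ge0 c'.
have x0 := rnorm_ge0 (b - b'); have y0 := rnorm_ge0 (c - c').
have g1 := ler_pM b0 y0 (lexx _) (ltW cc).
have g2 := ler_pM x0 c0' (ltW bb) c1.
apply: le_lt_trans (rnormD _ _) _; rewrite rnormN.
have k1 := rnormD (b ** (c - c')) ((b - b') ** c').
have k2 := rnormD ((c - c') ** b) (c' ** (b - b')).
rewrite (mulrC (rnorm (c - c'))) in h3; rewrite (mulrC (rnorm c')) in h4.
have : d * N * 2 <= e by lra.
have dN0 : 0 < d * N by rewrite mulr_gt0.
rewrite /N in dN0 *; nra.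
Qed.

Lemma central_mod_comm I a : is_ideal I -> central_mod I a -> forall b, I (a ** b - b ** a).
Proof.
case=> Is _ _ ac b; have [I0 _ _] := Is.
have : coset I (b ** a) (a ** b) by rewrite -ac; exists 0; rewrite ?addr0.
by case=> i Ii <-; rewrite addrAC subrr add0r.
Qed.

Lemma AF_no_far_central I a : AF_algebra A -> is_ideal I ->
  closure (lin_span (commutators A)) a -> (forall b, I (a ** b - b ** a)) ->
  (forall i, I i -> 1 <= rnorm (a - i)) -> False.
Proof.
case=> B [Bfd Bmono Bd] Ii ac acent Ia.
have [K [pi [[prep _ _] pib piI [v v0] [l l1 lP]]]] := irreducible_with_scalar Ii acent Ia.
have h2 : 0 < 2^-1 :> R by rewrite invr_gt0.
have [n [x xs ax]] := AF_commutators Bfd Bmono Bd ac h2.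
have [[B0 BD BZ] BM BS [S /finite_seqP[s sE] SB]] := Bfd n.
have [_ piD piZ piM _] := prep.
have piB b c w : pi (b - c) w = pi b w - pi c w by rewrite piD -scaleN1r piZ scaleN1r.
have xB : B n x.
  apply: lin_span_sub xs; first by split.
  move=> _ [b [c [Bb Bc ->]]]; apply: subspaceB; [by split | exact: BM | exact: BM].
have [e [oe es eL]] := gram_schmidt [seq pi b v | b <- s].
pose L := [set pi b v | b in B n].
have Ls : is_subspace L.
  split.
  - by exists 0 => //; rewrite -(scale0r 0) piZ scale0r.
  - by move=> _ _ [b Bb <-] [c Bc <-]; exists (b + c); [exact: BD | rewrite piD].
  - by move=> k _ [b Bb <-]; exists (k *: b); [exact: BZ | rewrite piZ].
have SL b : b \in s -> B n b.
  by move=> bs; rewrite SB; apply: sub_lin_span; rewrite sE.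
have eInL y : y \in e -> L y.
  by apply: eL => // _ /mapP[b bs ->]; exists b => //; exact: SL.
have LV y : L y -> oproj e y = y.
  case=> b; rewrite SB => Bb <-.
  have : lin_span S `<=` [set b | oproj e (pi b v) = pi b v].
    apply: lin_span_sub.
      have [V0 VD VZ] := oproj_fixed_subspace e; split=> [|c d /= hc hd|k c /= hc] /=.
      - by rewrite -(scale0r 0) piZ scale0r.
      - by rewrite piD; exact: VD.
      - by rewrite piZ; exact: VZ.
    by move=> c; rewrite sE /= => cs; apply: es; exact: map_f.
  by apply.
have ax' w : rnorm (pi x w - l *: w) <= 2^-1 * rnorm w.
  rewrite -lP -piB; apply: le_trans (pib _ _) _.
  by rewrite ler_wpM2r ?rnorm_ge0 // rnormBC ltW.
(* The vector [v] itself need not lie in [pi(B) v], as [B] need not act with a unit. But [pi x v]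
   does, and it is nonzero, being within [|v| / 2] of [l v]. *)
have e0 : e != [::].
  apply/eqP => e0; have := LV (pi x v) (ex_intro2 _ _ x xB erefl).
  rewrite e0 /oproj big_nil => xv; have := ax' v; rewrite -xv sub0r rnormN rnormZ.
  have : 0 < rnorm v by rewrite lt_neqAle rnorm_ge0 andbT eq_sym; apply/eqP => /rnorm_eq0.
  nra.
have : cabs l <= 2^-1.
  apply: (trace_obstruction prep oe e0 _ xs) => [b y Bb /eInL[c Bc <-]|y ye].
    by rewrite -piM; apply: LV; exists (b ** c) => //; exact: BM.
  by have := ax' y; rewrite (orthonormal_rnorm oe ye) mulr1.
lra.
Qed.

Lemma postliminal_no_far_central I a : postliminal A -> is_ideal I ->
  closure (lin_span (commutators A)) a -> (forall b, I (a ** b - b ** a)) ->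
  (forall i, I i -> 1 <= rnorm (a - i)) -> False.
Proof.
move=> Apl Ii ac acent Ia.
have [M [Mi IM Ma Mmax]] := maximal_far_ideal Ii Ia.
have Mcent b : M (a ** b - b ** a) by exact: IM.
have [K [pi [pirr pib piM0 [v v0] [l l1 lP]]]] := irreducible_with_scalar Mi Mcent Ma.
have [prep _ _] := pirr; have [_ piD piZ piM piS] := prep.
have pi0 w : pi 0 w = 0 by rewrite -(scale0r 0) piZ scale0r.
have piB b c w : pi (b - c) w = pi b w - pi c w by rewrite piD -scaleN1r piZ scaleN1r.
(* Finite dimension is expressed by a finite orthonormal basis. All of [pi(A)] preserves its span,
   so the trace argument runs with [B = setT]. *)
have [[e [oe eT]]|Kinf] := pselect (exists e : seq K, orthonormal e /\ forall w, oproj e w = w).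
  have h2 : 0 < 2^-1 :> R by rewrite invr_gt0.
  have [x xs ax] := (closureP _ _).1 ac _ h2.
  have e0 : e != [::].
    by apply/eqP => e0; apply: v0; rewrite -(eT v) e0 /oproj big_nil.
  have : cabs l <= 2^-1.
    apply: (trace_obstruction (B := setT) prep oe e0) => //.
      exact: (lin_span_mono commutators_setT) xs.
    move=> y ye; rewrite -lP -piB; apply: le_trans (pib _ _) _.
    by rewrite (orthonormal_rnorm oe ye) mulr1 rnormBC ltW.
  lra.
(* the elements acting with finite rank *)
pose J0 : set A := [set x | exists s : seq K, forall L : set K, is_subspace L ->
  (forall y, y \in s -> L y) -> forall y, L (pi x y)].
have J0s : is_subspace J0.
  split.
  - by exists [::] => L [L0 _ _] _ y; rewrite pi0.
  - move=> x y [s hs] [t ht]; exists (s ++ t) => L Ls Lst w; rewrite piD.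
    have [_ LD _] := Ls; apply: LD; [apply: hs | apply: ht] => // z zs; apply: Lst.
      by rewrite mem_cat zs.
    by rewrite mem_cat zs orbT.
  - move=> k x [s hs]; exists s => L Ls Lst w; rewrite piZ.
    by case: (Ls) => _ _; apply; exact: hs.
have J0M b x : J0 x -> J0 (b ** x) /\ J0 (x ** b).
  case=> s hs; split; last by exists s => L Ls Lst y; rewrite piM; exact: hs.
  exists [seq pi b y | y <- s] => L Ls Lst y; rewrite piM.
  apply: (hs [set z | L (pi b z)]) => [|z zs]; last by apply: Lst; exact: map_f.
  have [L0 LD LZ] := Ls; split=> [|z w /= hz hw|k z /= hz] /=; rewrite ?linear0 ?linearD ?linearZ //.
    exact: LD.
  exact: LZ.
(* If [|a - x| < 1], a vector [z] killed by [pi x] satisfies [|l z| = |pi (a - x) z|], hence is 0.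
   The kernel contains the orthogonal complement of the finite-dimensional span of [f], so [f] would
   be a finite orthonormal basis. *)
have J0a x : J0 x -> 1 <= rnorm (a - x).
  case=> s hs; rewrite leNgt; apply/negP => ax1.
  have [e [oe es eL]] := gram_schmidt s.
  have xe y : oproj e (pi x y) = pi x y.
    by apply: (hs [set z | oproj e z = z]); [exact: oproj_fixed_subspace | exact: es].
  have [f [of_ fs fL]] := gram_schmidt [seq pi (cstar x) y | y <- e].
  apply: Kinf; exists f; split=> // w; apply/eqP; rewrite -subr_eq0; apply/eqP.
  set z := oproj f w - w.
  have zf y : y \in f -> inner z y = 0 by move=> yf; rewrite innerBl inner_oproj // subrr.
  have xz : pi x z = 0.
    (* [z] is orthogonal to [pi (cstar x) y] for all [y] in the basis [e] of the range *)
    rewrite -xe /oproj big_seq big1 // => y ye.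
    rewrite -[x]cstarK piS -(fs (pi (cstar x) y)) ?map_f //.
    by rewrite innerC oproj_orth ?rmorph0 ?scale0r.
  apply: rnorm_eq0; have := pib (a - x) z; rewrite piB xz subr0 lP rnormZ.
  by have := rnorm_ge0 z; nra.
(* This operator comes from some [t] in [A], which lies in [J0] and so in [M] by maximality; but
   [pi t v = |v|^2 v] is not 0, whereas [pi] kills [M]. *)
pose T0 := rank_one v.
pose T : {linear K -> K} := HB.pack T0 (GRing.isLinear.Build _ _ _ _ T0 (rank_one_linear v)).
have [t tT] : exists t, pi t =1 T by apply: (Apl K pi pirr); exact: (@rank_one_compact _ _ v).
have J0t : J0 t.
  exists [:: v] => L [_ _ LZ] Lv y; rewrite tT; apply: LZ; apply: Lv.
  by rewrite mem_head.
have MJ : M `<=` closure J0.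
  move=> m Mm; apply: subset_closure; exists [::] => L [L0 _ _] _ y.
  by rewrite piM0.
have /(Mmax _ (algebraic_ideal_closure J0s J0M) MJ) Mt : forall m, closure J0 m -> 1 <= rnorm (a - m).
  exact: dist_closure.
have := piM0 t v (Mt _ (subset_closure J0t)); rewrite tT => /eqP.
rewrite scaler_eq0 => /orP[/eqP/inner_eq0|/eqP]; exact: v0.
Qed.

End Corollary.

Theorem corollary4p11 (R : realType) (A : cstarAlgType R) :
  postliminal A \/ AF_algebra A ->
  closure (lin_span (commutators A)) `<=` CQ A.
Proof.
move=> PA a ac I Ii acent; have Icomm := central_mod_comm Ii acent.
exists 0, a; split; rewrite ?add0r //.
  by move=> b; rewrite cmul0l cmul0r.
have [[I0 ID IZ] _ Ic] := Ii.
apply: (closed_rnorm Ic) => d d0; apply/not_exists2P => h.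
have far i : I i -> d <= rnorm (a - i).
  by move=> Ii'; rewrite leNgt; apply/negP => ad; case: (h i).
have dn : d != 0 by rewrite gt_eqF.
pose a' := d^-1%:C *: a.
have aE : a = d%:C *: a' by rewrite scalerA -rmorphM /= mulfV // scale1r.
have far' i : I i -> 1 <= rnorm (a' - i).
  move=> Ii'; have := far _ (IZ d%:C i Ii').
  by rewrite {1}aE -scalerBr rnormZ cabs_real gtr0_norm // ler_pMr.
have ac' : closure (lin_span (commutators A)) a'.
  apply/closureP => e e0; have ed : 0 < e * d by rewrite mulr_gt0.
  have [x xs ax] := (closureP _ _).1 ac _ ed; exists (d^-1%:C *: x).
    by case: (lin_span_subspace (commutators A)) => _ _; apply.
  rewrite -scalerBr rnormZ cabs_real ger0_norm ?invr_ge0 ?ltW //.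
  by rewrite mulrC ltr_pdivrMr.
have comm' b : I (a' ** b - b ** a').
  rewrite cmulZl cmulZr -scalerBr; exact: IZ.
by case: PA => hA; [exact: (postliminal_no_far_central hA Ii ac' comm' far')
  | exact: (AF_no_far_central hA Ii ac' comm' far')].
Qed.
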